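(* Let $I_k=[a_k,b_k]$, $k=1,\dots,K$, be closed bounded intervals with $a_k<b_k$, any two of which intersect in at most one point. Let $\boldsymbol{I}=(I_1,\dots,I_K)$, let $\boldsymbol{n}=(n_1,\dots,n_K)$ be non-negative integers, and let $N=\sum_{k=1}^Kn_k$. Then $$\mathbf{S}^{\boldsymbol I}_{\boldsymbol n}(x)=\mathbf{S}^{\boldsymbol I,*}_{\boldsymbol n}(x)\,\mathsf{E}_{\boldsymbol n},\qquad \mathcal{H}[\mathbf{S}^{\boldsymbol I}_{\boldsymbol n}](x)=\mathbf{S}^{\boldsymbol I,*}_{\boldsymbol n}(x)\,\mathsf{H}_{\boldsymbol n}$$ for $x\in\mathbb{R}$, and $$\frac{\mathrm{d}}{\mathrm{d}x}[\mathbf{S}^{\boldsymbol I}_{\boldsymbol n}](x)=\mathbf{S}^{\boldsymbol I,*}_{\boldsymbol n}(x)\,\mathsf{D}^{\boldsymbol I}_{\boldsymbol n},\qquad (-\Delta)^{1/2}[\mathbf{S}^{\boldsymbol I}_{\boldsymbol n}](x)=\mathbf{S}^{\boldsymbol I,*}_{\boldsymbol n}(x)\,\mathsf{A}^{\boldsymbol I}_{\boldsymbol n}$$ for $x\in\mathbb{R}\setminus\{a_1,b_1,\dots,a_K,b_K\}$, where $\mathsf{E}_{\boldsymbol n},\mathsf{H}_{\boldsymbol n},\mathsf{D}^{\boldsymbol I}_{\boldsymbol n},\mathsf{A}^{\boldsymbol I}_{\boldsymbol n}\in\mathbb{R}^{(1+2N+6K)\times(1+2N+2K)}$ are the block diagonal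 matrices $$\mathsf{E}_{\boldsymbol n}=\mathrm{diag}(\mathsf{E}_{n_1},\mathsf{E}^\dagger_{n_2},\dots,\mathsf{E}^\dagger_{n_K}),\qquad \mathsf{H}_{\boldsymbol n}=\mathrm{diag}(\mathsf{H}_{n_1},\mathsf{H}^\dagger_{n_2},\dots,\mathsf{H}^\dagger_{n_K}),$$ $$\mathsf{D}^{\boldsymbol I}_{\boldsymbol n}=\mathrm{diag}(\mathsf{D}^{I_1}_{n_1},\mathsf{D}^{I_2,\dagger}_{n_2},\dots,\mathsf{D}^{I_K,\dagger}_{n_K}),\qquad \mathsf{A}^{\boldsymbol I}_{\boldsymbol n}=\mathrm{diag}(\mathsf{A}^{I_1}_{n_1},\mathsf{A}^{I_2,\dagger}_{n_2},\dots,\mathsf{A}^{I_K,\dagger}_{n_K}),$$ and $\dagger$ denotes the matrix with its first row and first column removed.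
   Context: $T_n,U_n$ are Chebyshev polynomials of the first and second kind, and $(1-x^2)_+^{\pm1/2}=0$ for $|x|\ge1$. $W_n(x)=(1-x^2)_+^{1/2}U_n(x)$ and $V_n(x)=(1-x^2)_+^{-1/2}T_n(x)$. $\tilde{T}_n(x)=T_n(x)$ for $|x|\le1$ and $\tilde{T}_n(x)=(x-\mathrm{sgn}(x)\sqrt{x^2-1})^n$ for $|x|>1$ (so $\tilde{T}_0\equiv1$). $\tilde{U}_{-2}(x)=\tilde{U}_{-1}(x)=0$ for $|x|\le1$; for $|x|>1$, $\tilde{U}_{-2}(x)=-\frac{|x|}{\sqrt{x^2-1}}$ and $\tilde{U}_{-1}(x)=-\frac{\mathrm{sgn}(x)}{\sqrt{x^2-1}}$. $\tilde{U}_0=\tilde{T}_0+\tilde{U}_{-2}$, and $\tilde{U}_n=2\tilde{T}_n+\tilde{U}_{n-2}$ for $n\ge1$. For $I=[a,b]$ and $y=\frac{2}{b-a}\left(x-\frac{a+b}{2}\right)$, set $\tilde{T}^I_n(x)=\tilde{T}_n(y)$, $\tilde{U}^I_n(x)=\tilde{U}_n(y)$, $W^I_n(x)=W_n(y)$, $V^I_n(x)=V_n(y)$. Quasimatrices (rows of functions): $\mathbf{S}^{\boldsymbol I}_{\boldsymbol n}=(\tilde{T}_0\,|\,\mathbf{S}^{\circ,I_1}_{n_1}\,|\cdots|\,\mathbf{S}^{\circ,I_K}_{n_K})$ with $\mathbf{S}^{\circ,I_k}_{n_k}=(W^{I_k}_0,\tilde{T}^{I_k}_1\,|\cdots|\,W^{I_k}_{n_k},\tilde{T}^{I_k}_{n_k+1})$,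 and $\mathbf{S}^{\boldsymbol I,*}_{\boldsymbol n}=(\tilde{U}^{I_1}_{-2}\,|\,\mathbf{S}^{\circ,I_1,*}_{n_1}\,|\cdots|\,\mathbf{S}^{\circ,I_K,*}_{n_K})$ with $\mathbf{S}^{\circ,I_k,*}_{n_k}=(V^{I_k}_0,\tilde{U}^{I_k}_{-1}\,|\cdots|\,V^{I_k}_{n_k+2},\tilde{U}^{I_k}_{n_k+1})$. Operators act column by column. Single-interval matrices in $\mathbb{R}^{(2n+7)\times(2n+3)}$: partition rows into a first row followed by $n+3$ blocks of size $2$ (block rows $0,\dots,n+2$), columns into a first column followed by $n+1$ blocks of size $2$ (block columns $0,\dots,n$). Let $\mathsf{N}=\begin{pmatrix}-1&0\\0&1\end{pmatrix}$, $\mathsf{M}=\begin{pmatrix}0&1\\1&0\end{pmatrix}$. All entries are zero except: $\mathsf{E}_n$ has in its first column $-1$ in the first row and $(0,1)^\top$ in block row $1$, and in block column $k$ ($0\le k\le n$) $-\mathsf{N}/2$ in block row $k$ and $\mathsf{N}/2$ in block row $k+2$; $\mathsf{H}_n$ has in block column $k$ $-\mathsf{M}/2$ in block row $k$ and $\mathsf{M}/2$ in block row $k+2$; $\mathsf{D}^I_n$ has in block column $k$ $\frac{2(k+1)}{b-a}\mathsf{N}$ in block row $k+1$; $\mathsf{A}^I_n$ has in block column $k$ $\frac{2(k+1)}{b-a}\mathsf{M}$ in block row $k+1$ (with $I=[a,b]$). $\mathcal{H}[u](x)=\frac1\pi\,\mathrm{p.v.}\!\int_{\mathbb{R}}\frac{u(y)}{x-y}\,\mathrm{d}y$,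 with $\mathcal{H}[\tilde{T}_0]=0$. For Schwartz $\phi$, $(-\Delta)^{1/2}\phi(x)=\frac1\pi\,\mathrm{p.v.}\!\int_{\mathbb{R}}\frac{\phi(x)-\phi(y)}{|x-y|^2}\,\mathrm{d}y$; for $u\in L^2(\mathbb{R})$, $(-\Delta)^{1/2}u$ is the distribution $\langle(-\Delta)^{1/2}u,\phi\rangle=\int_{\mathbb{R}} u\,(-\Delta)^{1/2}\phi\,\mathrm{d}x$, identified with a function when given by one; $(-\Delta)^{1/2}\tilde{T}_0=0$. *)

(* Defs.v *)
From HB Require Import structures.
From mathcomp Require Import all_boot all_order all_algebra.
From mathcomp Require Import all_classical all_reals all_analysis.
From mathcomp Require Import zify.

Set Implicit Arguments.
Unset Strict Implicit.
Unset Printing Implicit Defensive.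

Import Order.TTheory GRing.Theory Num.Theory.
Import numFieldNormedType.Exports.
Local Open Scope classical_set_scope.
Local Open Scope ring_scope.

Fixpoint chebT (R : realType) (n : nat) : {poly R} :=
  match n with
  | 0 => 1
  | 1 => 'X
  | (m.+1 as k).+1 => 2 *: 'X * chebT R k - chebT R m
  end.

Fixpoint chebU (R : realType) (n : nat) : {poly R} :=
  match n with
  | 0 => 1
  | 1 => 2 *: 'X
  | (m.+1 as k).+1 => 2 *: 'X * chebU R k - chebU R m
  end.

Section BasisFunctions.
Variable R : realType.
Implicit Types (x : R) (n : nat).

Definition W n x : R :=
  if `|x| < 1 then Num.sqrt (1 - x ^+ 2) * (chebU R n).[x] else 0.

Definition V n x : R :=
  if `|x| < 1 then (Num.sqrt (1 - x ^+ 2))^-1 * (chebT R n).[x] else 0.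

Definition Ttilde n x : R :=
  if `|x| <= 1 then (chebT R n).[x]
  else (x - Num.sg x * Num.sqrt (x ^+ 2 - 1)) ^+ n.

(* Index shifted by two: [Utilde2 m] is $\tilde U_{m-2}$. *)
Fixpoint Utilde2 (m : nat) x : R :=
  match m with
  | 0 => if `|x| <= 1 then 0 else - (`|x| / Num.sqrt (x ^+ 2 - 1))
  | 1 => if `|x| <= 1 then 0 else - (Num.sg x / Num.sqrt (x ^+ 2 - 1))
  | n.+2 => (if n == 0%N then Ttilde n x else 2 * Ttilde n x) + Utilde2 n x
  end.

Definition to_ref (a b x : R) : R := 2 / (b - a) * (x - (a + b) / 2).

End BasisFunctions.

Section Quasimatrices.
Variable R : realType.

Local Notation ncol n := (\sum_(j < n.+1) 2)%N.
Local Notation nrow n := (\sum_(i < n.+3) 2)%N.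

Definition qeval c (S : 'rV[R -> R]_c) (x : R) : 'rV[R]_c :=
  map_mx (fun f => f x) S.

Definition pair_row (f g : R -> R) : 'rV[R -> R]_2 :=
  \row_(i < 2) (if i == 0 then f else g).

Definition S0 (a b : R) (n : nat) : 'rV[R -> R]_(ncol n) :=
  \mxrow_(j < n.+1)
    pair_row (W j \o to_ref a b) (Ttilde j.+1 \o to_ref a b).

(* The second function of block [i] is $\tilde U^I_{i-1}$. *)
Definition S0star (a b : R) (n : nat) : 'rV[R -> R]_(nrow n) :=
  \mxrow_(i < n.+3)
    pair_row (V i \o to_ref a b) (Utilde2 i.+1 \o to_ref a b).

Definition matN : 'M[R]_2 :=
  \matrix_(i < 2, j < 2) (nth [::] [:: [:: -1; 0]; [:: 0; 1]] i)`_j.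

Definition matM : 'M[R]_2 :=
  \matrix_(i < 2, j < 2) (nth [::] [:: [:: 0; 1]; [:: 1; 0]] i)`_j.

Definition E1 (n : nat) : 'M[R]_(1 + nrow n, 1 + ncol n) :=
  block_mx (-1)%:M 0
    (\mxcol_(i < n.+3) (if i == 1%N :> nat then delta_mx 1 0 : 'cV[R]_2 else 0))
    (\mxblock_(i < n.+3, k < n.+1)
       (if i == k :> nat then - (2^-1 *: matN)
        else if i == k.+2 :> nat then 2^-1 *: matN else 0)).

Definition H1 (n : nat) : 'M[R]_(1 + nrow n, 1 + ncol n) :=
  block_mx 0 0 0
    (\mxblock_(i < n.+3, k < n.+1)
       (if i == k :> nat then - (2^-1 *: matM)
        else if i == k.+2 :> nat then 2^-1 *: matM else 0)).

Definition D1 (a b : R) (n : nat) : 'M[R]_(1 + nrow n, 1 + ncol n) :=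
  block_mx 0 0 0
    (\mxblock_(i < n.+3, k < n.+1)
       (if i == k.+1 :> nat then (2 * k.+1%:R / (b - a)) *: matN else 0)).

Definition A1 (a b : R) (n : nat) : 'M[R]_(1 + nrow n, 1 + ncol n) :=
  block_mx 0 0 0
    (\mxblock_(i < n.+3, k < n.+1)
       (if i == k.+1 :> nat then (2 * k.+1%:R / (b - a)) *: matM else 0)).

Definition dagger p q (A : 'M[R]_(1 + p, 1 + q)) : 'M[R]_(p, q) := drsubmx A.

Section Multi.
(* There are [K.+1] intervals [a k, b k]; interval $I_1$ has index [ord0]. *)
Variables (K : nat) (a b : 'I_K.+1 -> R) (n : 'I_K.+1 -> nat).

Local Notation nxt := (lift (@ord0 K)).

Lemma multi_cols :
  (1 + ncol (n ord0) + \sum_(k < K) ncol (n (nxt k)) =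
   1 + 2 * (\sum_k n k) + 2 * K.+1)%N.
Proof.
have e m : (ncol m = 2 * m + 2)%N by rewrite sum_nat_const card_ord; lia.
rewrite e (eq_bigr (fun k : 'I_K => 2 * n (nxt k) + 2)%N) => [|k _]; last exact: e.
by rewrite big_split -big_distrr sum_nat_const card_ord big_ord_recl /=; lia.
Qed.

Lemma multi_rows :
  (1 + nrow (n ord0) + \sum_(k < K) nrow (n (nxt k)) =
   1 + 2 * (\sum_k n k) + 6 * K.+1)%N.
Proof.
have e m : (nrow m = 2 * m + 6)%N by rewrite sum_nat_const card_ord; lia.
rewrite e (eq_bigr (fun k : 'I_K => 2 * n (nxt k) + 6)%N) => [|k _]; last exact: e.
by rewrite big_split -big_distrr sum_nat_const card_ord big_ord_recl /=; lia.
Qed.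

(* The casts only rewrite the block dimensions into the closed forms above. *)
Definition Smulti : 'rV[R -> R]_(1 + 2 * (\sum_k n k) + 2 * K.+1) :=
  castmx (erefl, multi_cols)
    (row_mx
       (row_mx (const_mx (Ttilde 0)) (S0 (a ord0) (b ord0) (n ord0)))
       (\mxrow_(k < K) S0 (a (nxt k)) (b (nxt k)) (n (nxt k)))).

Definition Smultistar : 'rV[R -> R]_(1 + 2 * (\sum_k n k) + 6 * K.+1) :=
  castmx (erefl, multi_rows)
    (row_mx
       (row_mx (const_mx (Utilde2 0 \o to_ref (a ord0) (b ord0)))
               (S0star (a ord0) (b ord0) (n ord0)))
       (\mxrow_(k < K) S0star (a (nxt k)) (b (nxt k)) (n (nxt k)))).

(* [conform_mx] only serves to type the block (i, j) when [i == j], as in the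
   library definition of [mxdiag], which is restricted to square blocks. *)
Definition multi_diag
    (A : forall k : 'I_K.+1, 'M[R]_(1 + nrow (n k), 1 + ncol (n k))) :
    'M[R]_(1 + 2 * (\sum_k n k) + 6 * K.+1, 1 + 2 * (\sum_k n k) + 2 * K.+1) :=
  castmx (multi_rows, multi_cols)
    (block_mx (A ord0) 0 0
      (\mxblock_(i < K, j < K)
         (if i == j then conform_mx 0 (dagger (A (nxt i))) else 0))).

Definition Emulti := multi_diag (fun k => E1 (n k)).
Definition Hmulti := multi_diag (fun k => H1 (n k)).
Definition Dmulti := multi_diag (fun k => D1 (a k) (b k) (n k)).
Definition Amulti := multi_diag (fun k => A1 (a k) (b k) (n k)).

End Multi.
End Quasimatrices.

Section Operators.
Variable R : realType.
Local Notation mu := (@lebesgue_measure R).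
Implicit Types (u f g phi : R -> R) (x l : R).

Definition pv_trunc g x (e : R) : R :=
  (\int[mu]_(y in [set y | e < `|x - y|]) g y)%R.

Definition is_pv g x l : Prop :=
  (forall e, 0 < e -> mu.-integrable [set y | e < `|x - y|] (EFin \o g)) /\
  pv_trunc g x e @[e --> 0^'+] --> l.

(* [is_hilbert u x l]: $\mathcal H[u](x)$ exists and equals [l]. *)
Definition is_hilbert u x l : Prop :=
  if `[< u = @Ttilde R 0 >] then l = 0
  else exists2 p, is_pv (fun y => u y / (x - y)) x p & l = pi^-1 * p.

Definition schwartz phi : Prop :=
  (forall k x, derivable (derive1n k phi) x 1) /\
  (forall m k, exists C, forall x, `|x ^+ m * derive1n k phi x| <= C).

(* Only used on Schwartz functions, for which the limit exists. *)
Definition half_laplacian_schwartz phi x : R :=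
  pi^-1 * lim (pv_trunc (fun y => (phi x - phi y) / `|x - y| ^+ 2) x e @[e --> 0^'+]).

(* [is_half_laplacian u f]: $(-\Delta)^{1/2} u$ is given by the function [f]. *)
Definition is_half_laplacian u f : Prop :=
  if `[< u = @Ttilde R 0 >] then f = cst 0
  else u \in Lfun mu 2%:E /\
    forall phi, schwartz phi ->
      mu.-integrable setT (EFin \o (fun x => f x * phi x)) /\
      (\int[mu]_x (u x * half_laplacian_schwartz phi x) =
       \int[mu]_x (f x * phi x))%R.

End Operators.

(* Main.v *)
(* If [G] is a primitive of [y |-> u y / (x - y)] away from [x] and
   [G (x + r) - G (x - r)] tends to 0 as [r] goes to 0, then the principal value
   defining the Hilbert transform of [u] at [x] is the limit of this difference as
   [r] goes to infinity. For [W 0] and [Ttilde 1] explicit primitives come from the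
   half-angle and Joukowski substitutions. Both families obey
   [u_{n+2} = 2 y u_{n+1} - u_n], and [y / (x - y) = x / (x - y) - 1] turns this
   into the same recurrence for the Hilbert transforms up to the integrals of the
   [u_n], whence H[W_n] = Ttilde_{n+1} and H[Ttilde_{n+1}] = - W_n on all of R.
   The half Laplacian of a Schwartz function [phi] is H[phi'], so antisymmetry of H
   and an integration by parts show that the half Laplacian of [u] is the derivative
   of H[u]. The matrices record these identities column by column. *)
Require Import Defs.
From HB Require Import structures.
From mathcomp Require Import all_boot all_order all_algebra.
From mathcomp Require Import all_classical all_reals all_analysis.
From mathcomp Require Import measurable_realfun.
From mathcomp Require Import ring lra.

Set Implicit Arguments.
Unset Strict Implicit.
Unset Printing Implicit Defensive.

Import Order.TTheory GRing.Theory Num.Theory.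
Import numFieldNormedType.Exports.
Local Open Scope classical_set_scope.
Local Open Scope ring_scope.

(** The analysis lives in one class of functions: Holder of exponent 1/2 and O(1/|x|). The exponent
    is forced by the endpoints, where square roots appear, and 1/|x| is all the decay that
    [Ttilde 1] has. The double integral behind the antisymmetry of H does not converge absolutely
    because of the kernel, so it is first proved by Fubini for the kernel cut off at distance e, and
    e is then sent to 0 by dominated convergence. A majorant exists because the Holder bound makes
    the truncation error O(sqrt e) with a constant controlled in [x], while the derivative of the
    test function supplies three powers of 1/(1 + |x|): one is spent on shifting weights between [x]
    and [y], two remain for integrability.

    The derivatives of the basis functions blow up at the endpoints; their integrability is read off
    from bounded primitives of majorants, not from explicit improper integrals. The constant
    [Ttilde 0] has no decay and stays outside the class; in the Hilbert transforms it enters only as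
    a starting value of the recurrence, with principal value 0 by symmetry. *)

(* [is_derive], opaque to instance resolution, which otherwise tries to infer every
   hypothesis of the form [is_derive _ _ _ _]. *)
Definition has_derive (R : realType) (f : R -> R) (y l : R) : Prop :=
  is_derive y 1 f l.

(** * Fundamental theorem of calculus off a finite set of exceptional points *)

Section FundamentalTheorem.
Variable R : realType.
Local Notation mu := (@lebesgue_measure R).

(** Induction on the exceptional points: a point of [S] strictly inside cuts the segment in two, and
    continuity makes the two constants agree there. With no point left this is the mean value
    theorem. *)
Lemma continuous_derive0_const (S : seq R) (H : R -> R) p q : p <= q ->
  {within `[p, q], continuous H} ->
  (forall y, y \in `]p, q[ -> y \notin S -> has_derive H y 0) ->
  H p = H q.
Proof.
elim: S p q => [|s S IH] p q pq cH dH.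
  have [c _ /eqP] := MVT_segment pq (fun y yI => dH y yI isT) cH.
  by rewrite mul0r subr_eq0 => /eqP.
have [/andP[ps sq]|sNI] := boolP (p < s < q).
  have Hps : H p = H s.
    apply: (IH _ _ (ltW ps)).
      by apply: continuous_subspaceW cH; apply: subset_itvl; rewrite bnd_simp ltW.
    move=> y; rewrite in_itv/= => /andP[py ys] yS; apply: dH.
      by rewrite in_itv/= py (lt_trans ys).
    by rewrite inE (lt_eqF ys).
  rewrite Hps; apply: (IH _ _ (ltW sq)).
    by apply: continuous_subspaceW cH; apply: subset_itvr; rewrite bnd_simp ltW.
  move=> y; rewrite in_itv/= => /andP[sy yq] yS; apply: dH.
    by rewrite in_itv/= yq (lt_trans ps).
  by rewrite inE (gt_eqF sy).
apply: (IH _ _ pq) => // y yI yS; apply: dH => //; rewrite inE negb_or yS andbT.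
by apply: contra sNI => /eqP <-; move: yI; rewrite in_itv.
Qed.

(* The parameterized integral of [g] and [G] differ by a continuous function
   whose derivative vanishes off [S]. *)
Lemma FTC_segment (S : seq R) (G g : R -> R) p q : p <= q ->
  (forall y, p <= y <= q -> {for y, continuous G}) ->
  (forall y, p < y < q -> y \notin S ->
     {for y, continuous g} /\ has_derive G y (g y)) ->
  mu.-integrable `[p, q] (EFin \o g) ->
  (\int[mu]_(y in `[p, q]) g y = G q - G p)%R.
Proof.
rewrite le_eqVlt => /predU1P[->|pq] cG dG ig.
  by rewrite set_itv1 Rintegral_set1 subrr.
pose H x := G x - parameterized_integral mu p x g.
have Ip : parameterized_integral mu p p g = 0.
  by rewrite /parameterized_integral set_itv1 Rintegral_set1.
suff : H p = H q by rewrite /H Ip subr0 => ->; rewrite subKr.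
apply: (@continuous_derive0_const S); first exact: ltW.
  move=> y; apply: cvgB; last first.
    by apply: parameterized_integral_continuous => //; exact: ltW.
  move: y; apply/continuous_within_itvP => //; split.
  - by move=> y; rewrite in_itv/= => /andP[py yq]; apply: cG; rewrite !ltW.
  - by apply: cvg_at_right_filter; apply: cG; rewrite lexx ltW.
  - by apply: cvg_at_left_filter; apply: cG; rewrite lexx ltW.
move=> y; rewrite in_itv/= => pyq yS; have [cg dGy] := dG y pyq yS.
have /andP[py yq] := pyq.
have [dI dIE] := continuous_FTC1_closed yq ig py cg.
have dIy : is_derive y 1 (fun x => parameterized_integral mu p x g) (g y).
  by split; [exact: dI|rewrite -derive1E; exact: dIE].
rewrite /has_derive -(subrr (g y)); exact: is_deriveB.
Qed.

End FundamentalTheorem.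

(** * Differentiation rules in terms of [has_derive] *)

Section DerivativeRules.
Variable R : realType.
Implicit Types (f g : R -> R) (y a b : R).

Lemma has_derive_eq f y a b : has_derive f y a -> a = b -> has_derive f y b.
Proof. by move=> ? <-. Qed.

Lemma has_derive_cst c y : has_derive (fun=> c) y 0.
Proof. exact: is_derive_cst. Qed.

Lemma has_derive_id y : has_derive (fun z => z) y 1.
Proof. exact: is_derive_id. Qed.

Lemma has_deriveD f g y a b : has_derive f y a -> has_derive g y b ->
  has_derive (fun z => f z + g z) y (a + b).
Proof. exact: is_deriveD. Qed.

Lemma has_deriveN f y a : has_derive f y a -> has_derive (fun z => - f z) y (- a).
Proof. exact: is_deriveN. Qed.

Lemma has_deriveB f g y a b : has_derive f y a -> has_derive g y b ->
  has_derive (fun z => f z - g z) y (a - b).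
Proof. exact: is_deriveB. Qed.

Lemma has_deriveM f g y a b : has_derive f y a -> has_derive g y b ->
  has_derive (fun z => f z * g z) y (a * g y + f y * b).
Proof.
move=> df dg; rewrite /has_derive addrC [a * _]mulrC; exact: is_deriveM.
Qed.

Lemma has_deriveX f y a n : has_derive f y a ->
  has_derive (fun z => f z ^+ n) y (n%:R * f y ^+ n.-1 * a).
Proof.
move=> df; rewrite (_ : (fun z => _) = (f ^+ n)%R); first exact: is_deriveX.
by rewrite exprfctE.
Qed.

Lemma has_deriveV f y a : f y != 0 -> has_derive f y a ->
  has_derive (fun z => (f z)^-1) y (- a / (f y) ^+ 2).
Proof.
move=> fy0 df; rewrite /has_derive mulNr mulrC -mulNr.
by have := @is_deriveV _ f y a 1 fy0 df.
Qed.

Lemma has_derive_comp f g y a b : has_derive f (g y) a -> has_derive g y b ->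
  has_derive (fun z => f (g z)) y (a * b).
Proof. exact: is_derive1_comp. Qed.

Lemma has_derive_near f g y a : (\forall z \near y, f z = g z) ->
  has_derive f y a -> has_derive g y a.
Proof. by move=> fg; exact: near_eq_is_derive. Qed.

Lemma has_derive_sqrt f y a : 0 < f y -> has_derive f y a ->
  has_derive (fun z => Num.sqrt (f z)) y (a / (2 * Num.sqrt (f y))).
Proof.
move=> fy0 df; rewrite mulrC; apply: (@has_derive_comp Num.sqrt f) => //.
exact: is_derive1_sqrt.
Qed.

Lemma has_derive_ln f y a : 0 < f y -> has_derive f y a ->
  has_derive (fun z => ln (f z)) y (a / f y).
Proof.
move=> fy0 df; rewrite mulrC; apply: (@has_derive_comp (@ln R) f) => //.
exact: is_derive1_ln.
Qed.

Lemma has_derive_atan f y a : has_derive f y a ->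
  has_derive (fun z => atan (f z)) y (a / (1 + f y ^+ 2)).
Proof.
move=> df; rewrite mulrC; apply: (@has_derive_comp (@atan R) f) => //.
exact: is_derive1_atan.
Qed.

(** Writing ln |f| as half of ln (f^2) avoids a split on the sign of [f]; the identity survives even
    at zeros of [f], because [ln 0] is 0. *)
Lemma has_derive_ln_norm f y a : f y != 0 -> has_derive f y a ->
  has_derive (fun z => ln `|f z|) y (a / f y).
Proof.
move=> fy0 df.
rewrite (_ : (fun z => _) = (fun z => 2^-1 * ln (f z ^+ 2))); last first.
  apply/funext => z; have [->|fz0] := eqVneq (f z) 0.
    by rewrite normr0 expr0n/= ln0// mulr0.
  rewrite -[f z ^+ 2]real_normK ?num_real// lnXn ?normr_gt0// mulr2n.
  by field.
apply: has_derive_eq; first apply: has_deriveM; first exact: has_derive_cst.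
  by apply: has_derive_ln; [rewrite exprn_even_gt0|exact: has_deriveX df].
by rewrite /=; field.
Qed.

Lemma has_derive_continuous f y a : has_derive f y a -> {for y, continuous f}.
Proof.
by move=> [dfy _]; apply/differentiable_continuous; rewrite -derivable1_diffP.
Qed.

End DerivativeRules.

(** * Dominated convergence for real-valued integrals *)

Section DominatedConvergence.
Variable R : realType.

Lemma dominated_cvg_Rintegral d (T : measurableType d)
    (mu : {measure set T -> \bar R}) (D : set T) (f_ : nat -> T -> R)
    (f h : T -> R) :
  measurable D -> (forall n, measurable_fun D (f_ n)) ->
  (forall x, D x -> f_ n x @[n --> \oo] --> f x) ->
  mu.-integrable D (EFin \o h) ->
  (forall n x, D x -> `|f_ n x| <= h x) ->
  mu.-integrable D (EFin \o f) /\
  ((\int[mu]_(x in D) f_ n x)%R @[n --> \oo] --> (\int[mu]_(x in D) f x)%R).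
Proof.
move=> mD mf_ f_f ih f_h.
have mf : measurable_fun D f by exact: measurable_fun_cvg mf_ f_f.
have [||||//|if' _ cf] := @dominated_convergence _ _ _ mu D mD
  (fun n => EFin \o f_ n) (EFin \o f) (EFin \o h).
- by move=> n; exact/measurable_EFinP.
- exact/measurable_EFinP.
- by apply: aeW => x Dx; apply: cvg_EFin; [exact: nearW|exact: f_f].
- exact: ih.
- by apply: aeW => x n Dx; rewrite /= lee_fin f_h.
split => //; apply: fine_cvg.
by rewrite /Rintegral fineK //; exact: integrable_fin_num.
Qed.

Local Notation mu := (@lebesgue_measure R).

(** Dominated convergence for [g] extended by zero from [D_ n], with |g| as majorant. *)
Lemma cvg_Rintegral_exhaustion (D : set R) (D_ : nat -> set R) (g : R -> R) :
  measurable D -> (forall n, measurable (D_ n)) -> (forall n, D_ n `<=` D) ->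
  (forall x, D x -> \forall n \near \oo, D_ n x) ->
  mu.-integrable D (EFin \o g) ->
  (\int[mu]_(x in D_ n) g x)%R @[n --> \oo] --> (\int[mu]_(x in D) g x)%R.
Proof.
move=> mD mD_ sD_ cD_ ig.
have mg : measurable_fun D g.
  by have /measurable_EFinP := measurable_int mu ig.
have [||||_ +] := @dominated_cvg_Rintegral _ _ mu D (fun n => g \_ (D_ n)) g
    (fun x => `|g x|) mD.
- move=> n; apply/(measurable_restrict g (mD_ n) mD).
  by apply: measurable_funS mg => //; exact: subIsetl.
- move=> x Dx; apply: cvg_near_cst; have := cD_ x Dx; apply: filterS => n Dnx.
  by rewrite patchE mem_set.
- exact: integrable_norm.
- by move=> n x Dx; rewrite patchE; case: ifP => // _; rewrite normr0.
- rewrite (_ : (fun n => _) = (fun n => (\int[mu]_(x in D_ n) g x)%R))//.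
  apply/funext => n.
  by rewrite -Rintegral_mkcondr; congr Rintegral; exact: setIidr.
Qed.

End DominatedConvergence.

(** * Improper integrals computed from primitives *)

Section ImproperIntegrals.
Variable R : realType.
Local Notation mu := (@lebesgue_measure R).
Implicit Types (f g G : R -> R) (S : seq R).

Lemma ring_setE (x e' e : R) : 0 < e' -> e' <= e ->
  [set y | e' < `|x - y| <= e] =
  `[x - e, x - e'[%classic `|` `]x + e', x + e]%classic.
Proof.
move=> e'0 e'e; apply/seteqP; split=> y /=; rewrite !in_itv/= ler_norml lter_normr.
  by move=> /andP[/orP[h|h] /andP[h1 h2]]; [left|right]; lra.
by move=> [] /andP[h1 h2]; apply/andP; split; lra.
Qed.

Lemma closed_ring_setE (x e' e : R) : 0 < e' -> e' <= e ->
  [set y | e' <= `|x - y| <= e] =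
  `[x - e, x - e']%classic `|` `[x + e', x + e]%classic.
Proof.
move=> e'0 e'e; apply/seteqP; split=> y /=; rewrite !in_itv/= ler_norml lter_normr.
  by move=> /andP[/orP[h|h] /andP[h1 h2]]; [left|right]; lra.
by move=> [] /andP[h1 h2]; apply/andP; split; lra.
Qed.

Lemma measurable_closed_ring (x e' e : R) : 0 < e' -> e' <= e ->
  measurable [set y | e' <= `|x - y| <= e].
Proof. by move=> e'0 e'e; rewrite closed_ring_setE//; exact: measurableU. Qed.

(** A ring open inside and closed outside is exactly what separates two of the sets [e < |x - y|]
    used for principal values; passing from half-open to closed intervals costs only null sets. *)
Lemma FTC_ring S G g x e' e : 0 < e' -> e' <= e ->
  (forall y, e' <= `|x - y| <= e -> {for y, continuous G}) ->
  (forall y, e' < `|x - y| < e -> y \notin S ->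
     {for y, continuous g} /\ has_derive G y (g y)) ->
  mu.-integrable [set y | e' <= `|x - y| <= e] (EFin \o g) ->
  (\int[mu]_(y in [set y | (e' < `|x - y| <= e)%R]) g y)%R =
    (G (x + e) - G (x - e)) - (G (x + e') - G (x - e')).
Proof.
move=> e'0 e'e cG dG ig.
have mD := measurable_closed_ring x e'0 e'e.
have il : mu.-integrable `[x - e, x - e'] (EFin \o g).
  by apply: integrableS ig => //; rewrite closed_ring_setE//; exact: subsetUl.
have ir : mu.-integrable `[x + e', x + e] (EFin \o g).
  by apply: integrableS ig => //; rewrite closed_ring_setE//; exact: subsetUr.
have lE : (\int[mu]_(y in `[x - e, x - e']) g y = G (x - e') - G (x - e))%R.
  apply: (@FTC_segment _ S) => //; first lra.
    move=> y /andP[h1 h2]; apply: cG; rewrite ger0_norm; last lra.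
    by apply/andP; split; lra.
  move=> y /andP[h1 h2]; apply: dG; rewrite ger0_norm; last lra.
  by apply/andP; split; lra.
have rE : (\int[mu]_(y in `[x + e', x + e]) g y = G (x + e) - G (x + e'))%R.
  apply: (@FTC_segment _ S) => //; first lra.
    move=> y /andP[h1 h2]; apply: cG; rewrite ler0_norm; last lra.
    by apply/andP; split; lra.
  move=> y /andP[h1 h2]; apply: dG; rewrite ler0_norm; last lra.
  by apply/andP; split; lra.
rewrite ring_setE// Rintegral_setU//; last 2 first.
- rewrite -ring_setE//; apply: integrableS ig => //=.
    by rewrite ring_setE//; exact: measurableU.
  by move=> y /= /andP[/ltW -> ->].
- apply/disj_setPS => y [] /=; rewrite !in_itv/= => /andP[h1 h2] /andP[h3 h4].
  lra.
rewrite Rintegral_itv_bndo_bndc; last first.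
  by apply: integrableS il => //; apply: subset_itvl; rewrite bnd_simp.
rewrite Rintegral_itv_obnd_cbnd; last first.
  by apply: integrableS ir => //; apply: subset_itvr; rewrite bnd_simp.
rewrite lE rE; lra.
Qed.

Lemma open_annulus (x e : R) : open [set y | e < `|x - y|].
Proof.
rewrite (_ : mkset _ = (fun y => `|x - y|) @^-1` [set r | e < r]); last by [].
apply: open_comp; last exact: open_gt.
by move=> y _; apply: cvg_norm; apply: cvgB; [exact: cvg_cst|exact: cvg_id].
Qed.

Lemma measurable_annulus (x e : R) : measurable [set y | e < `|x - y|].
Proof. by apply: open_measurable; exact: open_annulus. Qed.

(** The rings of radii [e] and [e + n] exhaust the domain of integration, so only the symmetric
    increments of [G] at infinity and at distance [e] survive. *)
Lemma FTC_punctured S G g x l :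
  (forall y, y != x -> {for y, continuous G}) ->
  (forall y, y != x -> y \notin S ->
     {for y, continuous g} /\ has_derive G y (g y)) ->
  (forall e, 0 < e -> mu.-integrable [set y | e < `|x - y|] (EFin \o g)) ->
  G (x + r) - G (x - r) @[r --> +oo] --> l ->
  forall e, 0 < e -> pv_trunc g x e = l - (G (x + e) - G (x - e)).
Proof.
move=> cG dG ig Gl e e0.
have neq y e' : 0 < e' -> e' <= `|x - y| -> y != x.
  move=> e'0 h; apply/eqP => yx; move: h; rewrite yx subrr normr0; lra.
pose D_ n := [set y | e < `|x - y| <= e + n%:R].
have mD_ n : measurable (D_ n).
  rewrite /D_ ring_setE//; first exact: measurableU.
  by rewrite lerDl.
have cD : (\int[mu]_(y in D_ n) g y)%R @[n --> \oo] --> pv_trunc g x e.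
  apply: cvg_Rintegral_exhaustion => //; first exact: measurable_annulus.
  - by move=> n y /= /andP[].
  - move=> y /= xy; near=> n; rewrite /D_/= xy/=.
    rewrite -lerBlDl; near: n; exact: nbhs_infty_ger.
  - exact: ig.
have DE n : (\int[mu]_(y in D_ n) g y)%R =
    (G (x + (e + n%:R)) - G (x - (e + n%:R))) - (G (x + e) - G (x - e)).
  apply: (@FTC_ring S) => //.
  - by rewrite lerDl.
  - by move=> y /andP[h _]; apply: cG; exact: neq h.
  - by move=> y /andP[/ltW h _]; apply: dG; exact: neq h.
  (* The closed ring contains the points at distance exactly [e], which the open annulus of radius
     [e] misses; half the radius covers them. *)
  - apply: integrableS (ig (e / 2) _) => //; last by rewrite divr_gt0.
    + exact: measurable_annulus.
    + by apply: measurable_closed_ring => //; rewrite lerDl.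
    + by move=> y /= /andP[h _]; lra.
apply: cvg_unique cD _ => //; rewrite (funext DE).
apply: cvgB; last exact: cvg_cst.
suff : e + n%:R @[n --> \oo] --> +oo by move=> h; exact: (cvg_comp _ _ h Gl).
apply/cvgryPge => A; near=> n; rewrite -lerBlDl; near: n.
exact: nbhs_infty_ger.
Unshelve. all: by end_near. Qed.

Lemma FTC_line S G g l : continuous G ->
  (forall y, y \notin S -> {for y, continuous g} /\ has_derive G y (g y)) ->
  mu.-integrable setT (EFin \o g) ->
  G r - G (- r) @[r --> +oo] --> l ->
  (\int[mu]_y g y)%R = l.
Proof.
move=> cG dG ig Gl.
pose D_ n := `[- n%:R, n%:R : R]%classic.
have cD : (\int[mu]_(y in D_ n) g y)%R @[n --> \oo] --> (\int[mu]_y g y)%R.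
  apply: cvg_Rintegral_exhaustion => //.
    by move=> n; exact: measurable_itv.
  move=> y _; near=> n; rewrite /D_/= in_itv/= -ler_norml; near: n; exact: nbhs_infty_ger.
have DE n : (\int[mu]_(y in D_ n) g y)%R = G n%:R - G (- n%:R).
  apply: (@FTC_segment _ S).
  - by have := ler0n R n; lra.
  - by move=> y _; exact: cG.
  - by move=> y _; exact: dG.
  - by apply: integrableS ig.
apply: cvg_unique cD _ => //; rewrite (funext DE).
exact: (cvg_comp _ _ (@cvgr_idn R) Gl).
Unshelve. all: by end_near. Qed.

End ImproperIntegrals.

(** * Integrability by comparison, and the weight 1/(1 + |x|) *)

Lemma integrable_bound d (T : measurableType d) (R : realType)
    (mu : {measure set T -> \bar R}) (D : set T) (f h : T -> R) :
  measurable D -> measurable_fun D f -> mu.-integrable D (EFin \o h) ->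
  (forall x, D x -> `|f x| <= h x) -> mu.-integrable D (EFin \o f).
Proof.
move=> mD mf ih fh; apply: le_integrable ih => //.
  exact/measurable_EFinP.
by move=> x Dx /=; rewrite lee_fin (le_trans (fh x Dx))// ler_norm.
Qed.

Section Integrability.
Variable R : realType.
Local Notation mu := (@lebesgue_measure R).
Implicit Types (f F h u : R -> R) (x y e : R).

(** On each segment the integral of |f| is at most the increment of [F], hence at most 2 C, and
    monotone convergence along the increasing segments keeps this bound. Integrands that blow up at
    the ends of [D] are covered without evaluating an improper integral. *)
Lemma integrable_derive_bound (p q : nat -> R) (D : set R) f F h C :
  D = \bigcup_n `[p n, q n]%classic ->
  {homo (fun n => `[p n, q n]%classic) : n m / (n <= m)%N >-> n `<=` m} ->
  (forall n, p n <= q n) -> measurable_fun D f ->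
  (forall y, D y -> {for y, continuous h}) ->
  (forall y, D y -> has_derive F y (h y)) ->
  (forall y, D y -> `|f y| <= h y) -> (forall y, D y -> `|F y| <= C) ->
  mu.-integrable D (EFin \o f).
Proof.
move=> DE homD pq mf ch dF fh FC.
have sD n : `[p n, q n]%classic `<=` D by move=> y yn; rewrite DE; exists n.
have mD : measurable D by rewrite DE; exact: bigcup_measurable.
apply/integrableP; split; first exact/measurable_EFinP.
apply: (@le_lt_trans _ _ (C + C)%:E); last exact: ltry.
rewrite [in X in (X <= _)%E]DE.
apply: (@cvge_le _ \oo _ _
  (fun n => (\int[mu]_(x in `[p n, q n]) (`|(EFin \o f) x|))%E)); last first.
  apply: ge0_nondecreasing_set_cvg_integral => //.
    by move=> n m nm; apply/subsetPset; exact: homD.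
  move=> n; apply: measurableT_comp => //; apply/measurable_EFinP.
  exact: measurable_funS (sD n) mf.
apply: nearW => n.
have ih : mu.-integrable `[p n, q n] (EFin \o h).
  apply: continuous_compact_integrable; first exact: segment_compact.
  apply: continuous_in_subspaceT => y /set_mem /sD; exact: ch.
apply: (@le_trans _ _ (\int[mu]_(x in `[p n, q n]) (EFin \o h) x)%E).
  apply: ge0_le_integral => //.
  - apply: measurableT_comp => //; apply/measurable_EFinP.
    exact: measurable_funS (sD n) mf.
  - exact: measurable_int ih.
  - by move=> y yI /=; rewrite lee_fin; apply: fh; exact: (sD n).
rewrite -[leLHS]fineK; last exact: integrable_fin_num.
rewrite lee_fin -[fine _]/(Rintegral mu _ h) (@FTC_segment _ [::] F)//.
- apply: (le_trans (ler_norm _)); apply: (le_trans (ler_normB _ _)).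
  by apply: lerD; apply: FC; apply: (sD n); rewrite /= in_itv/= lexx pq.
- move=> y yI; have /dF [dFy _] : D y by apply: (sD n); rewrite /= in_itv.
  by apply/differentiable_continuous; rewrite -derivable1_diffP.
- move=> y /andP[h1 h2] _.
  have Dy : D y by apply: (sD n); rewrite /= in_itv/= !ltW.
  by split; [exact: ch|exact: dF].
Qed.

(** The common scale for decay: its square is integrable, and unlike 1/|x| it is bounded and
    continuous everywhere. *)
Definition weight x : R := (1 + `|x|)^-1.

Lemma weight_gt0 x : 0 < weight x.
Proof. by rewrite invr_gt0 ltr_pwDl. Qed.

Lemma weight_le1 x : weight x <= 1.
Proof. by rewrite invf_le1 ?lerDl// ltr_pwDl. Qed.

Lemma weightK x : weight x * (1 + `|x|) = 1.
Proof. by rewrite mulVf// gt_eqF// ltr_pwDl. Qed.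

Lemma weightN x : weight (- x) = weight x.
Proof. by rewrite /weight normrN. Qed.

(** This is 1 + |x| <= (1 + |x - y|) (1 + |y|) in reciprocal form. It trades decay in [x - y] for
    decay in [x] at the price of one power of 1 + |y|. *)
Lemma weight_shift x y : weight (x - y) <= (1 + `|y|) * weight x.
Proof.
rewrite ler_pdivlMr ?ltr_pwDl// mulrC ler_pdivrMr ?ltr_pwDl//.
have := ler_normD (x - y) y; rewrite subrK => h.
have := normr_ge0 y; have := normr_ge0 (x - y); nra.
Qed.

Lemma continuous_weight : continuous weight.
Proof.
move=> x; apply: cvgV; first by rewrite gt_eqF// ltr_pwDl.
by apply: cvgD; [exact: cvg_cst|exact: cvg_norm].
Qed.

(** The majorant is 1/(1 + x^2), the derivative of the bounded function [atan]. *)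
Lemma integrable_weight2 : mu.-integrable setT (EFin \o (fun x => weight x ^+ 2)).
Proof.
apply: (@integrable_derive_bound (fun n => - n%:R) (fun n => n%:R) _ _ atan
  (fun x => (1 + x ^+ 2)^-1) (pi / 2)).
- apply/esym/seteqP; split => // x _.

  have [N /= Nx] : exists N : nat, `|x| <= N%:R.
    by exists (Num.bound `|x|); exact/ltW/archi_boundP.
  by exists N => //=; rewrite in_itv/= -ler_norml.
- move=> n m nm; apply: subset_itvScc; rewrite bnd_simp ?lerN2 ler_nat//.
- by move=> n; have := ler0n R n; lra.
- apply: continuous_measurable_fun => x; apply: continuousM;
    exact: continuous_weight.
- move=> y _; apply: cvgV; first by rewrite gt_eqF// ltr_pwDl// sqr_ge0.
  by apply: cvgD; [exact: cvg_cst|exact: exprn_continuous].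
- by move=> y _; exact: is_derive1_atan.
- move=> y _; rewrite ger0_norm ?exprn_ge0 ?(ltW (weight_gt0 y))// /weight exprVn /=.
  rewrite lef_pV2 ?posrE ?ltr_pwDl ?sqr_ge0 ?exprn_gt0//.
  have := normr_ge0 y; have := @real_normK _ y (num_real y); nra.
- move=> y _; rewrite ler_norml; have := @atan_ltpi2 R y.
  have := @atan_gtNpi2 R y; lra.
Qed.

End Integrability.

(** * Truncated kernels and principal values from primitives *)

Section PrincipalValue.
Variable R : realType.
Local Notation mu := (@lebesgue_measure R).
Implicit Types (u G P : R -> R) (x y e l L : R) (S : seq R).

(** Extending 1/t by zero over |t| <= e turns truncated integrals into integrals over the whole line
    with one measurable kernel, the form that Fubini requires. *)
Definition cut_kernel e (t : R) : R := if e < `|t| then t^-1 else 0.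

Lemma mem_annulus x e y : (y \in [set y | e < `|x - y|]) = (e < `|x - y|).
Proof. by apply/idP/idP => [/set_mem|?]; last exact/mem_set. Qed.

Lemma measurable_cut_kernel e : 0 < e -> measurable_fun setT (cut_kernel e).
Proof.
move=> e0.
have -> : cut_kernel e = (fun t => t^-1) \_ [set t | e < `|0 - t|].
  by apply/funext => t; rewrite patchE mem_annulus sub0r normrN.
apply/measurable_restrict => //; first exact: measurable_annulus.
rewrite setTI; apply: open_continuous_measurable_fun; first exact: open_annulus.
move=> t /set_mem /=; rewrite sub0r normrN => et; apply: cvgV; last exact: cvg_id.
by rewrite -normr_gt0 (lt_trans e0).
Qed.

(** For |t| > e, (1 + |t|)/|t| = 1 + 1/|t| is below 1 + 1/e. *)
Lemma cut_kernel_bound e t : 0 < e ->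
  `|cut_kernel e t| <= (1 + e^-1) * weight t.
Proof.
move=> e0; rewrite /cut_kernel; case: ifPn => [et|_]; last first.
  by rewrite normr0 mulr_ge0// ?addr_ge0// ?invr_ge0 ltW// weight_gt0.
have t0 : 0 < `|t| by rewrite (lt_trans e0).
rewrite normfV ler_pdivlMr ?ltr_pwDl// mulrDr mulr1 mulVf ?gt_eqF//.
by rewrite addrC lerD2l lef_pV2// ltW.
Qed.

Definition decays u := exists C, forall x, `|u x| <= C * weight x.

Lemma decays_ge0 u C : (forall x, `|u x| <= C * weight x) -> 0 <= C.
Proof.
by move=> /(_ 0) /(le_trans (normr_ge0 _)); rewrite pmulr_lge0 ?weight_gt0.
Qed.

Lemma measurable_mul_cut u x e : measurable_fun setT u -> 0 < e ->
  measurable_fun setT (fun y => u y * cut_kernel e (x - y)).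
Proof.
move=> mu0 e0; apply: measurable_funM => //.
apply: (measurableT_comp (measurable_cut_kernel e0)).
by apply: measurable_funB.
Qed.

(** One factor [weight y] comes from [u], the other from the kernel through [weight_shift]; the
    price is the linear growth in [x]. *)
Lemma mul_cut_bound u C x y e : 0 < e -> (forall y, `|u y| <= C * weight y) ->
  `|u y * cut_kernel e (x - y)| <=
  C * (1 + e^-1) * (1 + `|x|) * weight y ^+ 2.
Proof.
move=> e0 uC; rewrite normrM.
have h : `|cut_kernel e (x - y)| <= (1 + e^-1) * ((1 + `|x|) * weight y).
  apply: (le_trans (cut_kernel_bound _ e0)).
  rewrite ler_wpM2l ?addr_ge0 ?invr_ge0 ?(ltW e0)//.
  by rewrite -opprB weightN; exact: weight_shift.
apply: (le_trans (ler_pM (normr_ge0 _) (normr_ge0 _) (uC y) h)).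
by rewrite le_eqVlt; apply/orP; left; apply/eqP; ring.
Qed.

Lemma integrable_cst_weight2 C :
  mu.-integrable setT (EFin \o (fun y => C * weight y ^+ 2)).
Proof.
by have := integrableZl measurableT C (integrable_weight2 R).
Qed.

Lemma integrable_mul_cut u x e : measurable_fun setT u -> decays u -> 0 < e ->
  mu.-integrable setT (EFin \o (fun y => u y * cut_kernel e (x - y))).
Proof.
move=> mu0 [C uC] e0.
apply: (integrable_bound _ _ (integrable_cst_weight2
  (C * (1 + e^-1) * (1 + `|x|)))) => //; first exact: measurable_mul_cut.
by move=> y _; exact: mul_cut_bound.
Qed.

Lemma restrict_cut u x e :
  (fun y => u y / (x - y)) \_ [set y | e < `|x - y|] =
  (fun y => u y * cut_kernel e (x - y)).
Proof.
by apply/funext => y; rewrite patchE mem_annulus /cut_kernel; case: ifP; rewrite ?mulr0.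
Qed.

Lemma pv_trunc_cut u x e : pv_trunc (fun y => u y / (x - y)) x e =
  (\int[mu]_y (u y * cut_kernel e (x - y)))%R.
Proof. by rewrite /pv_trunc Rintegral_mkcond restrict_cut. Qed.

Lemma integrable_annulus u x e : measurable_fun setT u -> decays u -> 0 < e ->
  mu.-integrable [set y | e < `|x - y|] (EFin \o (fun y => u y / (x - y))).
Proof.
move=> mu0 du e0.
apply/integrable_mkcond; first exact: measurable_annulus.
by rewrite restrict_EFin restrict_cut; exact: integrable_mul_cut.
Qed.

(* Cutting out a symmetric interval leaves [l - (G (x + e) - G (x - e))], in
   which the logarithmic singularity of [G] at [x] cancels. *)
Definition odd_primitive S u x l := exists G : R -> R,
  [/\ forall y, y != x -> {for y, continuous G},
      forall y, y != x -> y \notin S -> has_derive G y (u y / (x - y)),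
      G (x + r) - G (x - r) @[r --> 0^'+] --> 0 &
      G (x + r) - G (x - r) @[r --> +oo] --> l].

Lemma pv_of_odd_primitive S u x l : continuous u -> decays u ->
  odd_primitive S u x l -> is_pv (fun y => u y / (x - y)) x l.
Proof.
move=> cu du [G [cG dG G0 Gl]].
have mu0 : measurable_fun setT u by exact: continuous_measurable_fun.
have ig e : 0 < e -> _ := @integrable_annulus u x e mu0 du.
split => //.
have E e : 0 < e -> pv_trunc (fun y => u y / (x - y)) x e =
    l - (G (x + e) - G (x - e)).
  apply: (@FTC_punctured _ S G _ x l) => // y yx yS; split; last exact: dG.
  apply: cvgM; first exact: cu.
  apply: cvgV; first by rewrite subr_eq0 eq_sym.
  by apply: cvgB; [exact: cvg_cst|exact: cvg_id].
rewrite -[X in _ --> X]subr0.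
have : l - (G (x + e) - G (x - e)) @[e --> 0^'+] --> l - 0.
  by apply: cvgB => //; exact: cvg_cst.
apply: cvg_trans; apply: near_eq_cvg.
by near=> e; rewrite E.
Unshelve. all: by end_near. Qed.

Lemma cvg_addr_right x : x + r @[r --> 0^'+] --> x.
Proof.
apply: cvg_at_right_filter; rewrite -[X in _ --> X]addr0.
by apply: cvgD; [exact: cvg_cst|exact: cvg_id].
Qed.

Lemma cvg_subr_right x : x - r @[r --> 0^'+] --> x.
Proof.
apply: cvg_at_right_filter; rewrite -[X in _ --> X]subr0.
by apply: cvgB; [exact: cvg_cst|exact: cvg_id].
Qed.

(** The primitive is [2 * x * G - 2 * P - G'], and [m] plays the part of the integral of [u]. It is
    a limit of symmetric increments because [Ttilde 1], of size 1/(2 |y|) at infinity, is not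
    integrable. *)
Lemma odd_primitive_rec S u u' P x l l' (m : R) : continuous P ->
  (forall y, y \notin S -> has_derive P y (u y)) ->
  P (x + r) - P (x - r) @[r --> +oo] --> m ->
  odd_primitive S u x l -> odd_primitive S u' x l' ->
  odd_primitive S (fun y => 2 * y * u y - u' y) x (2 * x * l - 2 * m - l').
Proof.
move=> cP dP Pm [G [cG dG G0 Gl]] [G' [cG' dG' G0' Gl']].
exists (fun y => 2 * x * G y - 2 * P y - G' y); split.
- move=> y yx; apply: cvgB; last exact: cG'.
  by apply: cvgB; apply: cvgM; try exact: cvg_cst; [exact: cG|exact: cP].
- move=> y yx yS; have xy0 : x - y != 0 by rewrite subr_eq0 eq_sym.
  apply: has_derive_eq.
    apply: has_deriveB (dG' _ yx yS); apply: has_deriveB; apply: has_deriveM.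
    - exact: has_derive_cst.
    - exact: dG.
    - exact: has_derive_cst.
    - exact: dP.
  by rewrite /=; field.
- have -> : (fun r => 2 * x * G (x + r) - 2 * P (x + r) - G' (x + r) -
      (2 * x * G (x - r) - 2 * P (x - r) - G' (x - r))) =
    (fun r => 2 * x * (G (x + r) - G (x - r)) - 2 * (P (x + r) - P (x - r)) -
      (G' (x + r) - G' (x - r))) by apply/funext => r; ring.
  rewrite [X in _ --> X](_ : 0 = 2 * x * 0 - 2 * (P x - P x) - 0); last by ring.
  apply: cvgB => //; apply: cvgB; apply: cvgM; try exact: cvg_cst; first by [].
  apply: cvgB.
    exact: (cvg_comp _ _ (@cvg_addr_right x) (cP x)).
  exact: (cvg_comp _ _ (@cvg_subr_right x) (cP x)).
- have -> : (fun r => 2 * x * G (x + r) - 2 * P (x + r) - G' (x + r) -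
      (2 * x * G (x - r) - 2 * P (x - r) - G' (x - r))) =
    (fun r => 2 * x * (G (x + r) - G (x - r)) - 2 * (P (x + r) - P (x - r)) -
      (G' (x + r) - G' (x - r))) by apply/funext => r; ring.
  apply: cvgB => //; apply: cvgB; apply: cvgM => //; exact: cvg_cst.
Qed.

(** The substitution z = c (y - d) multiplies both dy and x - y by [c]. The factors cancel and [l]
    is unchanged: the Hilbert transform commutes with translations and positive dilations. *)
Lemma odd_primitive_affine S u x l c d : 0 < c ->
  odd_primitive S u (c * (x - d)) l ->
  odd_primitive [seq s / c + d | s <- S] (fun y => u (c * (y - d))) x l.
Proof.
move=> c0 [G [cG dG G0 Gl]]; exists (fun y => G (c * (y - d))).
have neq y : y != x -> c * (y - d) != c * (x - d).
  by apply: contra_neq => /(mulfI (lt0r_neq0 c0)) /addIr.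
have shift : (fun r => G (c * (x + r - d)) - G (c * (x - r - d))) =
    (fun r => G (c * (x - d) + r) - G (c * (x - d) - r)) \o (fun r => c * r).
  apply/funext => r /=.
  by congr (G _ - G _); ring.
split.
- move=> y yx; apply: (@continuous_comp _ _ _ (fun y => c * (y - d)) G).
    apply: cvgM; first exact: cvg_cst.
    by apply: cvgB; [exact: cvg_id|exact: cvg_cst].
  exact/cG/neq.
- move=> y yx yS; apply: has_derive_eq.
    apply: (@has_derive_comp _ G); last first.
      apply: has_deriveM; first exact: has_derive_cst.
      by apply: has_deriveB; [exact: has_derive_id|exact: has_derive_cst].
    apply: dG; first exact: neq.
    apply: contra yS => cyS; apply/mapP; exists (c * (y - d)) => //.
    by field; rewrite gt_eqF.
  have xy0 : x - y != 0 by rewrite subr_eq0 eq_sym.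
  have -> : c * (x - d) - c * (y - d) = c * (x - y) by ring.
  by rewrite /=; field; rewrite xy0 gt_eqF.
- rewrite shift; apply: cvg_comp G0 => A [/= e e0 eA].
  exists (e / c); first exact: divr_gt0.
  move=> r; rewrite /= !sub0r !normrN => rec r0; apply: eA; last exact: mulr_gt0.
  by rewrite /= sub0r normrN normrM gtr0_norm// mulrC -ltr_pdivlMr.
- rewrite shift; apply: cvg_comp Gl => A [M [Mr MA]].
  exists (M / c); split; first by rewrite num_real.
  by move=> r; rewrite ltr_pdivrMr// mulrC; exact: MA.
Qed.

End PrincipalValue.
Lemma integrable_scale d (T : measurableType d) (R : realType)
    (mu : {measure set T -> \bar R}) (D : set T) (f : T -> R) k :
  measurable D -> mu.-integrable D (EFin \o f) ->
  mu.-integrable D (EFin \o (fun x => k * f x)).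
Proof. by move=> mD /(integrableZl mD k). Qed.

(** * Error made by truncating a principal value *)

Section TruncationError.
Variable R : realType.
Local Notation mu := (@lebesgue_measure R).
Implicit Types (u g : R -> R) (x y e L : R).

Lemma integrable_closed_ring g x e' e : 0 < e' -> e' <= e ->
  (forall y, y != x -> {for y, continuous g}) ->
  mu.-integrable [set y | e' <= `|x - y| <= e] (EFin \o g).
Proof.
move=> e'0 e'e cg; apply: continuous_compact_integrable.
  by rewrite closed_ring_setE//; apply: compactU; exact: segment_compact.
apply: continuous_in_subspaceT => y /set_mem /= /andP[h _]; apply: cg.
by apply/eqP => yx; move: h; rewrite yx subrr normr0; lra.
Qed.

Lemma continuous_inv_dist x y : y != x -> {for y, continuous (fun z => (x - z)^-1)}.
Proof.
move=> yx; apply: cvgV; first by rewrite subr_eq0 eq_sym.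
by apply: cvgB; [exact: cvg_cst|exact: cvg_id].
Qed.

Lemma has_derive_ln_dist x y : y != x ->
  has_derive (fun z => ln `|x - z|) y (- (x - y)^-1).
Proof.
move=> yx; have xy0 : x - y != 0 by rewrite subr_eq0 eq_sym.
apply: has_derive_eq; first (apply: has_derive_ln_norm; first exact: xy0).
  by apply: has_deriveB; [exact: has_derive_cst|exact: has_derive_id].
by rewrite sub0r mulNr mul1r.
Qed.

(** The primitive, minus the logarithm of the distance to [x], takes equal values at [x + r] and
    [x - r]. *)
Lemma integral_ring_inv x e' e : 0 < e' -> e' <= e ->
  (\int[mu]_(y in [set y | (e' < `|x - y| <= e)%R]) (x - y)^-1)%R = 0.
Proof.
move=> e'0 e'e.
have neq y : e' <= `|x - y| -> y != x.
  by move=> h; apply/eqP => yx; move: h; rewrite yx subrr normr0; lra.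
rewrite (@FTC_ring _ [::] (fun z => - ln `|x - z|))//.
- have E3 r : x - (x + r) = - r by ring.
  by rewrite !E3 !normrN; ring.
- move=> y /andP[/neq yx _]; apply: (@has_derive_continuous _ _ _ (x - y)^-1).
  by rewrite -[X in has_derive _ _ X]opprK; apply/has_deriveN/has_derive_ln_dist.
- move=> y /andP[/ltW /neq yx _] _; split; first exact: continuous_inv_dist.
  by rewrite -[X in has_derive _ _ X]opprK; apply/has_deriveN/has_derive_ln_dist.
- apply: integrable_closed_ring => // y; exact: continuous_inv_dist.
Qed.

Lemma continuous_inv_sqrt_dist x y : y != x ->
  {for y, continuous (fun z => (Num.sqrt `|x - z|)^-1)}.
Proof.
move=> yx; apply: cvgV; first by rewrite gt_eqF// sqrtr_gt0 normr_gt0 subr_eq0 eq_sym.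
apply: (@continuous_comp _ _ _ (fun z => `|x - z|) Num.sqrt).
  by apply: cvg_norm; apply: cvgB; [exact: cvg_cst|exact: cvg_id].
exact: sqrt_continuous.
Qed.

Lemma has_derive_sqrt_dist x y : y != x ->
  has_derive (fun z => Num.sg (z - x) * (2 * Num.sqrt `|x - z|)) y
    (Num.sqrt `|x - y|)^-1.
Proof.
move=> yx; have [xy|xy] : y < x \/ x < y by apply/orP; rewrite -neq_lt.
  apply: (@has_derive_near _ (fun z => - (2 * Num.sqrt (x - z)))).
    near=> z; have zx : z < x by near: z; exact: lt_nbhsl.
    by rewrite ltr0_sg ?subr_lt0// gtr0_norm ?subr_gt0// mulN1r.
  rewrite gtr0_norm ?subr_gt0//; apply: has_derive_eq.
    apply/has_deriveN/has_deriveM; first exact: has_derive_cst.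
    apply: has_derive_sqrt; first by rewrite subr_gt0.
    by apply: has_deriveB; [exact: has_derive_cst|exact: has_derive_id].
  by rewrite /=; field; rewrite gt_eqF// sqrtr_gt0 subr_gt0.
apply: (@has_derive_near _ (fun z => 2 * Num.sqrt (z - x))).
  near=> z; have zx : x < z by near: z; exact: lt_nbhsr.
  by rewrite gtr0_sg ?subr_gt0// distrC gtr0_norm ?subr_gt0// mul1r.
rewrite distrC gtr0_norm ?subr_gt0//; apply: has_derive_eq.
  apply: has_deriveM; first exact: has_derive_cst.
  apply: has_derive_sqrt; first by rewrite subr_gt0.
  by apply: has_deriveB; [exact: has_derive_id|exact: has_derive_cst].
by rewrite /=; field; rewrite gt_eqF// sqrtr_gt0 subr_gt0.
Unshelve. all: by end_near. Qed.

Lemma integral_ring_inv_sqrt x e' e : 0 < e' -> e' <= e ->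
  (\int[mu]_(y in [set y | (e' < `|x - y| <= e)%R]) (Num.sqrt `|x - y|)^-1)%R
  = 4 * Num.sqrt e - 4 * Num.sqrt e'.
Proof.
move=> e'0 e'e; have e0 : 0 < e by rewrite (lt_le_trans e'0).
have neq y : e' <= `|x - y| -> y != x.
  by move=> h; apply/eqP => yx; move: h; rewrite yx subrr normr0; lra.
rewrite (@FTC_ring _ [::] (fun z => Num.sg (z - x) * (2 * Num.sqrt `|x - z|)))//.
- have E1 r : x + r - x = r by ring.
  have E2 r : x - (x + r) = - r by ring.
  by rewrite !E1 !E2 !normrN !sgrN !gtr0_sg// !gtr0_norm//; ring.
- move=> y /andP[/neq yx _].
  exact: (has_derive_continuous (has_derive_sqrt_dist yx)).
- move=> y /andP[/ltW /neq yx _] _; split; first exact: continuous_inv_sqrt_dist.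
  exact: has_derive_sqrt_dist.
- apply: integrable_closed_ring => // y; exact: continuous_inv_sqrt_dist.
Qed.

(** Exponent one half is that of the square-root behavior of [W n] and [Ttilde n] at the endpoints.
    The constant is attached to the point [x] so that it may decay in [x]. *)
Definition holder_at u L x :=
  forall y, `|x - y| <= 1 -> `|u y - u x| <= L * Num.sqrt `|x - y|.

(** On the ring between the two radii the constant [u x] contributes nothing, since 1/(x - y) is odd
    about [x]. What remains is at most L |x - y|^(-1/2), whose integral is L (4 sqrt e - 4 sqrt e').
    The bound is uniform in [e'], so it serves both for convergence and for domination. *)
Lemma pv_trunc_diff u x L e' e : continuous u -> decays u -> holder_at u L x ->
  0 < e' -> e' <= e -> e <= 1 ->
  `|pv_trunc (fun y => u y / (x - y)) x e' - pv_trunc (fun y => u y / (x - y)) x e|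
  <= L * (4 * Num.sqrt e).
Proof.
move=> cu du hu e'0 e'e e1; have e0 : 0 < e by rewrite (lt_le_trans e'0).
pose ring := [set y | e' < `|x - y| <= e].
have mring : measurable ring by rewrite /ring ring_setE//; exact: measurableU.
have sring : ring `<=` [set y | e' <= `|x - y| <= e].
  by move=> y /= /andP[/ltW -> ->].
have iring g : (forall y, y != x -> {for y, continuous g}) ->
    mu.-integrable ring (EFin \o g).
  move=> cg; apply: integrableS (integrable_closed_ring e'0 e'e cg) => //.
  exact: measurable_closed_ring.
have ugE : (fun y => u y / (x - y)) =
    (fun y => (u y - u x) / (x - y) + u x * (x - y)^-1).
  by apply/funext => y; ring.
have iu : mu.-integrable ring (EFin \o (fun y => (u y - u x) / (x - y))).
  apply: iring => y yx; apply: cvgM; last exact: continuous_inv_dist.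
  by apply: cvgB; [exact: cu|exact: cvg_cst].
have ic : mu.-integrable ring (EFin \o (fun y => (x - y)^-1)).
  by apply: iring => y yx; exact: continuous_inv_dist.
have icu : mu.-integrable ring (EFin \o (fun y => u x * (x - y)^-1)).
  exact: integrable_scale.
have -> : pv_trunc (fun y => u y / (x - y)) x e' =
    (\int[mu]_(y in ring) ((u y - u x) / (x - y)))%R +
    pv_trunc (fun y => u y / (x - y)) x e.
  have setE : [set y | e' < `|x - y|] = ring `|` [set y | e < `|x - y|].
    apply/seteqP; split=> y /=.
      by case: (leP `|x - y| e) => h1 h2; [left; rewrite /ring /= h2 h1|right].
    by move=> [/andP[]//|]; apply: le_lt_trans.
  rewrite /pv_trunc [in LHS]setE Rintegral_setU//; last 3 first.
  - exact: measurable_annulus.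
  - rewrite -setE; apply: integrable_annulus => //.
    exact: continuous_measurable_fun.
  - by apply/disj_setPS => y [] /= /andP[_]; rewrite leNgt => /negP.
  congr (_ + _).
  by rewrite ugE RintegralD// RintegralZl// integral_ring_inv// mulr0 addr0.
rewrite addrK; apply: le_trans; first by apply: le_normr_Rintegral; [exact: mring|exact: iu].
have isq : mu.-integrable ring (EFin \o (fun y => (Num.sqrt `|x - y|)^-1)).
  by apply: iring => y yx; exact: continuous_inv_sqrt_dist.
apply: (@le_trans _ _ (\int[mu]_(y in ring) (L * (Num.sqrt `|x - y|)^-1))%R).
  apply: le_Rintegral => //.
  - exact: integrable_norm.
  - exact: integrable_scale.
  move=> y /andP[h1 h2]; rewrite normrM normfV.
  have xy0 : 0 < `|x - y| by rewrite (lt_trans e'0).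
  rewrite ler_pdivrMr// -[X in _ <= _ * X](@sqr_sqrtr _ `|x - y|)//.
  rewrite expr2 mulrA mulfVK ?gt_eqF ?sqrtr_gt0//.
  by apply: hu; rewrite (le_trans h2).
rewrite RintegralZl// integral_ring_inv_sqrt//.
have L0 : 0 <= L.
  have := hu (x + 1); rewrite opprD addNKr normrN normr1 sqrtr1 mulr1 => /(_ (lexx _)).
  by apply: le_trans.
by rewrite ler_wpM2l// gerBl mulr_ge0.
Qed.

End TruncationError.

(** * Antisymmetry of the Hilbert transform *)

Section HilbertAntisymmetry.
Variable R : realType.
Local Notation mu := (@lebesgue_measure R).
Implicit Types (u v psi : R -> R) (x y e L C : R).

Definition pv_limit u x := lim (pv_trunc (fun y => u y / (x - y)) x e @[e --> 0^'+]).

Lemma cvg_pv_trunc u L x : continuous u -> decays u -> holder_at u L x ->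
  pv_trunc (fun y => u y / (x - y)) x e @[e --> 0^'+] --> pv_limit u x.
Proof.
move=> cu du hu; apply: cauchy_cvg; apply: cauchy_exP => eps eps0.
have L0 : 0 <= L.
  have := hu (x + 1); rewrite opprD addNKr normrN normr1 sqrtr1 mulr1 => /(_ (lexx _)).
  by apply: le_trans.
(* With this [d] the truncation error 4 L sqrt d is at most (L / (L + 1)) (eps / 2) < eps. Using
   [L + 1] keeps the quotient defined when [L] is 0, and the minimum with 1 stays within the range
   of [pv_trunc_diff]. *)
pose d := Num.min 1 ((eps / (8 * (L + 1))) ^+ 2).
have q0 : 0 < eps / (8 * (L + 1)) by rewrite divr_gt0// mulr_gt0// ltr_wpDl.
have d0 : 0 < d by rewrite lt_min ltr01 exprn_gt0.
have dq : Num.sqrt d <= eps / (8 * (L + 1)).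
  rewrite -[leRHS]gtr0_norm// -sqrtr_sqr ler_wsqrtr//.
  by rewrite ge_min lexx orbT.
exists (pv_trunc (fun y => u y / (x - y)) x d).
suff : \forall e \near 0^'+, ball (pv_trunc (fun y => u y / (x - y)) x d) eps
  (pv_trunc (fun y => u y / (x - y)) x e) by [].
near=> e.
have e0 : 0 < e by near: e; exact: nbhs_right_gt.
have ed : e <= d by near: e; exact: nbhs_right_le.
have := pv_trunc_diff cu du hu e0 ed; rewrite ge_min lexx /= => /(_ isT) h.
rewrite /ball /= distrC (le_lt_trans h)//.
have : L * (4 * Num.sqrt d) <= L * (4 * (eps / (8 * (L + 1)))).
  by rewrite !ler_wpM2l.
move=> /le_lt_trans; apply.
have -> : L * (4 * (eps / (8 * (L + 1)))) = (L / (L + 1)) * (eps / 2).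
  by field; rewrite gt_eqF// ltr_wpDl.
have L1 : L / (L + 1) <= 1 by rewrite ler_pdivrMr ?ltr_wpDl// mul1r lerDl.
have : L / (L + 1) * (eps / 2) <= 1 * (eps / 2).
  by rewrite ler_wpM2r// divr_ge0// ltW.
lra.
Unshelve. all: by end_near. Qed.

Lemma cut_kernelN e t : cut_kernel e (- t) = - cut_kernel e t.
Proof. by rewrite /cut_kernel normrN; case: ifP; rewrite ?invrN ?oppr0. Qed.

Local Notation hilb e u x := (\int[mu]_y (u y * cut_kernel e (x - y)))%R.
Local Notation J := (\int[mu]_y (weight y ^+ 2))%R.

Lemma weight_integral_ge0 : 0 <= J.
Proof. by apply: Rintegral_ge0 => y _; rewrite exprn_ge0// ltW// weight_gt0. Qed.

Lemma trunc_bound_decays u C x e : 0 < e -> measurable_fun setT u ->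
  (forall y, `|u y| <= C * weight y) ->
  `|hilb e u x| <= (1 + e^-1) * C * J * (1 + `|x|).
Proof.
move=> e0 mu0 uC; have iu := @integrable_mul_cut _ u x e mu0 (ex_intro _ C uC) e0.
apply: le_trans; first by apply: le_normr_Rintegral; [exact: measurableT|exact: iu].
have -> : (1 + e^-1) * C * J * (1 + `|x|) =
    (\int[mu]_y (C * (1 + e^-1) * (1 + `|x|) * weight y ^+ 2))%R.
  by rewrite RintegralZl//; [ring|exact: integrable_weight2].
apply: le_Rintegral => //; first exact: integrable_norm.
  exact: integrable_cst_weight2.
by move=> y _; exact: mul_cut_bound.
Qed.

(** Here [weight_shift] moves the decay of the kernel to [x]. One of the three powers of [weight y]
    pays for the factor 1 + |y|, and the other two are integrable; this is where the cube comes
    from. *)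
Lemma trunc_bound_rapid u C x : measurable_fun setT u ->
  (forall y, `|u y| <= C * weight y ^+ 3) ->
  `|hilb 1 u x| <= 2 * C * J * weight x.
Proof.
move=> mu0 uC.
have C0 : 0 <= C.
  by have := le_trans (normr_ge0 _) (uC 0); rewrite pmulr_lge0// exprn_gt0// weight_gt0.
have du : decays u.
  exists C => y; apply: (le_trans (uC y)); rewrite ler_wpM2l// exprS.
  by rewrite ler_piMr ?exprn_ile1 ?weight_le1 ?(ltW (weight_gt0 y)).
have iu := @integrable_mul_cut _ u x 1 mu0 du ltr01.
apply: le_trans; first by apply: le_normr_Rintegral; [exact: measurableT|exact: iu].
have -> : 2 * C * J * weight x = (\int[mu]_y (2 * C * weight x * weight y ^+ 2))%R.
  by rewrite RintegralZl//; [ring|exact: integrable_weight2].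
apply: le_Rintegral => //; first exact: integrable_norm.
  exact: integrable_cst_weight2.
move=> y _; rewrite normrM.
have h : `|cut_kernel 1 (x - y)| <= 2 * ((1 + `|y|) * weight x).
  apply: (le_trans (cut_kernel_bound _ ltr01)); rewrite invr1.
  by rewrite ler_wpM2l//; exact: weight_shift.
apply: (le_trans (ler_pM (normr_ge0 _) (normr_ge0 _) (uC y) h)).
rewrite le_eqVlt; apply/orP; left; apply/eqP.
transitivity (2 * C * weight x * weight y ^+ 2 * (weight y * (1 + `|y|))); first ring.
by rewrite weightK mulr1.
Qed.

Lemma integrable_weight2_prod C : (mu \x mu)%E.-integrable setT
  (EFin \o (fun z : R * R => C * (weight z.1 ^+ 2 * weight z.2 ^+ 2))).
Proof.
have mw : measurable_fun setT (@weight R).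
  by apply: continuous_measurable_fun => x; exact: continuous_weight.
have mf : measurable_fun setT
    (fun z : R * R => C * (weight z.1 ^+ 2 * weight z.2 ^+ 2)).
  apply: measurable_funM => //; apply: measurable_funM; apply: measurable_funX.
    exact: measurableT_comp.
  exact: measurableT_comp.
apply/integrable12ltyP; first exact/measurable_EFinP.
have w0 x : 0 <= weight x ^+ 2 :> R by rewrite exprn_ge0// ltW// weight_gt0.
have -> : (fun x => \int[mu]_y `|(EFin \o (fun z : R * R =>
    C * (weight z.1 ^+ 2 * weight z.2 ^+ 2))%R) (x, y)|)%E =
    (fun x => (`|C| * J * weight x ^+ 2)%:E).
  apply/funext => x.
  under eq_integral => y _ do rewrite /= normrM (ger0_norm (mulr_ge0 (w0 x) (w0 y))).
  rewrite -[LHS]fineK; last first.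
    apply: integrable_fin_num => //.
    have := integrable_cst_weight2 (`|C| * weight x ^+ 2).
    apply: eq_integrable => // y _ /=; congr EFin; ring.
  congr EFin; rewrite -[LHS]/(Rintegral mu setT (fun y =>
    `|C| * (weight x ^+ 2 * weight y ^+ 2))).
  have -> : (fun y => `|C| * (weight x ^+ 2 * weight y ^+ 2)) =
      (fun y => `|C| * weight x ^+ 2 * weight y ^+ 2) by apply/funext => y; ring.
  by rewrite RintegralZl//; [ring|exact: integrable_weight2].
suff : (\int[mu]_x (`|C| * J * weight x ^+ 2)%:E)%E \is a fin_num.
  by rewrite fin_numElt => /andP[].
by apply: integrable_fin_num => //; exact: integrable_cst_weight2.
Qed.

(** The cut kernel is odd, so exchanging the two integrals changes the sign. Fubini applies because
    the integrand is below a multiple of [weight x ^+ 2 * weight y ^+ 2]: the third power of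
    [weight y] is spent on the factor 1 + |y| of [weight_shift]. *)
Lemma truncated_antisymmetry u psi C C' e : 0 < e ->
  measurable_fun setT u -> measurable_fun setT psi ->
  (forall y, `|u y| <= C * weight y) -> (forall y, `|psi y| <= C' * weight y ^+ 3) ->
  [/\ measurable_fun setT (fun x => u x * hilb e psi x),
      measurable_fun setT (fun y => psi y * hilb e u y) &
      (\int[mu]_x (u x * hilb e psi x))%R = - (\int[mu]_y (psi y * hilb e u y))%R].
Proof.
move=> e0 mu0 mpsi uC psiC'.
have C'0 : 0 <= C'.
  by have := le_trans (normr_ge0 _) (psiC' 0); rewrite pmulr_lge0// exprn_gt0// weight_gt0.
have dpsi : decays psi.
  exists C' => y; apply: (le_trans (psiC' y)); rewrite ler_wpM2l// exprS.
  by rewrite ler_piMr ?exprn_ile1 ?weight_le1 ?(ltW (weight_gt0 y)).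
have du : decays u by exists C.
pose h (z : R * R) := u z.1 * psi z.2 * cut_kernel e (z.1 - z.2).
have mh : measurable_fun setT h.
  apply: measurable_funM.
    by apply: measurable_funM; exact: measurableT_comp.
  apply: (measurableT_comp (measurable_cut_kernel e0)).
  by apply: measurable_funB.
have ih : (mu \x mu)%E.-integrable setT (EFin \o h).
  apply: (integrable_bound _ _ (integrable_weight2_prod (C * C' * (1 + e^-1)))) => //.
  move=> [x y] _; rewrite /h /= normrM normrM.
  have h1 : `|cut_kernel e (x - y)| <= (1 + e^-1) * ((1 + `|y|) * weight x).
    apply: (le_trans (cut_kernel_bound _ e0)).
    by rewrite ler_wpM2l ?addr_ge0 ?invr_ge0 ?(ltW e0)//; exact: weight_shift.
  have h2 := ler_pM (normr_ge0 _) (normr_ge0 _) (uC x) (psiC' y).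
  apply: (le_trans (ler_pM (mulr_ge0 (normr_ge0 _) (normr_ge0 _)) (normr_ge0 _) h2 h1)).
  rewrite le_eqVlt; apply/orP; left; apply/eqP.
  transitivity (C * C' * (1 + e^-1) * (weight x ^+ 2 * weight y ^+ 2) *
    (weight y * (1 + `|y|))); first ring.
  by rewrite weightK mulr1.
have FE x : (\int[mu]_y (h (x, y))%:E)%E = (u x * hilb e psi x)%:E.
  have ipsi := integrable_mul_cut x mpsi dpsi e0.
  rewrite -RintegralZl// /Rintegral fineK.
    by apply: eq_integral => y _; rewrite /h /= mulrA.
  by apply: integrable_fin_num => //; exact: integrable_scale.
have GE y : (\int[mu]_x (h (x, y))%:E)%E = (- (psi y * hilb e u y))%:E.
  have iu := integrable_mul_cut y mu0 du e0.
  rewrite -mulNr -RintegralZl// /Rintegral fineK.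
    apply: eq_integral => x _; rewrite /h /= -[x - y]opprB cut_kernelN.
    by congr EFin; ring.
  by apply: integrable_fin_num => //; exact: integrable_scale.
have mF := measurable_fubini_F ih; have mG := measurable_fubini_G ih.
have := Fubini ih.
rewrite /fubini_F /fubini_G in mF mG.
have FE' : (fun x => \int[mu]_y (EFin \o h) (x, y))%E =
  EFin \o (fun x => u x * hilb e psi x) by apply/funext => x; exact: FE.
have GE' : (fun y => \int[mu]_x (EFin \o h) (x, y))%E =
  EFin \o (fun y => - (psi y * hilb e u y)) by apply/funext => y; exact: GE.
rewrite FE' in mF *; rewrite GE' in mG * => EQ.
split.
- exact/measurable_EFinP.
- move/measurable_EFinP : mG => /(measurable_funN).
  by rewrite (_ : \- _ = fun y => psi y * hilb e u y)//; apply/funext => y; rewrite /= opprK.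
have iG : mu.-integrable setT (EFin \o (fun y => - (psi y * hilb e u y))).
  apply: (integrable_bound _ _ (integrable_cst_weight2
    (C' * ((1 + e^-1) * C * J)))) => //; first exact/measurable_EFinP.
  move=> y _; rewrite normrN normrM.
  apply: (le_trans (ler_pM (normr_ge0 _) (normr_ge0 _) (psiC' y)
    (trunc_bound_decays y e0 mu0 uC))).
  rewrite le_eqVlt; apply/orP; left; apply/eqP.
  transitivity (C' * ((1 + e^-1) * C * J) * weight y ^+ 2 *
    (weight y * (1 + `|y|))); first ring.
  by rewrite weightK mulr1.
transitivity (\int[mu]_y (- (psi y * hilb e u y)))%R; first by rewrite /Rintegral EQ.
have : (\int[mu]_y (-1 * - (psi y * hilb e u y)))%R =
    -1 * (\int[mu]_y (- (psi y * hilb e u y)))%R by rewrite RintegralZl.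
have -> : (fun y => -1 * - (psi y * hilb e u y)) = (fun y => psi y * hilb e u y).
  by apply/funext => y; rewrite mulN1r opprK.
by move=> ->; rewrite mulN1r opprK.
Qed.

(** The limit of [truncated_antisymmetry] along the radii 1/(n + 1). On the left [u] gives one power
    of [weight] and the truncated transform of [psi] another; on the right the three powers of [psi]
    absorb the linear growth allowed for the transform of [u]. Either way a multiple of the squared
    weight dominates. *)
Lemma hilbert_antisymmetry u v psi C C' L L' :
  continuous u -> continuous psi ->
  (forall y, `|u y| <= C * weight y) -> (forall y, `|psi y| <= C' * weight y ^+ 3) ->
  (forall x, holder_at u L x) -> (forall x, holder_at psi (L' * weight x) x) ->
  (forall x, is_pv (fun y => u y / (x - y)) x (v x)) ->
  mu.-integrable setT (EFin \o (fun x => u x * pv_limit psi x)) /\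
  (\int[mu]_x (u x * pv_limit psi x))%R = - (\int[mu]_y (psi y * v y))%R.
Proof.
move=> cu cpsi uC psiC' hu hpsi pv.
have mu0 := continuous_measurable_fun cu.
have mpsi := continuous_measurable_fun cpsi.
have wpos x : 0 <= weight x :> R by rewrite ltW// weight_gt0.
have C0 := decays_ge0 uC.
have C'0 : 0 <= C'.
  by have := le_trans (normr_ge0 _) (psiC' 0); rewrite pmulr_lge0// exprn_gt0// weight_gt0.
have L'0 : 0 <= L'.
  have := hpsi 0 (0 + 1).
  rewrite opprD addNKr normrN normr1 sqrtr1 mulr1 => /(_ (lexx _)) /(le_trans (normr_ge0 _)).
  by rewrite pmulr_lge0// weight_gt0.
have L0 : 0 <= L.
  have := hu 0 (0 + 1).
  by rewrite opprD addNKr normrN normr1 sqrtr1 mulr1 => /(_ (lexx _)); exact: le_trans.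
have dpsi : decays psi.
  exists C' => y; apply: (le_trans (psiC' y)); rewrite ler_wpM2l// exprS.
  by rewrite ler_piMr ?exprn_ile1 ?weight_le1.
have du : decays u by exists C.
pose e_ n : R := n.+1%:R^-1.
have e_0 n : 0 < e_ n by rewrite invr_gt0.
have e_1 n : e_ n <= 1 by rewrite invf_le1// ler1n.
have sub f (l : R) x : pv_trunc (fun y => f y / (x - y)) x e @[e --> 0^'+] --> l ->
    hilb (e_ n) f x @[n --> \oo] --> l.
  move=> h0; have h := (cvg_at_rightP _ _ _).1 h0 e_; rewrite (_ : (fun n => _) =
    (fun n => pv_trunc (fun y => f y / (x - y)) x (e_ n))); last first.
    by apply/funext => n; rewrite pv_trunc_cut.
  by apply: h; split => //; exact: cvg_harmonic.
have sq1 n : 4 * Num.sqrt (e_ n) <= 4.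
  by rewrite ler_piMr// -[leRHS]sqrtr1 ler_wsqrtr.
have J0 := weight_integral_ge0.
(* Truncation at radius 1 gives 2 C' J, and passing from radius 1 to [e_ n] costs at most 4 L',
   uniformly in [n]; both come with the factor [weight x]. *)
have hpsi_bound n x : `|hilb (e_ n) psi x| <= (2 * C' * J + 4 * L') * weight x.
  have := pv_trunc_diff cpsi dpsi (hpsi x) (e_0 n) (e_1 n) (lexx 1).
  rewrite !pv_trunc_cut sqrtr1 mulr1 => h1.
  have h2 := trunc_bound_rapid x mpsi psiC'.
  have := ler_distD 0 (hilb (e_ n) psi x) (hilb 1 psi x).
  have := lerB_normD (hilb (e_ n) psi x) (- hilb 1 psi x).
  rewrite normrN; lra.
have hu_bound n x : `|hilb (e_ n) u x| <= (2 * C * J + 4 * L) * (1 + `|x|).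
  have := pv_trunc_diff cu du (hu x) (e_0 n) (e_1 n) (lexx 1).
  rewrite !pv_trunc_cut sqrtr1 mulr1 => h1.
  have := trunc_bound_decays x ltr01 mu0 uC; rewrite invr1 => h2.
  have := lerB_normD (hilb (e_ n) u x) (- hilb 1 u x).
  have : 4 * L * 1 <= 4 * L * (1 + `|x|).
    by rewrite ler_wpM2l ?mulr_ge0// lerDl.
  rewrite normrN; lra.
have anti n := truncated_antisymmetry (e_0 n) mu0 mpsi uC psiC'.
have [||||iu lim1] := @dominated_cvg_Rintegral _ _ _ mu setT
    (fun n x => u x * hilb (e_ n) psi x) (fun x => u x * pv_limit psi x)
    (fun x => C * (2 * C' * J + 4 * L') * weight x ^+ 2) measurableT.
- by move=> n; have [] := anti n.
- move=> x _; apply: cvgM; first exact: cvg_cst.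
  exact/sub/(cvg_pv_trunc cpsi dpsi (hpsi x)).
- exact: integrable_cst_weight2.
- move=> n x _; rewrite normrM.
  apply: (le_trans (ler_pM (normr_ge0 _) (normr_ge0 _) (uC x) (hpsi_bound n x))).
  by rewrite le_eqVlt; apply/orP; left; apply/eqP; ring.
have [||||_ lim2] := @dominated_cvg_Rintegral _ _ _ mu setT
    (fun n x => psi x * hilb (e_ n) u x) (fun x => psi x * v x)
    (fun x => C' * (2 * C * J + 4 * L) * weight x ^+ 2) measurableT.
- by move=> n; have [] := anti n.
- move=> x _; apply: cvgM; first exact: cvg_cst.
  by apply: sub; have [] := pv x.
- exact: integrable_cst_weight2.
- move=> n x _; rewrite normrM.
  apply: (le_trans (ler_pM (normr_ge0 _) (normr_ge0 _) (psiC' x) (hu_bound n x))).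
  rewrite le_eqVlt; apply/orP; left; apply/eqP.
  transitivity (C' * (2 * C * J + 4 * L) * weight x ^+ 2 * (weight x * (1 + `|x|))).
    by ring.
  by rewrite weightK mulr1.
split; first exact: iu.
apply: cvg_unique lim1 _ => //.
rewrite (_ : (fun n => _) = (fun n => - (\int[mu]_y (psi y * hilb (e_ n) u y))%R)).
  exact: cvgN.
by apply/funext => n; have [] := anti n.
Qed.

End HilbertAntisymmetry.

(** * Half Laplacian of Schwartz functions *)

Section HalfLaplacian.
Variable R : realType.
Local Notation mu := (@lebesgue_measure R).
Implicit Types (u v f phi : R -> R) (x y e L C : R).

(** Induction on [m]: one more factor 1 + |x| splits into the same expression and the one with an
    extra power of [x], which is why the power [j] is generalised first. *)
Lemma schwartz_bound phi k m : schwartz phi ->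
  exists C, forall x, `|derive1n k phi x| <= C * weight x ^+ m.
Proof.
move=> [_ bd].
suff /(_ 0%N) [C hC] : forall j, exists C,
    forall x, (1 + `|x|) ^+ m * `|x ^+ j * derive1n k phi x| <= C.
  exists C => x; have := hC x; rewrite expr0 mul1r => h.
  by rewrite /weight exprVn ler_pdivlMr ?exprn_gt0 ?ltr_pwDl// mulrC.
elim: m => [|m IH] j.
  by have [C hC] := bd j k; exists C => x; rewrite expr0 mul1r.
have [[C1 h1] [C2 h2]] := (IH j, IH j.+1).
exists (C1 + C2) => x.
have -> : (1 + `|x|) ^+ m.+1 * `|x ^+ j * derive1n k phi x| =
  (1 + `|x|) ^+ m * `|x ^+ j * derive1n k phi x| +
  (1 + `|x|) ^+ m * `|x ^+ j.+1 * derive1n k phi x|.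
  by rewrite !exprS !normrM; ring.
exact: lerD.
Qed.

Lemma schwartz_derive phi k x : schwartz phi ->
  has_derive (derive1n k phi) x (derive1n k.+1 phi x).
Proof.
by move=> [der _]; rewrite /has_derive derive1nS derive1E; exact/derivableP.
Qed.

Lemma schwartz_continuous phi k : schwartz phi -> continuous (derive1n k phi).
Proof. by move=> sphi x; exact: has_derive_continuous (schwartz_derive k x sphi). Qed.

Lemma has_derive_lipschitz f (f' : R -> R) x y M :
  (forall z, has_derive f z (f' z)) ->
  (forall z, Num.min x y <= z <= Num.max x y -> `|f' z| <= M) ->
  `|f y - f x| <= M * `|x - y|.
Proof.
move=> df f'M.
have cf : continuous f by move=> z; exact: has_derive_continuous (df z).
wlog: x y f'M / x <= y => [hw|xy].
  have [/hw|/ltW yx] := leP x y; first exact.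
  rewrite distrC [`|x - y|]distrC; apply: hw => // z zx.
  by apply: f'M; rewrite minC maxC.
have [c] := MVT_segment xy (fun z _ => df z) (continuous_subspaceT cf).
rewrite in_itv/= => cI ->; rewrite normrM [`|y - x|]distrC ler_wpM2r//.
by apply: f'M; rewrite min_l// max_r.
Qed.

(** The second derivative is O([weight]), and [weight] at most doubles over a distance 1, so the
    Lipschitz constant near [x] is a multiple of [weight x]; up to distance 1 the distance is below
    its square root. The decay of the constant is what the domination in [hilbert_antisymmetry]
    uses. *)
Lemma schwartz_holder phi : schwartz phi ->
  exists L, forall x, holder_at (derive1n 1 phi) (L * weight x) x.
Proof.
move=> sphi; have [C hC] := schwartz_bound 2 1 sphi.
have C0 : 0 <= C by apply: (@decays_ge0 _ (derive1n 2 phi)) => x; rewrite -(expr1 (weight x)).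
exists (2 * C) => x y xy1.
apply: le_trans.
  apply: (@has_derive_lipschitz _ (derive1n 2 phi) x y (2 * C * weight x)).
    by move=> z; exact: schwartz_derive.
  move=> z xyz; have xz : `|x - z| <= `|x - y|.
    move: xyz; have [xy|yx] := leP x y => /andP[h1 h2].
      by rewrite !ler0_norm; lra.
    by rewrite !ger0_norm; lra.
  apply: (le_trans (hC z)); rewrite expr1 -[z](subKr x).
  apply: (le_trans (ler_wpM2l C0 (weight_shift _ _))).
  have : 1 + `|x - z| <= 2 by lra.
  have := @weight_gt0 R x => w0 h.
  have : C * ((1 + `|x - z|) * weight x) <= C * (2 * weight x).
    by rewrite ler_wpM2l// ler_wpM2r// ltW.
  by move=> /le_trans; apply; rewrite le_eqVlt; apply/orP; left; apply/eqP; ring.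
rewrite ler_wpM2l ?mulr_ge0 ?(ltW (weight_gt0 _))//.
rewrite -{1}[`|x - y|]sqr_sqrtr// expr2 ler_piMl// -[leRHS]sqrtr1.
exact: ler_wsqrtr.
Qed.

(** Integration by parts with the difference quotient [G], whose derivative is the left integrand
    minus the right one. [G] tends to 0 at infinity because [phi] is bounded, and the boundary terms
    at distance [e] are the two one-sided difference quotients. *)
Lemma pv_trunc_second_difference phi x e : schwartz phi -> 0 < e ->
  pv_trunc (fun y => (phi x - phi y) / `|x - y| ^+ 2) x e =
  pv_trunc (fun y => derive1n 1 phi y / (x - y)) x e +
  ((phi x - phi (x - e)) / e - (phi (x + e) - phi x) / e).
Proof.
move=> sphi e0; set psi := derive1n 1 phi.
have cphi : continuous phi := @schwartz_continuous phi 0 sphi.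
have cpsi : continuous psi := @schwartz_continuous phi 1 sphi.
have dpsi : decays psi.
  by have [C hC] := schwartz_bound 1 1 sphi; exists C => y; rewrite -(expr1 (weight y)).
have [B hB] : exists B, forall y, `|phi y| <= B.
  by have [B hB] := schwartz_bound 0 0 sphi; exists B => y; have := hB y; rewrite expr0 mulr1.
pose g1 y := (phi x - phi y) / `|x - y| ^+ 2.
pose G y := (phi x - phi y) / (x - y).
have cg1 y : y != x -> {for y, continuous g1}.
  move=> yx; apply: cvgM; first by apply: cvgB; [exact: cvg_cst|exact: cphi].
  apply: cvgV; first by rewrite expf_neq0// normr_eq0 subr_eq0 eq_sym.
  apply: (@continuous_comp _ _ _ (fun z => `|x - z|) (fun z => z ^+ 2)).
    by apply: cvg_norm; apply: cvgB; [exact: cvg_cst|exact: cvg_id].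
  exact: exprn_continuous.
have ig1 d : 0 < d -> mu.-integrable [set y | d < `|x - y|] (EFin \o g1).
  move=> d0; apply: (@integrable_bound _ _ _ mu _ _
      (fun y => 2 * B * (1 + d^-1) ^+ 2 * (1 + `|x|) ^+ 2 * weight y ^+ 2)).
  - exact: measurable_annulus.
  - apply: open_continuous_measurable_fun; first exact: open_annulus.
    move=> y /set_mem /= dy; apply: cg1; apply/eqP => yx.
    by move: dy; rewrite yx subrr normr0; lra.
  - apply: integrableS (integrable_cst_weight2 _) => //.
    exact: measurable_annulus.
  move=> y /= dy; have := cut_kernel_bound (x - y) d0; rewrite /cut_kernel dy => h1.
  have h2 : `|(x - y)^-1| <= (1 + d^-1) * ((1 + `|x|) * weight y).
    apply: (le_trans h1); rewrite ler_wpM2l ?addr_ge0 ?invr_ge0 ?(ltW d0)//.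
    by rewrite -opprB weightN; exact: weight_shift.
  rewrite /g1 normrM -exprVn normrX -normfV !normr_id.
  have h3 : `|phi x - phi y| <= 2 * B.
    by have := ler_normB (phi x) (phi y); have := hB x; have := hB y; lra.
  apply: (@le_trans _ _ (2 * B * ((1 + d^-1) * ((1 + `|x|) * weight y)) ^+ 2)).
    by apply: ler_pM => //; rewrite lerXn2r ?nnegrE// (le_trans (normr_ge0 _) h2).
  by rewrite le_eqVlt; apply/orP; left; apply/eqP; ring.
have ipsi d : 0 < d ->
    mu.-integrable [set y | d < `|x - y|] (EFin \o (fun y => psi y / (x - y))).
  move=> d0; apply: integrable_annulus => //; exact: continuous_measurable_fun.
have cG y : y != x -> has_derive G y (g1 y - psi y / (x - y)).
  move=> yx; have xy0 : x - y != 0 by rewrite subr_eq0 eq_sym.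
  apply: has_derive_eq.
    apply: has_deriveM.
      by apply: has_deriveB; [exact: has_derive_cst|exact: schwartz_derive 0 y sphi].
    apply: has_deriveV; first exact: xy0.
    by apply: has_deriveB; [exact: has_derive_cst|exact: has_derive_id].
  rewrite /g1 real_normK ?num_real// -[X in 0 - X]/(psi y).
  by field.
have := @FTC_punctured _ [::] G (fun y => g1 y - psi y / (x - y)) x 0.
move=> /(_ _ _ _ _ e e0) H.
have {H} : pv_trunc (fun y => g1 y - psi y / (x - y)) x e =
    0 - (G (x + e) - G (x - e)).
  apply: H.
  - by move=> y yx; exact: has_derive_continuous (cG y yx).
  - move=> y yx _; split; last exact: cG.
    apply: cvgB; first exact: cg1.
    by apply: cvgM; [exact: cpsi|exact: continuous_inv_dist].
  - move=> d d0; have := integrableB _ (ig1 d d0) (ipsi d d0).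
    by apply; exact: measurable_annulus.
  (* Each of the two quotients is at most 2 B / r, so the increment is at most 4 B / r. *)
  apply/cvgr0Pnorm_le => eps eps0; near=> r.
  have r0 : 0 < r by near: r; exact: nbhs_pinfty_gt.
  have hr : 4 * B <= eps * r.
    by rewrite -ler_pdivrMl//; near: r; apply: nbhs_pinfty_ge; rewrite num_real.
  rewrite /G !opprD !addrA !subrr !add0r opprK invrN mulrN -opprD normrN -mulrDl.
  rewrite normrM normfV (gtr0_norm r0) ler_pdivrMr//; apply: le_trans hr.
  have := ler_normD (phi x - phi (x + r)) (phi x - phi (x - r)).
  have := ler_normB (phi x) (phi (x + r)); have := ler_normB (phi x) (phi (x - r)).
  by have := hB x; have := hB (x + r); have := hB (x - r); lra.
rewrite /pv_trunc RintegralB//; last 3 first.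
- exact: measurable_annulus.
- exact: ig1.
- exact: ipsi.
move=> /eqP; rewrite subr_eq => /eqP ->; rewrite addrC; congr (_ + _).
rewrite /G; have -> : x - (x + e) = - e by ring.
have -> : x - (x - e) = e by ring.
by field; rewrite gt_eqF.
Unshelve. all: by end_near. Qed.

(** The boundary terms of [pv_trunc_second_difference] are difference quotients from the two sides;
    both tend to the derivative of [phi] at [x], so they cancel in the limit. *)
Lemma half_laplacian_schwartzE phi x : schwartz phi ->
  half_laplacian_schwartz phi x = pi^-1 * pv_limit (derive1n 1 phi) x.
Proof.
move=> sphi; rewrite /half_laplacian_schwartz; congr (_ * _).
apply: cvg_lim => //.
have [L hL] := schwartz_holder sphi.
have [C hC] := schwartz_bound 1 1 sphi.
have dpsi : decays (derive1n 1 phi) by exists C => y; rewrite -(expr1 (weight y)).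
have cpsi : continuous (derive1n 1 phi) := @schwartz_continuous phi 1 sphi.
have dphi : has_derive phi x (derive1n 1 phi x) := schwartz_derive 0 x sphi.
rewrite -[X in _ --> X]addr0 -[X in _ --> _ + X](subrr (derive1n 1 phi x)).
have lim_h : h^-1 * (phi (x + h) - phi x) @[h --> 0^'] --> derive1n 1 phi x.
  have [dx <-] := dphi.
  rewrite (_ : (fun h => _) = (fun h => h^-1 *: ((phi \o shift x) (h *: 1) - phi x))).
    exact: dx.
  apply/funext => h; rewrite /= [h%:A]mulr1 [x + h]addrC.
  by [].
have lim_r : (phi (x + e) - phi x) / e @[e --> 0^'+] --> derive1n 1 phi x.
  under eq_cvg do rewrite mulrC.
  exact: cvg_dnbhs_at_right.
have lim_l : (phi x - phi (x - e)) / e @[e --> 0^'+] --> derive1n 1 phi x.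
  have E : (fun e => (phi x - phi (x - e)) / e) =
      (fun h => h^-1 * (phi (x + h) - phi x)) \o -%R.
    by apply/funext => e /=; rewrite invrN; ring.
  rewrite E; apply: cvg_comp (cvg_dnbhs_at_left lim_h).
  have -> : (0 : R)^'- = -%R @ (0 : R)^'+ by rewrite -at_leftN oppr0.
  exact: cvg_id.
have : pv_trunc (fun y => derive1n 1 phi y / (x - y)) x e +
  ((phi x - phi (x - e)) / e - (phi (x + e) - phi x) / e) @[e --> 0^'+] -->
  pv_limit (derive1n 1 phi) x + (derive1n 1 phi x - derive1n 1 phi x).
  by apply: cvgD; [exact: cvg_pv_trunc dpsi (hL x)|exact: cvgB].
apply: cvg_trans; apply: near_eq_cvg; near=> e.
by rewrite pv_trunc_second_difference.
Unshelve. all: by end_near. Qed.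

End HalfLaplacian.

(** * Transfer to the distributional half Laplacian *)

Section HalfLaplacianDuality.
Variable R : realType.
Local Notation mu := (@lebesgue_measure R).
Implicit Types (u v f phi : R -> R) (x y e L C : R).

(** Here [v] is H[u] and [f] its derivative off [S], which may blow up on [S]. As [v] is continuous
    across [S] and [f] is integrable, the integration by parts leaves no point masses, and the
    boundary terms at infinity vanish with [phi]. *)
Theorem half_laplacian_of_hilbert (S : seq R) u v f L :
  continuous u -> decays u -> (forall x, holder_at u L x) ->
  (forall x, is_pv (fun y => u y / (x - y)) x (pi * v x)) ->
  continuous v -> decays v ->
  (forall y, y \notin S -> {for y, continuous f} /\ has_derive v y (f y)) ->
  mu.-integrable setT (EFin \o f) ->
  forall phi, schwartz phi ->
    mu.-integrable setT (EFin \o (fun x => f x * phi x)) /\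
    (\int[mu]_x (u x * half_laplacian_schwartz phi x))%R =
    (\int[mu]_x (f x * phi x))%R.
Proof.
move=> cu [C uC] hu pv cv [Cv vC] dv fi phi sphi.
have cphi : continuous phi := @schwartz_continuous _ phi 0 sphi.
pose psi := derive1n 1 phi.
have cpsi : continuous psi := @schwartz_continuous _ phi 1 sphi.
have [B hB] := schwartz_bound 0 0 sphi.
have [Bp hBp] := schwartz_bound 0 1 sphi.
have [C3 h3] := schwartz_bound 1 3 sphi.
have [L' hL'] := schwartz_holder sphi.
have C30 : 0 <= C3.
  by have := le_trans (normr_ge0 _) (h3 0); rewrite pmulr_lge0// exprn_gt0// weight_gt0.
have mf : measurable_fun setT f.
  by have /measurable_EFinP := measurable_int mu fi.
have mphi := continuous_measurable_fun cphi.
have ifphi : mu.-integrable setT (EFin \o (fun x => f x * phi x)).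
  apply: (@integrable_bound _ _ _ mu _ _ (fun x => B * `|f x|)) => //.
  - exact: measurable_funM.
  - by apply: integrable_scale => //; exact: integrable_norm.
  - move=> x _; rewrite normrM mulrC ler_wpM2r//.
    by have := hB x; rewrite expr0 mulr1.
split => //.
have ivpsi : mu.-integrable setT (EFin \o (fun x => v x * psi x)).
  apply: (@integrable_bound _ _ _ mu _ _ (fun x => Cv * C3 * weight x ^+ 2)) => //.
  - by apply: measurable_funM; exact: continuous_measurable_fun.
  - exact: integrable_cst_weight2.
  - move=> x _; rewrite normrM.
    apply: (le_trans (ler_pM (normr_ge0 _) (normr_ge0 _) (vC x) (h3 x))).
    have w0 := @weight_gt0 R x; have w1 := weight_le1 x.
    have -> : Cv * weight x * (C3 * weight x ^+ 3) =
      Cv * C3 * weight x ^+ 2 * weight x ^+ 2 by ring.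
    rewrite ler_piMr ?exprn_ile1 ?(ltW w0)//.
    by rewrite !mulr_ge0 ?exprn_ge0 ?(ltW w0) ?(decays_ge0 vC).
have [iupv anti] := hilbert_antisymmetry cu cpsi uC h3 hu hL' pv.
under eq_Rintegral do rewrite (half_laplacian_schwartzE _ sphi) mulrCA.
rewrite RintegralZl// anti.
have -> : (\int[mu]_y (psi y * (pi * v y)))%R = pi * (\int[mu]_x (v x * psi x))%R.
  rewrite -RintegralZl//; apply: eq_Rintegral => y _; ring.
rewrite mulrN mulrA mulVf ?gt_eqF ?pi_gt0// mul1r.
(* What is left says that [f * phi + v * psi], the derivative of [v * phi], integrates to 0. *)
apply/eqP; rewrite eq_sym -subr_eq0 opprK -RintegralD//; apply/eqP.
apply: (@FTC_line _ S (fun x => v x * phi x)).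
- by move=> x; apply: cvgM; [exact: cv|exact: cphi].
- move=> y yS; have [cf dvy] := dv y yS; split.
    apply: cvgD; apply: cvgM => //; first exact: cphi.
      exact: cv.
    exact: cpsi.
  by apply: has_deriveM => //; exact: (@schwartz_derive _ phi 0 y sphi).
- by have := integrableD measurableT ifphi ivpsi.
- have lim0 (s : R -> R) : (forall r, `|s r| = `|r|) ->
      v (s r) * phi (s r) @[r --> +oo] --> 0.
    move=> sr; apply/cvgr0Pnorm_le => eps eps0; near=> r.
    have r0 : 0 < r by near: r; exact: nbhs_pinfty_gt.
    have hr : Cv * Bp * eps^-1 <= r.
      by near: r; apply: nbhs_pinfty_ge; rewrite num_real.
    rewrite normrM.
    have Cv0 := decays_ge0 vC.
    have Bp0 : 0 <= Bp.
      by apply: (@decays_ge0 _ phi) => x; rewrite -(expr1 (weight x)).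
    have h1 : `|v (s r)| <= Cv.
      by apply: (le_trans (vC _)); rewrite ler_piMr// weight_le1.
    have h2 : `|phi (s r)| <= Bp * weight r.
      by have := hBp (s r); rewrite expr1 /weight sr.
    apply: (le_trans (ler_pM (normr_ge0 _) (normr_ge0 _) h1 h2)).
    rewrite mulrA ler_pdivrMr ?ltr_pwDl// (gtr0_norm r0) mulrDr mulr1.
    by move: hr; rewrite ler_pdivrMr//; lra.
  rewrite -[X in _ --> X]subr0; apply: cvgB; first exact: (lim0 id).
  by apply: (lim0 -%R) => r; rewrite normrN.
Unshelve. all: by end_near. Qed.

Lemma decays_Lfun2 u : continuous u -> decays u -> u \in Lfun mu 2%:E.
Proof.
move=> cu [C uC].
rewrite inE; apply/andP; split; rewrite inE/=.
  exact: continuous_measurable_fun.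
rewrite /finite_norm unlock poweR_lty//.
under eq_integral => x _ do rewrite /= powR_mulrn// real_normK ?num_real//.
apply: integrable_lty => //.
apply: (@integrable_bound _ _ _ mu _ _ (fun x => C ^+ 2 * weight x ^+ 2)) => //.
- by apply: measurable_funX; exact: continuous_measurable_fun.
- exact: integrable_cst_weight2.
- move=> x _; rewrite normrX -exprMn lerXn2r ?nnegrE//.
  exact: le_trans (uC x).
Qed.

End HalfLaplacianDuality.

(** * Identities for Chebyshev polynomials *)

Section ChebyshevIdentities.
Variable R : realType.
Implicit Types (x : R) (n : nat).

Local Notation T n x := (chebT R n).[x].
Local Notation U n x := (chebU R n).[x].

Lemma chebT_rec n x : T n.+2 x = 2 * x * T n.+1 x - T n x.
Proof. by rewrite [chebT R n.+2]/= hornerD hornerN -scalerAl hornerZ hornerM hornerX mulrA. Qed.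

Lemma chebU_rec n x : U n.+2 x = 2 * x * U n.+1 x - U n x.
Proof. by rewrite [chebU R n.+2]/= hornerD hornerN -scalerAl hornerZ hornerM hornerX mulrA. Qed.

Lemma chebT0 x : T 0 x = 1. Proof. by rewrite hornerC. Qed.
Lemma chebT1 x : T 1 x = x. Proof. by rewrite hornerX. Qed.
Lemma chebU0 x : U 0 x = 1. Proof. by rewrite hornerC. Qed.
Lemma chebU1 x : U 1 x = 2 * x. Proof. by rewrite /= hornerZ hornerX. Qed.

Lemma pair_ind (P : nat -> Prop) : P 0%N -> P 1%N ->
  (forall n, P n -> P n.+1 -> P n.+2) -> forall n, P n.
Proof.
move=> P0 P1 PS n; suff [] : P n /\ P n.+1 by [].
by elim: n => // n [h1 h2]; split => //; exact: PS.
Qed.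

Lemma chebT_chebU n x : T n.+1 x = U n.+1 x - x * U n x.
Proof.
elim/pair_ind: n => [||n IH1 IH2].
- by rewrite chebT1 chebU1 ?chebU0; ring.
- by rewrite chebT_rec chebU_rec chebT1 chebT0 chebU1 ?chebU0; ring.
- by rewrite chebT_rec IH1 IH2 !chebU_rec; ring.
Qed.

(** At x = cos t this is cos(n t) - cos((n + 2) t) = 2 sin t sin((n + 1) t). It is the source of
    both W_n = (V_n - V_{n+2})/2 and the derivative of [W n]. *)
Lemma chebT_sub n x : T n x - T n.+2 x = 2 * (1 - x ^+ 2) * U n x.
Proof.
elim/pair_ind: n => [||n IH1 IH2].
- by rewrite chebT_rec chebT1 chebT0 ?chebU0; ring.
- by rewrite !chebT_rec chebT1 chebT0 chebU1; ring.
- rewrite chebU_rec mulrBr mulrCA -IH1.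
  have -> : 2 * x * (2 * (1 - x ^+ 2) * U n.+1 x) = 2 * x * (T n.+1 x - T n.+3 x).
    by rewrite IH2.
  by rewrite (chebT_rec n.+2) (chebT_rec n); ring.
Qed.

(* With the convention [U_{-1} = 0], [2 * x * U n - U n.+1] is $U_{n-1}$. *)
Lemma has_derive_chebT n x :
  has_derive (fun z => T n z) x (n%:R * (2 * x * U n x - U n.+1 x)).
Proof.
elim/pair_ind: n => [||n IH1 IH2].
- rewrite mul0r (_ : (fun z => _) = fun=> 1); first exact: has_derive_cst.
  by apply/funext => z; rewrite chebT0.
- rewrite (_ : (fun z => _) = id); last by apply/funext => z; rewrite chebT1.
  apply: has_derive_eq; first exact: has_derive_id.
  by rewrite chebU_rec chebU1 ?chebU0; ring.
- rewrite (_ : (fun z => _) = (fun z => 2 * z * T n.+1 z - T n z)); last first.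
    by apply/funext => z; rewrite chebT_rec.
  apply: has_derive_eq.
    apply: has_deriveB IH1; apply: has_deriveM IH2.
    by apply: has_deriveM; [exact: has_derive_cst|exact: has_derive_id].
  cbv beta; rewrite chebT_chebU !chebU_rec -[n.+2%:R]natr1 -[n.+1%:R]natr1; ring.
Qed.

Lemma has_derive_chebTS n x :
  has_derive (fun z => T n.+1 z) x (n.+1%:R * U n x).
Proof.
apply: has_derive_eq; first exact: has_derive_chebT.
by cbv beta; rewrite chebU_rec; ring.
Qed.

End ChebyshevIdentities.

(** * The basis functions, their recurrences and derivatives *)

Section BasisFunctions.
Variable R : realType.
Implicit Types (x y z : R) (n : nat).

Local Notation T n x := (chebT R n).[x].
Local Notation U n x := (chebU R n).[x].

(** For |y| > 1 this is the root of j^2 - 2 y j + 1 = 0 inside the unit disc, the inverse of the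
    Joukowski map y = (j + 1/j)/2. Rational expressions in j replace square roots in the later
    computations. *)
Definition joukowski y : R := y - Num.sg y * Num.sqrt (y ^+ 2 - 1).

Lemma sqrt_out_gt0 y : 1 < `|y| -> 0 < Num.sqrt (y ^+ 2 - 1).
Proof.
move=> y1; rewrite sqrtr_gt0 subr_gt0 -[y ^+ 2]real_normK ?num_real//.
by rewrite exprn_egt1.
Qed.

Lemma sqr_sqrt_out y : 1 < `|y| -> Num.sqrt (y ^+ 2 - 1) ^+ 2 = y ^+ 2 - 1.
Proof. by move=> /sqrt_out_gt0; rewrite sqrtr_gt0 => /ltW /sqr_sqrtr. Qed.

Lemma sgr_out y : 1 < `|y| -> Num.sg y ^+ 2 = 1.
Proof.
move=> y1; rewrite sqr_sg; case: eqVneq => // y0.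
by move: y1; rewrite y0 normr0 ltr10.
Qed.

Lemma joukowski_sqr y : 1 < `|y| -> joukowski y ^+ 2 = 2 * y * joukowski y - 1.
Proof.
move=> y1; rewrite /joukowski.
have h1 := sqr_sqrt_out y1; have h2 := sgr_out y1.
have -> : (y - Num.sg y * Num.sqrt (y ^+ 2 - 1)) ^+ 2 =
  y ^+ 2 - 2 * y * (Num.sg y * Num.sqrt (y ^+ 2 - 1)) +
  Num.sg y ^+ 2 * Num.sqrt (y ^+ 2 - 1) ^+ 2 by ring.
by rewrite h1 h2; ring.
Qed.

Lemma joukowski_neq0 y : 1 < `|y| -> joukowski y != 0.
Proof.
move=> y1; apply/eqP => j0; have := joukowski_sqr y1.
by rewrite j0; rewrite expr0n /= mulr0; lra.
Qed.

Lemma joukowski_inv y : 1 < `|y| ->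
  (joukowski y)^-1 = y + Num.sg y * Num.sqrt (y ^+ 2 - 1).
Proof.
move=> y1; have j0 := joukowski_neq0 y1; apply: (mulfI j0); rewrite divff//.
rewrite /joukowski.
have h1 := sqr_sqrt_out y1; have h2 := sgr_out y1.
transitivity (y ^+ 2 - Num.sg y ^+ 2 * Num.sqrt (y ^+ 2 - 1) ^+ 2); last by ring.
by rewrite h1 h2; ring.
Qed.

Lemma joukowski_double y : 1 < `|y| ->
  y = (joukowski y + (joukowski y)^-1) / 2.
Proof. by move=> y1; rewrite joukowski_inv// /joukowski; field. Qed.

Lemma sqrt_joukowski y : 1 < `|y| ->
  Num.sg y * Num.sqrt (y ^+ 2 - 1) = ((joukowski y)^-1 - joukowski y) / 2.
Proof. by move=> y1; rewrite joukowski_inv// /joukowski; field. Qed.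

Lemma joukowski_norm_le y : 1 < `|y| -> `|joukowski y| <= `|y|^-1.
Proof.
move=> y1; have y0 : 0 < `|y| by rewrite (lt_trans ltr01).
rewrite -[joukowski y]invrK joukowski_inv// normfV lef_pV2 ?posrE//.
  have -> : y + Num.sg y * Num.sqrt (y ^+ 2 - 1) =
    Num.sg y * (`|y| + Num.sqrt (y ^+ 2 - 1)) by rewrite mulrDr -numEsg.
  rewrite normrM normr_sg -normr_gt0 y0.
  by rewrite mul1r ger0_norm ?addr_ge0// lerDl.
have := joukowski_neq0 y1.
by rewrite -invr_eq0 joukowski_inv// normr_gt0.
Qed.

Lemma joukowski_norm_lt1 y : 1 < `|y| -> `|joukowski y| < 1.
Proof.
move=> y1; apply: (le_lt_trans (joukowski_norm_le y1)).
by rewrite invf_lt1// (lt_trans ltr01).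
Qed.

Lemma Ttilde_in n y : `|y| <= 1 -> Ttilde n y = T n y.
Proof. by rewrite /Ttilde => ->. Qed.

Lemma Ttilde_out n y : 1 < `|y| -> Ttilde n y = joukowski y ^+ n.
Proof. by move=> y1; rewrite /Ttilde leNgt y1. Qed.

Lemma Ttilde0 y : Ttilde 0 y = 1.
Proof.
have [y1|y1] := leP `|y| 1; first by rewrite Ttilde_in// chebT0.
by rewrite Ttilde_out.
Qed.

(** Outside [-1, 1] the recurrence is the quadratic equation of [joukowski] multiplied by j^n. *)
Lemma Ttilde_rec n y : Ttilde n.+2 y = 2 * y * Ttilde n.+1 y - Ttilde n y.
Proof.
have [y1|y1] := leP `|y| 1; first by rewrite !Ttilde_in// chebT_rec.
rewrite !Ttilde_out// -addn2 exprD joukowski_sqr// exprS; ring.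
Qed.

Lemma W_in n y : `|y| <= 1 -> W n y = Num.sqrt (1 - y ^+ 2) * U n y.
Proof.
rewrite /W le_eqVlt => /predU1P[y1|->//]; rewrite y1 ltxx.
by rewrite -[y ^+ 2]real_normK ?num_real// y1 expr1n subrr sqrtr0 mul0r.
Qed.

Lemma W_out n y : 1 <= `|y| -> W n y = 0.
Proof. by move=> y1; rewrite /W ltNge y1. Qed.

Lemma W_rec n y : W n.+2 y = 2 * y * W n.+1 y - W n y.
Proof.
have [y1|y1] := leP `|y| 1; last by rewrite !W_out ?(ltW y1)//; ring.
by rewrite !W_in// chebU_rec; ring.
Qed.

Lemma W1 y : W 1 y = 2 * y * W 0 y.
Proof.
have [y1|y1] := leP `|y| 1; last by rewrite !W_out ?(ltW y1)//; ring.
by rewrite !W_in// chebU1 chebU0; ring.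
Qed.

Lemma W_V n y : W n y = (V n y - V n.+2 y) / 2.
Proof.
rewrite /W /V; case: ifPn => y1; last by rewrite subrr mul0r.
rewrite -mulrBr chebT_sub.
have s2 : 0 < 1 - y ^+ 2.
  by rewrite subr_gt0 -[y ^+ 2]real_normK ?num_real// exprn_ilt1.
have s0 : Num.sqrt (1 - y ^+ 2) != 0 by rewrite gt_eqF// sqrtr_gt0.
by rewrite -[in RHS](sqr_sqrtr (ltW s2)) sqrtr_sqr ger0_norm//; field.
Qed.

Lemma Utilde2_rec n y : Utilde2 n.+3 y = 2 * Ttilde n.+1 y + Utilde2 n.+1 y.
Proof. by []. Qed.

Lemma Ttilde_Utilde2 n y : Ttilde n.+1 y = (Utilde2 n.+3 y - Utilde2 n.+1 y) / 2.
Proof. by rewrite Utilde2_rec; field. Qed.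

Lemma Utilde2_in n y : `|y| <= 1 -> Utilde2 n.+2 y = U n y.
Proof.
move=> y1; elim/pair_ind: n => [||n IH1 IH2].
- by rewrite /= y1 addr0 Ttilde0 hornerC.
- by rewrite /= y1 addr0 Ttilde_in// chebT1 -chebU1.
- rewrite Utilde2_rec IH1 Ttilde_in// chebT_chebU.
  by rewrite chebU_rec; ring.
Qed.

(** Since 1/j - j = 2 sgn(y) sqrt(y^2 - 1), the closed form grows by 2 j^(n+1) when the index grows
    by two, as the recursion demands; the starting values U_{-1} and U_0 fit the same formula. *)
Lemma Utilde2_out n y : 1 < `|y| ->
  Utilde2 n.+1 y = - (Num.sg y * joukowski y ^+ n / Num.sqrt (y ^+ 2 - 1)).
Proof.
move=> y1; have s0 := sqrt_out_gt0 y1.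
have sn0 : Num.sqrt (y ^+ 2 - 1) != 0 by rewrite gt_eqF.
have sg2 := sgr_out y1.
have ny : (`|y| <= 1) = false by rewrite leNgt y1.
elim/pair_ind: n => [||n IH1 IH2].
- by rewrite /= ny mulr1.
- rewrite /= ny Ttilde0 expr1 /joukowski.
  apply: (mulIf sn0); rewrite mulrDl !mulNr !divfK// mulrBr.
  rewrite mulrA -expr2 sg2 -normrEsg; ring.
- rewrite Utilde2_rec IH1 Ttilde_out//.
  have j0 := joukowski_neq0 y1.
  have s2 := sqrt_joukowski y1.
  apply: (mulIf sn0); rewrite mulrDl !mulNr !divfK//.
  have -> : 2 * joukowski y ^+ n.+1 * Num.sqrt (y ^+ 2 - 1) =
    2 * joukowski y ^+ n.+1 * (Num.sg y * (Num.sg y * Num.sqrt (y ^+ 2 - 1))).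
    by rewrite [Num.sg y * (_ * _)]mulrA -expr2 sg2 mul1r.
  by rewrite s2 !exprS; field.
Qed.

Lemma near_in y : `|y| < 1 -> \forall z \near y, `|z| < 1.
Proof. by move=> y1; exact: (@norm_continuous _ _ y _ (lt_nbhsl y1)). Qed.

Lemma near_out y : 1 < `|y| -> \forall z \near y, 1 < `|z|.
Proof. by move=> y1; exact: (@norm_continuous _ _ y _ (lt_nbhsr y1)). Qed.

Lemma near_sg y : y != 0 -> \forall z \near y, Num.sg z = Num.sg y.
Proof.
move=> y0; have [yn|yp] : y < 0 \/ 0 < y by apply/orP; rewrite -neq_lt.
  near=> z; rewrite !ltr0_sg//; near: z; exact: lt_nbhsl.
near=> z; rewrite !gtr0_sg//; near: z; exact: lt_nbhsr.
Unshelve. all: by end_near. Qed.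

Lemma sqrt_in_gt0 y : `|y| < 1 -> 0 < Num.sqrt (1 - y ^+ 2).
Proof.
move=> y1; rewrite sqrtr_gt0 subr_gt0 -[y ^+ 2]real_normK ?num_real//.
by rewrite exprn_ilt1.
Qed.

Lemma sqr_sqrt_in y : `|y| <= 1 -> Num.sqrt (1 - y ^+ 2) ^+ 2 = 1 - y ^+ 2.
Proof.
move=> y1; rewrite sqr_sqrtr// subr_ge0 -[y ^+ 2]real_normK ?num_real//.
by rewrite exprn_ile1.
Qed.

Lemma has_derive_sqrt_in y : `|y| < 1 ->
  has_derive (fun z => Num.sqrt (1 - z ^+ 2)) y (- y / Num.sqrt (1 - y ^+ 2)).
Proof.
move=> y1; apply: has_derive_eq.
  apply: has_derive_sqrt; first by rewrite -sqrtr_gt0 sqrt_in_gt0.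
  by apply: has_deriveB; [exact: has_derive_cst|apply/has_deriveX/has_derive_id].
by rewrite /=; field; rewrite gt_eqF// sqrt_in_gt0.
Qed.

Lemma has_derive_joukowski y : 1 < `|y| ->
  has_derive joukowski y (- (Num.sg y * joukowski y / Num.sqrt (y ^+ 2 - 1))).
Proof.
move=> y1; have s0 := sqrt_out_gt0 y1.
have sn0 : Num.sqrt (y ^+ 2 - 1) != 0 by rewrite gt_eqF.
apply: (@has_derive_near _ (fun z => z - Num.sg y * Num.sqrt (z ^+ 2 - 1))).
  have y0 : y != 0 by rewrite -normr_gt0 (lt_trans ltr01).
  by have := near_sg y0; apply: filterS => z zy; rewrite /joukowski zy.
apply: has_derive_eq.
  apply: has_deriveB; first exact: has_derive_id.
  apply: has_deriveM; first exact: has_derive_cst.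
  apply: has_derive_sqrt; first by rewrite -sqrtr_gt0.
  by apply: has_deriveB; [apply/has_deriveX/has_derive_id|exact: has_derive_cst].
rewrite /joukowski.
transitivity (Num.sg y ^+ 2 - Num.sg y * y / Num.sqrt (y ^+ 2 - 1)).
  by rewrite sgr_out//= expr1; field.
by field.
Qed.

(** At y = cos t, [W n] is sin((n + 1) t), with derivative -(n + 1) cos((n + 1) t) / sin t. The
    proof writes [W n] as (T_n - T_{n+2}) / (2 sqrt(1 - y^2)) inside (-1, 1), which avoids
    differentiating U_n. *)
Lemma has_derive_W n y : `|y| != 1 ->
  has_derive (W n) y (- (n.+1%:R * V n.+1 y)).
Proof.
rewrite neq_lt => /orP[y1|y1]; last first.
  rewrite /V ltNge (ltW y1) /= mulr0 oppr0.
  apply: (@has_derive_near _ (fun=> 0)); last exact: has_derive_cst.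
  by have := near_out y1; apply: filterS => z /ltW z1; rewrite W_out.
have s0 := sqrt_in_gt0 y1.
have sn0 : Num.sqrt (1 - y ^+ 2) != 0 by rewrite gt_eqF.
apply: (@has_derive_near _ (fun z => (T n z - T n.+2 z) / (2 * Num.sqrt (1 - z ^+ 2)))).
  have := near_in y1; apply: filterS => z z1; rewrite W_in ?ltW// chebT_sub.
  have sz : Num.sqrt (1 - z ^+ 2) != 0 by rewrite gt_eqF// sqrt_in_gt0.
  by rewrite -(sqr_sqrt_in (ltW z1)) sqrtr_sqr ger0_norm//; field.
apply: has_derive_eq.
  apply: has_deriveM; first by apply: has_deriveB;
    [exact: (has_derive_chebT n)|exact: (has_derive_chebT n.+2)].
  apply: has_deriveV; first by rewrite mulf_neq0.
  by apply: has_deriveM; [exact: has_derive_cst|exact: has_derive_sqrt_in].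
cbv beta; rewrite chebT_sub -(sqr_sqrt_in (ltW y1)) /V y1 chebT_chebU.
rewrite (chebU_rec n.+1) chebU_rec -[n.+2%:R]natr1 -[n.+1%:R]natr1.
rewrite sqrtr_sqr ger0_norm//.
by field.
Qed.

Lemma has_derive_Ttilde n y : `|y| != 1 ->
  has_derive (Ttilde n.+1) y (n.+1%:R * Utilde2 n.+2 y).
Proof.
rewrite neq_lt => /orP[y1|y1].
  rewrite Utilde2_in ?ltW//; apply: (@has_derive_near _ (fun z => T n.+1 z)).
    by have := near_in y1; apply: filterS => z /ltW z1; rewrite Ttilde_in.
  exact: has_derive_chebTS.
apply: (@has_derive_near _ (fun z => joukowski z ^+ n.+1)).
  by have := near_out y1; apply: filterS => z z1; rewrite Ttilde_out.
rewrite Utilde2_out//; apply: has_derive_eq.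
  by apply: has_deriveX; exact: has_derive_joukowski.
by rewrite /= [joukowski y ^+ n.+1]exprS; ring.
Qed.

Lemma continuous_V n y : `|y| != 1 -> {for y, continuous (V n)}.
Proof.
rewrite neq_lt => /orP[y1|y1].
  suff : has_derive (fun z => (Num.sqrt (1 - z ^+ 2))^-1 * T n z) y
      (y / Num.sqrt (1 - y ^+ 2) ^+ 3 * T n y + (Num.sqrt (1 - y ^+ 2))^-1 *
       (n%:R * (2 * y * U n y - U n.+1 y))).
    move=> h; apply: (has_derive_continuous (has_derive_near _ h)).
    by have := near_in y1; apply: filterS => z z1; rewrite /V z1.
  have sn0 : Num.sqrt (1 - y ^+ 2) != 0 by rewrite gt_eqF// sqrt_in_gt0.
  apply: has_derive_eq.
    apply: has_deriveM; last exact: has_derive_chebT.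
    by apply: has_deriveV => //; exact: has_derive_sqrt_in.
  by congr (_ * _ + _); field.
apply: (@has_derive_continuous _ _ _ 0).
apply: (@has_derive_near _ (fun=> 0)); last exact: has_derive_cst.
by have := near_out y1; apply: filterS => z /ltW z1; rewrite /V ltNge z1.
Qed.

Lemma continuous_near (f g : R -> R) y : (\forall z \near y, f z = g z) ->
  {for y, continuous f} -> {for y, continuous g}.
Proof.
move=> fg cf; rewrite /prop_for /continuous_at -(nbhs_singleton fg).
by apply: cvg_trans cf; exact: near_eq_cvg.
Qed.

Lemma continuous_Utilde2 n y : `|y| != 1 -> {for y, continuous (Utilde2 n.+2)}.
Proof.
rewrite neq_lt => /orP[y1|y1].
  apply: (@continuous_near (horner (chebU R n))); last exact: continuous_horner.
  by have := near_in y1; apply: filterS => z /ltW z1; rewrite Utilde2_in.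
have sn0 : Num.sqrt (y ^+ 2 - 1) != 0 by rewrite gt_eqF// sqrt_out_gt0.
apply: (@continuous_near
  (fun z => - (Num.sg y * joukowski z ^+ n.+1 / Num.sqrt (z ^+ 2 - 1)))).
  have y0 : y != 0 by rewrite -normr_gt0 (lt_trans ltr01).
  near=> z; rewrite Utilde2_out; last by near: z; exact: near_out.
  by congr (- (_ * _ / _)); apply/esym; near: z; exact: near_sg.
apply: has_derive_continuous; apply: has_deriveN; apply: has_deriveM.
  apply: has_deriveM; first exact: has_derive_cst.
  by apply: has_deriveX; exact: has_derive_joukowski.
apply: has_deriveV; first exact: sn0.
apply: has_derive_sqrt; first by rewrite -sqrtr_gt0 sqrt_out_gt0.
by apply: has_deriveB; [apply/has_deriveX/has_derive_id|exact: has_derive_cst].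
Unshelve. all: by end_near. Qed.

End BasisFunctions.

(** * Holder continuity and decay of the basis functions *)

Section HolderContinuity.
Variable R : realType.
Implicit Types (x y z c : R) (u v : R -> R) (n : nat) (p : {poly R}).

Definition holder u := exists2 L, 0 <= L &
  forall x y, `|u y - u x| <= L * Num.sqrt `|x - y|.

Definition bounded_fun u := exists C, forall x, `|u x| <= C.

Lemma holder_holder_at u : holder u -> exists L, forall x, holder_at u L x.
Proof. by move=> [L _ uL]; exists L => x y _. Qed.

Lemma holder_eq u v : u =1 v -> holder u -> holder v.
Proof. by move=> /funext ->. Qed.

Lemma holder_cst c : holder (fun=> c).
Proof. by exists 0 => // x y; rewrite subrr normr0 mul0r. Qed.

Lemma holderD u v : holder u -> holder v -> holder (fun x => u x + v x).
Proof.
move=> [L L0 uL] [M M0 vM]; exists (L + M); first exact: addr_ge0.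
by move=> x y; rewrite opprD addrACA mulrDl (le_trans (ler_normD _ _))// lerD.
Qed.

Lemma holderM u v : bounded_fun u -> bounded_fun v -> holder u -> holder v ->
  holder (fun x => u x * v x).
Proof.
move=> [C uC] [D vD] [L L0 uL] [M M0 vM].
have C0 := le_trans (normr_ge0 _) (uC 0); have D0 := le_trans (normr_ge0 _) (vD 0).
exists (D * L + C * M); first by rewrite addr_ge0 ?mulr_ge0.
move=> x y; have -> : u y * v y - u x * v x = v y * (u y - u x) + u x * (v y - v x).
  by ring.
rewrite (le_trans (ler_normD _ _))// !normrM mulrDl -!mulrA.
by apply: lerD; apply: ler_pM.
Qed.

Lemma holderB u v : holder u -> holder v -> holder (fun x => u x - v x).
Proof.
move=> hu [L L0 vL]; apply: holderD hu _; exists L => // x y.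
by rewrite -opprD normrN.
Qed.

Lemma bounded_funM u v : bounded_fun u -> bounded_fun v ->
  bounded_fun (fun x => u x * v x).
Proof. by move=> [C uC] [D vD]; exists (C * D) => x; rewrite normrM ler_pM. Qed.

Lemma bounded_funD u v : bounded_fun u -> bounded_fun v ->
  bounded_fun (fun x => u x + v x).
Proof.
by move=> [C uC] [D vD]; exists (C + D) => x; rewrite (le_trans (ler_normD _ _))// lerD.
Qed.

Lemma bounded_fun_cst c : bounded_fun (fun=> c).
Proof. by exists `|c|. Qed.

Lemma holderX u n : bounded_fun u -> holder u ->
  bounded_fun (fun x => u x ^+ n) /\ holder (fun x => u x ^+ n).
Proof.
move=> bu hu; elim: n => [|n [bn hn]].
  by split; [exact: bounded_fun_cst|exact: holder_cst].
split.
  rewrite (_ : (fun x => _) = (fun x => u x * u x ^+ n)).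
    exact: bounded_funM.
  by apply/funext => x; rewrite exprS.
by apply: holder_eq (holderM bu bn hu hn) => x; rewrite exprS.
Qed.

(** Up to distance 1 the distance is below its square root; beyond it, boundedness takes over. *)
Lemma holder_lipschitz u C : 0 <= C -> bounded_fun u ->
  (forall x y, `|u y - u x| <= C * `|x - y|) -> holder u.
Proof.
move=> C0 [B uB] uC; have B0 := le_trans (normr_ge0 _) (uB 0).
exists (C + 2 * B); first by rewrite addr_ge0 ?mulr_ge0.
move=> x y; have [xy1|xy1] := leP `|x - y| 1.
  apply: (le_trans (uC x y)); apply: ler_pM => //.
    by rewrite lerDl mulr_ge0.
  rewrite -{1}[`|x - y|]sqr_sqrtr// expr2 ler_piMl// -[leRHS]sqrtr1.
  exact: ler_wsqrtr.
have s1 : 1 <= Num.sqrt `|x - y| by rewrite -[leLHS]sqrtr1 ler_wsqrtr// ltW.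
have := ler_normB (u y) (u x); have := uB x; have := uB y; nra.
Qed.

Lemma holder_comp_affine u c d : holder u -> holder (fun x => u (c * (x - d))).
Proof.
move=> [L L0 uL]; exists (L * Num.sqrt `|c|); first by rewrite mulr_ge0.
move=> x y; apply: (le_trans (uL _ _)); rewrite -mulrA ler_wpM2l//.
by rewrite -sqrtrM// -normrM; have -> : c * (x - d) - c * (y - d) = c * (x - y) by ring.
Qed.

Lemma holder_continuous u : holder u -> continuous u.
Proof.
move=> [L L0 uL] x; apply/cvgrPdist_le => e e0.
have q0 : 0 < e / (L + 1) by rewrite divr_gt0// ltr_wpDl.
near=> y; rewrite distrC; apply: (le_trans (uL x y)).
have xy : `|x - y| <= (e / (L + 1)) ^+ 2.
  by near: y; apply: cvgr_dist_le; [exact: cvg_id|exact: exprn_gt0].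
have : Num.sqrt `|x - y| <= e / (L + 1).
  by rewrite -[leRHS]gtr0_norm// -[leRHS]sqrtr_sqr ler_wsqrtr.
move=> h; apply: (@le_trans _ _ ((L + 1) * (e / (L + 1)))).
  by apply: ler_pM => //; rewrite lerDl.
by rewrite mulrCA divff ?mulr1// gt_eqF// ltr_wpDl.
Unshelve. all: by end_near. Qed.

Lemma sqrt_sub_le (a b : R) : 0 <= a -> 0 <= b ->
  `|Num.sqrt b - Num.sqrt a| <= Num.sqrt `|a - b|.
Proof.
wlog ab : a b / a <= b => [hw a0 b0|a0 b0].
  have [/hw|/ltW /hw] := leP a b; first exact.
  by rewrite distrC [`|a - b|]distrC; exact.
rewrite ger0_norm ?subr_ge0 ?ler_wsqrtr// distrC ger0_norm ?subr_ge0//.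
rewrite lerBlDl -ler_sqr ?nnegrE ?addr_ge0// sqrrD !sqr_sqrtr ?subr_ge0//.
have : 0 <= Num.sqrt a * Num.sqrt (b - a) by rewrite mulr_ge0.
by rewrite mulr2n; lra.
Qed.

(** The projection onto [-1, 1]. Polynomials composed with it are bounded and Holder on the whole
    line, so piecewise functions can be written as sums and products of such pieces, and the split
    on the positions of two points is made for [clamp] instead of for each function. *)
Definition clamp y : R := Num.max (-1) (Num.min 1 y).

Lemma clamp_id y : `|y| <= 1 -> clamp y = y.
Proof. by rewrite ler_norml => /andP[y1 y2]; rewrite /clamp min_r// max_r. Qed.

Lemma clamp_ge1 y : 1 <= y -> clamp y = 1.
Proof. by move=> y1; rewrite /clamp min_l// max_r//; lra. Qed.

Lemma clamp_leN1 y : y <= -1 -> clamp y = -1.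
Proof. by move=> y1; rewrite /clamp min_r ?max_l//; lra. Qed.

Lemma clamp_norm_le1 y : `|clamp y| <= 1.
Proof.
have [/clamp_ge1 ->|y1] := leP 1 y; first by rewrite normr1.
have [/clamp_leN1 ->|y2] := leP y (-1); first by rewrite normrN normr1.
by rewrite clamp_id ler_norml; lra.
Qed.

Lemma clamp_out y : 1 < `|y| -> clamp y = Num.sg y.
Proof.
rewrite lter_normr => /orP[y1|y1].
  by rewrite clamp_ge1 ?ltW// gtr0_sg//; lra.
by rewrite clamp_leN1 ?ltr0_sg//; lra.
Qed.

Lemma clamp_lipschitz x y : `|clamp y - clamp x| <= `|x - y|.
Proof.
have cases z : [\/ 1 <= z /\ clamp z = 1, z <= -1 /\ clamp z = -1 |
    (-1 < z < 1) /\ clamp z = z].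
  have [z1|z1] := leP 1 z; first by apply: Or31; rewrite clamp_ge1.
  have [z2|z2] := leP z (-1); first by apply: Or32; rewrite clamp_leN1.
  by apply: Or33; rewrite clamp_id// ler_norml; lra.
rewrite distrC.
have [[hx ->]|[hx ->]|[/andP[hx hx'] ->]] := cases x;
  have [[hy ->]|[hy ->]|[/andP[hy hy'] ->]] := cases y;
  rewrite ?subrr ?normr0//;
  have [h|h] := leP y x; rewrite ler_norml; have := ler_norm (x - y);
  have := ler_norm (- (x - y)); rewrite normrN; lra.
Qed.

Lemma holder_clamp : holder clamp.
Proof.
apply: (@holder_lipschitz _ 1) => //; first by exists 1; exact: clamp_norm_le1.
by move=> x y; rewrite mul1r; exact: clamp_lipschitz.
Qed.

Lemma holder_poly_clamp p :
  bounded_fun (fun y => p.[clamp y]) /\ holder (fun y => p.[clamp y]).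
Proof.
have bc : bounded_fun clamp by exists 1; exact: clamp_norm_le1.
elim/poly_ind: p => [|p c [bp hp]].
  have -> : (fun y => (0 : {poly R}).[clamp y]) = (fun=> 0).
    by apply/funext => y; rewrite horner0.
  by split; [exact: bounded_fun_cst|exact: holder_cst].
have -> : (fun y => (p * 'X + c%:P).[clamp y]) = (fun y => p.[clamp y] * clamp y + c).
  by apply/funext => y; rewrite hornerD hornerM hornerX hornerC.
split.
  by apply: bounded_funD; [exact: bounded_funM|exact: bounded_fun_cst].
by apply: holderD; [exact: holderM holder_clamp|exact: holder_cst].
Qed.

Lemma holder_sqrt_clamp : bounded_fun (fun y => Num.sqrt (1 - clamp y ^+ 2)) /\
  holder (fun y => Num.sqrt (1 - clamp y ^+ 2)).
Proof.
have c2 y : 0 <= 1 - clamp y ^+ 2.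
  by rewrite subr_ge0 -[_ ^+ 2]real_normK ?num_real// exprn_ile1// clamp_norm_le1.
split.
  exists 1 => y; rewrite ger0_norm// -[leRHS]sqrtr1 ler_wsqrtr//.
  by rewrite gerBl sqr_ge0.
exists (Num.sqrt 2) => // x y.
apply: (le_trans (sqrt_sub_le (c2 x) (c2 y))); rewrite -sqrtrM// ler_wsqrtr//.
have -> : 1 - clamp x ^+ 2 - (1 - clamp y ^+ 2) =
  (clamp y - clamp x) * (clamp x + clamp y) by ring.
rewrite normrM mulrC; apply: ler_pM => //; last exact: clamp_lipschitz.
apply: (le_trans (ler_normD _ _)).
by have := clamp_norm_le1 x; have := clamp_norm_le1 y; lra.
Qed.

(* Outside of [-1, 1], [W n] vanishes through its square root factor. *)
Lemma holder_W n : holder (W n).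
Proof.
have [bs hs] := holder_sqrt_clamp; have [bp hp] := holder_poly_clamp (chebU R n).
apply: holder_eq (holderM bs bp hs hp) => y.
have [y1|y1] := leP `|y| 1; first by rewrite clamp_id// W_in.
by rewrite W_out ?ltW// clamp_out// sgr_out// subrr sqrtr0 mul0r.
Qed.

(** [joukowski] on [1, +oo), continued to the left by the value 1; the branch on the negative side
    follows by oddness. *)
Definition outer_branch y : R :=
  Num.max 1 y - Num.sqrt (Num.max 1 y ^+ 2 - 1).

Lemma holder_outer_branch : holder outer_branch.
Proof.
exists 2 => // x y.
have max_lip : `|Num.max 1 y - Num.max 1 x| <= `|x - y|.
  have h1 := ler_norm (x - y); have := ler_norm (- (x - y)); rewrite normrN.
  by have [?|?] := leP 1 x; have [?|?] := leP 1 y; rewrite ler_norml; lra.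
rewrite /outer_branch; apply: (@le_trans _ _ (2 * Num.sqrt `|Num.max 1 y - Num.max 1 x|)); last first.
  by rewrite ler_wpM2l// ler_wsqrtr.
have : 1 <= Num.max 1 x by rewrite le_max lexx.
have : 1 <= Num.max 1 y by rewrite le_max lexx.
move: (Num.max 1 x) (Num.max 1 y) => {max_lip x y} p q q1 p1.
wlog pq : p q q1 p1 / p <= q => [hw|].
  have [/hw|/ltW /hw] := leP p q; first exact.
  by rewrite distrC [`|q - p|]distrC; exact.
have s0 : 0 <= p ^+ 2 - 1 by rewrite subr_ge0 exprn_ege1.
have t0 : 0 <= q ^+ 2 - 1 by rewrite subr_ge0 exprn_ege1.
have hs := sqr_sqrtr s0; have ht := sqr_sqrtr t0.
have hr := sqr_sqrtr (_ : 0 <= q - p); rewrite subr_ge0 in hr; have {}hr := hr pq.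
rewrite [`|q - p|]ger0_norm ?subr_ge0//.
move: hs ht hr (sqrtr_ge0 (p ^+ 2 - 1)) (sqrtr_ge0 (q ^+ 2 - 1)) (sqrtr_ge0 (q - p)).
move: (Num.sqrt (p ^+ 2 - 1)) (Num.sqrt (q ^+ 2 - 1)) (Num.sqrt (q - p)).
move=> s t r hs ht hr sp tp rp.
have ps : s <= p by rewrite -ler_sqr ?nnegrE//; lra.
have sp1 : p <= s + 1 by rewrite -ler_sqr ?nnegrE; [nra|lra|lra].
have qE : q = p + r ^+ 2 by lra.
(* The increment of the branch from [p] to [q] is r^2 - (t - s), so this bound and the next put it
   between -2 r and 0. Both follow by squaring, with s <= p <= s + 1. *)
have h1 : t <= s + r ^+ 2 + 2 * r.
  rewrite -ler_sqr ?nnegrE//; last by rewrite !addr_ge0 ?sqr_ge0 ?mulr_ge0.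
  rewrite ht qE.
  have : p * r ^+ 2 <= (s + 1) * r ^+ 2 by rewrite ler_wpM2r ?sqr_ge0.
  have : 0 <= s * r by rewrite mulr_ge0.
  have : 0 <= r ^+ 3 by rewrite exprn_ge0.
  have : 0 <= r ^+ 2 by rewrite sqr_ge0.
  lra.
have h2 : s + r ^+ 2 <= t.
  rewrite -ler_sqr ?nnegrE//; last by rewrite addr_ge0 ?sqr_ge0.
  rewrite ht qE.
  have : s * r ^+ 2 <= p * r ^+ 2 by rewrite ler_wpM2r ?sqr_ge0.
  nra.
rewrite ler_norml; lra.
Qed.

(** Each of the three terms varies on only one of (-oo, -1], [-1, 1] and [1, +oo), so the Holder
    bound for [Ttilde 1] follows from a sum, with no gluing. *)
Lemma Ttilde1E y :
  Ttilde 1 y = clamp y + (outer_branch y - 1) - (outer_branch (- y) - 1).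
Proof.
have b1 z : z <= 1 -> outer_branch z = 1.
  by move=> z1; rewrite /outer_branch max_l// expr1n subrr sqrtr0 subr0.
have [y1|y1] := leP `|y| 1.
  rewrite Ttilde_in// chebT1 clamp_id// !b1 ?(le_trans _ y1) ?ler_norm//.
    by rewrite subrr subr0 addr0.
  by rewrite -normrN ler_norm.
rewrite Ttilde_out// expr1 clamp_out// /joukowski.
have [y0|y0] := leP 0 y.
  have y1' : 1 < y by rewrite -[y]ger0_norm.
  rewrite gtr0_sg; last lra.
  rewrite (b1 (- y)); last lra.
  by rewrite /outer_branch max_r ?ltW//; ring.
have y1' : 1 < - y by rewrite -[- y]ltr0_norm.
rewrite ltr0_sg// (b1 y); last lra.
by rewrite /outer_branch max_r ?ltW// sqrrN; ring.
Qed.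

Lemma Ttilde1_bounded : bounded_fun (@Ttilde R 1).
Proof.
exists 1 => y; have [y1|y1] := leP `|y| 1; first by rewrite Ttilde_in// chebT1.
by rewrite Ttilde_out// expr1 ltW// joukowski_norm_lt1.
Qed.

Lemma holder_Ttilde1 : holder (@Ttilde R 1).
Proof.
have ho := holder_outer_branch.
have hoN : holder (fun y => outer_branch (- y)).
  have := @holder_comp_affine outer_branch (-1) 0 ho.
  by apply: holder_eq => y; rewrite subr0 mulN1r.
apply: (@holder_eq (fun y => clamp y + (outer_branch y - 1) - (outer_branch (- y) - 1))).
  by move=> y; rewrite Ttilde1E.
by apply: holderB; [apply: holderD; [exact: holder_clamp|]|]; apply: holderB => //;
  exact: holder_cst.
Qed.

Lemma chebT_pm1 n (s : R) : s ^+ 2 = 1 -> (chebT R n).[s] = s ^+ n.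
Proof.
move=> s2; elim/pair_ind: n => [||n IH1 IH2].
- by rewrite chebT0.
- by rewrite chebT1.
- rewrite chebT_rec IH1 IH2 !exprS mulrA -[2 * s * s]mulrA -expr2 s2.
  rewrite mulrA -expr2 s2; ring.
Qed.

Lemma holder_Ttilde n : bounded_fun (@Ttilde R n) /\ holder (@Ttilde R n).
Proof.
have [bT hT] := holderX n Ttilde1_bounded holder_Ttilde1.
have [bp hp] := holder_poly_clamp (chebT R n - 'X^n).
(* Outside [-1, 1] the power of [Ttilde 1] is already right, and the correction vanishes because T_n
   and X^n agree at -1 and 1; inside, it replaces y^n by T_n(y). *)
have E : @Ttilde R n = fun y => Ttilde 1 y ^+ n + (chebT R n - 'X^n).[clamp y].
  apply/funext => y; rewrite hornerD hornerN hornerXn.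
  have [y1|y1] := leP `|y| 1; first by rewrite !Ttilde_in// chebT1 clamp_id//; ring.
  by rewrite !Ttilde_out// expr1 clamp_out// chebT_pm1 ?sgr_out//; ring.
by rewrite E; split; [exact: bounded_funD|exact: holderD].
Qed.

Lemma decays_W n : decays (@W R n).
Proof.
have [bs _] := holder_sqrt_clamp; have [bp _] := holder_poly_clamp (chebU R n).
have [C hC] := bounded_funM bs bp; have C0 := le_trans (normr_ge0 _) (hC 0).
exists (2 * C) => y; have w0 := @weight_gt0 R y; have wK := weightK y.
have [y1|y1] := leP `|y| 1; last first.
  by rewrite (W_out _ (ltW y1)) normr0 !mulr_ge0// ltW.
have := hC y; rewrite clamp_id// -W_in// => h; apply: (le_trans h).
have : 2 * weight y >= 1 by nra.
by move=> h2; rewrite mulrAC; apply: (le_trans _ (ler_wpM2r C0 h2)); rewrite mul1r.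
Qed.

(** One factor [joukowski y] is at most 1/|y| in modulus and the remaining ones are below 1. *)
Lemma decays_Ttilde n : decays (@Ttilde R n.+1).
Proof.
have [[C hC] _] := holder_Ttilde n.+1; have C0 := le_trans (normr_ge0 _) (hC 0).
exists (2 * C + 2) => y; have w0 := @weight_gt0 R y; have wK := weightK y.
have [y1|y1] := leP `|y| 1.
  apply: (le_trans (hC y)); have : 2 * weight y >= 1 by nra.
  by nra.
rewrite Ttilde_out// normrX exprS.
have j1 := joukowski_norm_lt1 y1.
apply: (@le_trans _ _ `|joukowski y|).
  by rewrite ler_piMr// exprn_ile1// (ltW j1).
apply: (le_trans (joukowski_norm_le y1)).
have y0 : 0 < `|y| by lra.
have h : `|y|^-1 <= 2 * weight y.
  by rewrite -[leLHS]mulr1 ler_pdivrMl// mulrCA; nra.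
apply: (le_trans h); rewrite ler_wpM2r ?(ltW w0)//; lra.
Qed.

End HolderContinuity.

(** * Gluing at the endpoints of [-1, 1] *)

Section Gluing.
Variable R : realType.
Implicit Types (x y z r : R) (A B F G : R -> R).

Definition glue A B : R -> R := fun z => if `|z| <= 1 then A z else B z.

Lemma continuous_glue A B y :
  (`|y| <= 1 -> {for y, continuous A}) -> (1 <= `|y| -> {for y, continuous B}) ->
  (`|y| = 1 -> A y = B y) -> {for y, continuous (glue A B)}.
Proof.
move=> cA cB AB; have [y1|y1|y1] := ltgtP `|y| 1.
- apply: (@continuous_near _ A); last exact/cA/ltW.
  by have := near_in y1; apply: filterS => z /ltW z1; rewrite /glue z1.
- apply: (@continuous_near _ B); last exact/cB/ltW.
  by have := near_out y1; apply: filterS => z z1; rewrite /glue leNgt z1.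
- have gy : glue A B y = A y by rewrite /glue y1 lexx.
  apply/cvgrPdist_lt => e e0.
  rewrite y1 in cA cB.
  have /cvgrPdist_lt /(_ e e0) hA := cA (lexx 1).
  have /cvgrPdist_lt /(_ e e0) hB := cB (lexx 1).
  near=> z; rewrite gy /glue; case: ifP => _; first by near: z.
  by rewrite AB//; near: z.
Unshelve. all: by end_near. Qed.

Lemma has_derive_glue_in A B y d : `|y| < 1 -> has_derive A y d ->
  has_derive (glue A B) y d.
Proof.
move=> y1; apply: has_derive_near.
by have := near_in y1; apply: filterS => z /ltW z1; rewrite /glue z1.
Qed.

Lemma has_derive_glue_out A B y d : 1 < `|y| -> has_derive B y d ->
  has_derive (glue A B) y d.
Proof.
move=> y1; apply: has_derive_near.
by have := near_out y1; apply: filterS => z z1; rewrite /glue leNgt z1.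
Qed.

(** [G] may be singular at [x]: when it is a multiple of ln |x - y| plus regular terms, the
    logarithm drops out of the symmetric increments and [F] keeps the regular terms. *)
Lemma cvg_increment0 F G x : (\forall r \near 0^'+, F (x + r) - F (x - r) =
    G (x + r) - G (x - r)) -> {for x, continuous F} ->
  G (x + r) - G (x - r) @[r --> 0^'+] --> 0.
Proof.
move=> FG cF; have : F (x + r) - F (x - r) @[r --> 0^'+] --> F x - F x.
  apply: cvgB.
    exact: (cvg_comp _ _ (@cvg_addr_right _ x) cF).
  exact: (cvg_comp _ _ (@cvg_subr_right _ x) cF).
by rewrite subrr; apply: cvg_trans; exact: near_eq_cvg.
Qed.

Lemma near_in_incr x : `|x| < 1 ->
  \forall r \near 0^'+, `|x + r| < 1 /\ `|x - r| < 1.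
Proof.
move=> x1; have h := near_in x1; near=> r; split; near: r.
  exact: (@cvg_addr_right R x _ h).
exact: (@cvg_subr_right R x _ h).
Unshelve. all: by end_near. Qed.

Lemma near_out_incr x : 1 < `|x| ->
  \forall r \near 0^'+, 1 < `|x + r| /\ 1 < `|x - r|.
Proof.
move=> x1; have h := near_out x1; near=> r; split; near: r.
  exact: (@cvg_addr_right R x _ h).
exact: (@cvg_subr_right R x _ h).
Unshelve. all: by end_near. Qed.

Lemma near_pinfty_incr x M :
  \forall r \near +oo, M < x + r /\ x - r < - M.
Proof.
near=> r; have : M + `|x| < r by near: r; apply: nbhs_pinfty_gt; rewrite num_real.
by have := ler_norm x; have := ler_norm (- x); rewrite normrN; split; lra.
Unshelve. all: by end_near. Qed.

Lemma atan_inv (p : R) : 0 < p -> atan p + atan p^-1 = pi / 2.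
Proof.
move=> p0; pose H q : R := atan q + atan q^-1.
have H1 : H 1 = pi / 2 by rewrite /H invr1 atan1; field.
have dH q : 0 < q -> has_derive H q 0.
  move=> q0; have qn0 : q != 0 by rewrite gt_eqF.
  apply: has_derive_eq.
    apply: has_deriveD; first exact/has_derive_atan/has_derive_id.
    apply/has_derive_atan/has_deriveV; first exact: qn0.
    exact: has_derive_id.
  have q2 : 1 + q ^+ 2 != 0 by rewrite gt_eqF// ltr_pwDl// sqr_ge0.
  by rewrite /=; field; rewrite qn0 addrC q2.
have cH q q' : 0 < q -> {within `[q, q'], continuous H}.
  move=> q0; apply: continuous_in_subspaceT => z /set_mem /=.
  rewrite in_itv/= => /andP[qz _].
  exact: (has_derive_continuous (dH z (lt_le_trans q0 qz))).
rewrite -[LHS]/(H p) -H1; have [p1|/ltW p1] := leP 1 p.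
  apply/esym/(@continuous_derive0_const _ [::]) => //; first exact: cH.
  move=> z; rewrite in_itv/= => /andP[z1 _] _; apply: dH.
  exact: lt_trans z1.
apply: (@continuous_derive0_const _ [::]) => //; first exact: cH.
move=> z; rewrite in_itv/= => /andP[z1 _] _; apply: dH.
exact: lt_trans z1.
Qed.

Lemma atan_inv_lt0 (p : R) : p < 0 -> atan p + atan p^-1 = - (pi / 2).
Proof.
move=> p0; have : 0 < - p by rewrite oppr_gt0.
by move=> /atan_inv; rewrite invrN !atanN -opprD => /eqP; rewrite eqr_oppLR => /eqP.
Qed.

End Gluing.

(** * Primitives for the Hilbert transform of [W 0] *)

Section PrimitiveW.
Variable R : realType.
Implicit Types (x y z r : R).

(** For y = sin t this is h = tan(t/2). The formulas sin t = 2 h / (1 + h^2) and cos t = (1 - h^2) /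
    (1 + h^2) below make the integrands rational in h. *)
Definition half_angle y : R := y / (1 + Num.sqrt (1 - y ^+ 2)).

Lemma half_angle_den y : 0 < 1 + Num.sqrt (1 - y ^+ 2).
Proof. by rewrite ltr_pwDl. Qed.

Lemma continuous_half_angle y : {for y, continuous half_angle}.
Proof.
apply: cvgM; first exact: cvg_id.
apply: cvgV; first by rewrite gt_eqF// half_angle_den.
apply: cvgD; first exact: cvg_cst.
apply: (@continuous_comp _ _ _ (fun z => 1 - z ^+ 2) Num.sqrt).
  by apply: cvgB; [exact: cvg_cst|exact: exprn_continuous].
exact: sqrt_continuous.
Qed.

Lemma half_angle_y y : `|y| <= 1 -> y = 2 * half_angle y / (1 + half_angle y ^+ 2).
Proof.
move=> y1; rewrite /half_angle; have := half_angle_den y.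
have := sqr_sqrt_in y1; move: (Num.sqrt _) => s s2 s0.
have E : (1 + s) ^+ 2 + y ^+ 2 = 2 * (1 + s) by rewrite sqrrD s2 expr1n; lra.
have s0' : 1 + s != 0 by rewrite gt_eqF.
have D : (1 + s) ^+ 2 + y ^+ 2 != 0 by rewrite E mulf_neq0.
have -> : 1 + (y / (1 + s)) ^+ 2 = 2 / (1 + s).
  by rewrite -[2 in RHS](mulfK s0') -E; field.
by field; rewrite s0'.
Qed.

Lemma half_angle_sqrt y : `|y| <= 1 ->
  Num.sqrt (1 - y ^+ 2) = (1 - half_angle y ^+ 2) / (1 + half_angle y ^+ 2).
Proof.
move=> y1; rewrite /half_angle; have := half_angle_den y.
have := sqr_sqrt_in y1; move: (Num.sqrt _) => s s2 s0.
have E : (1 + s) ^+ 2 + y ^+ 2 = 2 * (1 + s) by rewrite sqrrD s2 expr1n; lra.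
have s0' : 1 + s != 0 by rewrite gt_eqF.
have -> : 1 + (y / (1 + s)) ^+ 2 = 2 / (1 + s).
  by rewrite -[2 in RHS](mulfK s0') -E; field.
have y2 : y ^+ 2 = (1 - s) * (1 + s) by lra.
by rewrite expr_div_n y2; field; rewrite s0'.
Qed.

Lemma half_angle1 : half_angle 1 = 1.
Proof. by rewrite /half_angle expr1n subrr sqrtr0 addr0 divr1. Qed.

Lemma half_angleN1 : half_angle (-1) = -1.
Proof. by rewrite /half_angle sqrrN expr1n subrr sqrtr0 addr0 divr1. Qed.

Lemma half_angle_norm_le1 y : `|y| <= 1 -> `|half_angle y| <= `|y|.
Proof.
move=> y1; rewrite /half_angle normrM normfV (gtr0_norm (half_angle_den y)).
by rewrite ler_pdivrMr ?half_angle_den// ler_peMr// lerDl.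
Qed.

Lemma has_derive_half_angle y : `|y| < 1 ->
  has_derive half_angle y ((1 + half_angle y ^+ 2) ^+ 2 / (2 * (1 - half_angle y ^+ 2))).
Proof.
move=> y1; have s0 := sqrt_in_gt0 y1.
have E := half_angle_sqrt (ltW y1).
apply: has_derive_eq.
  apply: has_deriveM; first exact: has_derive_id.
  apply: has_deriveV; first by rewrite gt_eqF// half_angle_den.
  by apply: has_deriveD; [exact: has_derive_cst|exact: has_derive_sqrt_in].
cbv beta; have yE := half_angle_y (ltW y1).
have t2 : 0 < 1 + half_angle y ^+ 2 by rewrite ltr_pwDl// sqr_ge0.
move: E s0 yE t2; move: (Num.sqrt _) (half_angle y) => s t sE s0 yE t2.
have t0 : 1 - t ^+ 2 != 0.
  by move: s0; rewrite sE; apply: contraTneq => ->; rewrite mul0r ltxx.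
rewrite sE yE; field.
have -> : 1 + t ^+ 2 + (1 - t ^+ 2) = 2 by ring.
by rewrite t0 gt_eqF//= pnatr_eq0.
Qed.

(** This arctangent is half of the arcsine of [y]. *)
Lemma has_derive_atan_half_angle y : `|y| < 1 ->
  has_derive (fun z => atan (half_angle z)) y (2 * Num.sqrt (1 - y ^+ 2))^-1.
Proof.
move=> y1; apply: has_derive_eq; first exact/has_derive_atan/has_derive_half_angle.
have s0 := sqrt_in_gt0 y1; have sE := half_angle_sqrt (ltW y1).
have t2 : 0 < 1 + half_angle y ^+ 2 by rewrite ltr_pwDl// sqr_ge0.
have t0 : 1 - half_angle y ^+ 2 != 0.
  by move: s0; rewrite sE; apply: contraTneq => ->; rewrite mul0r ltxx.
by rewrite sE; field; rewrite t0 gt_eqF.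
Qed.

Lemma continuous_sqrt_in : continuous (fun y : R => Num.sqrt (1 - y ^+ 2)).
Proof.
move=> y; apply: (@continuous_comp _ _ _ (fun z => 1 - z ^+ 2) Num.sqrt).
  by apply: cvgB; [exact: cvg_cst|exact: exprn_continuous].
exact: sqrt_continuous.
Qed.

Lemma continuous_atan_half_angle : continuous (fun y => atan (half_angle y)).
Proof.
move=> y; apply: (@continuous_comp _ _ _ half_angle atan).
  exact: continuous_half_angle.
exact: continuous_atan.
Qed.

Lemma notin_pm1 y : y \notin [:: -1; 1 : R] -> `|y| != 1.
Proof.
apply: contra => /eqP /(congr1 (fun a => a ^+ 2)); rewrite real_normK ?num_real//.
by rewrite expr1n => /eqP; rewrite sqrf_eq1 !inE orbC.
Qed.

Lemma norm1_cases y : `|y| = 1 -> y = 1 \/ y = -1.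
Proof.
move=> y1; have : y \in [:: -1; 1 : R] by apply: contra_eqT y1 => /notin_pm1.
by rewrite !inE => /orP[/eqP|/eqP]; [right|left].
Qed.

Lemma continuous_sg_out y : 1 <= `|y| -> {for y, continuous (@Num.sg R)}.
Proof.
move=> y1; have y0 : y != 0 by rewrite -normr_gt0 (lt_le_trans ltr01).
apply: (@continuous_near _ (fun=> Num.sg y)); last exact: cvg_cst.
by have := near_sg y0; apply: filterS => z ->.
Qed.

Lemma has_derive_sg_out y : 1 < `|y| -> has_derive (@Num.sg R) y 0.
Proof.
move=> y1; have y0 : y != 0 by rewrite -normr_gt0 (lt_trans ltr01).
apply: (@has_derive_near _ (fun=> Num.sg y)); last exact: has_derive_cst.
by have := near_sg y0; apply: filterS => z ->.
Qed.

(* [H] is the part of a primitive of [W 0 y / (x - y)] that depends on the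
   position of [x] relative to [-1, 1]. *)
Lemma odd_primitive_W0_of (H K : R -> R) x m :
  (forall y, `|y| <= 1 -> y != x -> {for y, continuous H}) ->
  (forall y, 1 <= `|y| -> {for y, continuous K}) ->
  (forall y, `|y| = 1 -> y != x -> H y = K y) ->
  (forall y, `|y| < 1 -> y != x ->
     has_derive H y ((1 - x ^+ 2) / ((x - y) * Num.sqrt (1 - y ^+ 2)))) ->
  (forall y, 1 < `|y| -> has_derive K y 0) ->
  (glue H K (x + r) - glue H K (x - r) @[r --> 0^'+] --> 0) ->
  (\forall r \near +oo, K (x + r) - K (x - r) = m) ->
  odd_primitive [:: -1; 1] (W 0) x (pi * x + m).
Proof.
move=> cH cK HK dH dK lim0 limy.
(* From 1 - y^2 = (1 - x^2) + (x - y)(x + y), [W 0 y / (x - y)] is (x + y) / sqrt(1 - y^2) plus the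
   derivative prescribed for [H]. [A] is the primitive x arcsin y - sqrt(1 - y^2) of the first part
   and [B] its constant extension; the total increment is pi x. *)
pose A y := 2 * x * atan (half_angle y) - Num.sqrt (1 - y ^+ 2).
pose B y := Num.sg y * (x * (pi / 2)).
have cA : continuous A.
  move=> y; apply: cvgB; last exact: continuous_sqrt_in.
  by apply: cvgM; [exact: cvg_cst|exact: continuous_atan_half_angle].
have cB y : 1 <= `|y| -> {for y, continuous B}.
  by move=> y1; apply: cvgM; [exact: continuous_sg_out|exact: cvg_cst].
have AB y : `|y| = 1 -> A y = B y.
  move=> /norm1_cases[->|->]; rewrite /A /B.
    by rewrite half_angle1 expr1n subrr sqrtr0 atan1 sgr1; field.
  by rewrite half_angleN1 sqrrN expr1n subrr sqrtr0 atanN atan1 sgrN sgr1; field.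
have cAB : continuous (glue A B).
  by move=> y; apply: continuous_glue; [move=> _; exact: cA|exact: cB|exact: AB].
exists (fun y => glue A B y + glue H K y); split.
- move=> y yx; apply: cvgD; first exact: cAB.
  by apply: continuous_glue => y1; [exact: cH|exact: cK|exact: HK].
- move=> y yx /notin_pm1; rewrite neq_lt => /orP[y1|y1].
    have xy0 : x - y != 0 by rewrite subr_eq0 eq_sym.
    apply: has_derive_eq.
      apply: has_deriveD; (apply: has_derive_glue_in; first exact: y1).
        apply: has_deriveB (has_derive_sqrt_in y1).
        apply: has_deriveM; first exact: has_derive_cst.
        exact: has_derive_atan_half_angle.
      exact: dH.
    rewrite W_in ?ltW// chebU0.
    have s0 := sqrt_in_gt0 y1; have s2 := sqr_sqrt_in (ltW y1).
    have sn0 : Num.sqrt (1 - y ^+ 2) != 0 by rewrite gt_eqF.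
    apply: (mulIf (mulf_neq0 sn0 xy0)).
    transitivity (1 - y ^+ 2); first by field; rewrite sn0.
    by rewrite -[LHS]s2; field; rewrite xy0.
  apply: has_derive_eq.
    apply: has_deriveD; (apply: has_derive_glue_out; first exact: y1); last exact: dK.
    by apply: has_deriveM; [exact: has_derive_sg_out|exact: has_derive_cst].
  by rewrite W_out ?ltW//; ring.
- have -> : (fun r => glue A B (x + r) + glue H K (x + r) -
      (glue A B (x - r) + glue H K (x - r))) = (fun r =>
      (glue A B (x + r) - glue A B (x - r)) + (glue H K (x + r) - glue H K (x - r))).
    by apply/funext => r; ring.
  rewrite [X in _ --> X](_ : 0 = 0 + 0); last by rewrite addr0.
  apply: cvgD; last exact: lim0.
  by apply: (@cvg_increment0 _ (glue A B)); [exact: nearW|exact: cAB].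
- apply: cvg_near_cst; near=> r.
  have [r1 r2] : 1 < x + r /\ x - r < -1 by near: r; exact: near_pinfty_incr.
  rewrite /glue !leNgt.
  have -> : 1 < `|x + r| by rewrite lter_normr r1.
  have -> : 1 < `|x - r| by rewrite lter_normr; apply/orP; right; lra.
  rewrite /= /B gtr0_sg; last lra.
  rewrite ltr0_sg; last lra.
  have -> : m = K (x + r) - K (x - r) by apply/esym; near: r.
  by field.
Unshelve. all: by end_near. Qed.

Lemma half_angle_sub x y : `|x| <= 1 -> `|y| <= 1 ->
  x - y = 2 * (half_angle x - half_angle y) * (1 - half_angle x * half_angle y) /
    ((1 + half_angle x ^+ 2) * (1 + half_angle y ^+ 2)).
Proof.
move=> x1 y1.
rewrite [in LHS](half_angle_y x1) [X in _ - X = _](half_angle_y y1).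
have d0 (t : R) : 1 + t ^+ 2 != 0 by rewrite gt_eqF// ltr_pwDl// sqr_ge0.
by field; rewrite !d0.
Qed.

Lemma half_angle_mul_lt1 x y : `|x| < 1 -> `|y| <= 1 ->
  0 < 1 - half_angle x * half_angle y.
Proof.
move=> x1 y1; rewrite subr_gt0 (le_lt_trans (ler_norm _))// normrM.
have h1 := half_angle_norm_le1 (ltW x1); have h2 := half_angle_norm_le1 y1.
have := normr_ge0 (half_angle x); have := normr_ge0 (half_angle y); nra.
Qed.

Lemma odd_primitive_W0_in x : `|x| < 1 ->
  odd_primitive [:: -1; 1] (W 0) x (pi * x).
Proof.
move=> x1; pose s := Num.sqrt (1 - x ^+ 2); pose t := half_angle x.
have d0 (q : R) : 0 < 1 + q ^+ 2 by rewrite ltr_pwDl// sqr_ge0.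
(* With h the half angle of [y], ln |x - y| + [reg y] is ln |(t - h) / (1 - t h)| by
   [half_angle_sub]. Keeping ln |x - y| apart isolates the part that is even about [x]. At y = -1
   and y = 1 the quotient has modulus 1, so [H] vanishes there and glues to 0. *)
pose reg y := ln ((1 + t ^+ 2) * (1 + half_angle y ^+ 2) / 2) -
  2 * ln (1 - t * half_angle y).
have creg y : `|y| <= 1 -> {for y, continuous reg}.
  move=> y1; have ch := @continuous_half_angle y.
  apply: cvgB.
    apply: (@continuous_comp _ _ _
      (fun z => (1 + t ^+ 2) * (1 + half_angle z ^+ 2) / 2) (@ln R)).
      apply: cvgM; last exact: cvg_cst.
      apply: cvgM; first exact: cvg_cst.
      apply: cvgD; first exact: cvg_cst.
      by apply: (@continuous_comp _ _ _ half_angle (fun z => z ^+ 2)); 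
        [exact: ch|exact: exprn_continuous].
    by apply: continuous_ln; rewrite divr_gt0// mulr_gt0.
  apply: cvgM; first exact: cvg_cst.
  apply: (@continuous_comp _ _ _ (fun z => 1 - t * half_angle z) (@ln R)).
    apply: cvgB; first exact: cvg_cst.
    by apply: cvgM; [exact: cvg_cst|exact: ch].
  by apply: continuous_ln; exact: half_angle_mul_lt1.
pose H y := - (s * (ln `|x - y| + reg y)).
rewrite -[pi * x]addr0; apply: (@odd_primitive_W0_of H (fun=> 0)).
- move=> y y1 yx; apply: cvgN; apply: cvgM; first exact: cvg_cst.
  apply: cvgD; last exact: creg.
  exact: (has_derive_continuous (has_derive_ln_dist yx)).
- by move=> y _; exact: cvg_cst.
- have zero (q : R) : q ^+ 2 = 1 -> half_angle q = q -> ln `|x - q| + reg q = 0.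
    move=> q2 hq.
    have q1 : `|q| <= 1.
      by rewrite -(@ler_sqr R) ?nnegrE// real_normK ?num_real// q2 expr1n.
    have p0 : 0 < 1 - t * q by have := half_angle_mul_lt1 x1 q1; rewrite hq.
    have xq : `|x - q| = (1 - t * q) ^+ 2 / (1 + t ^+ 2).
      rewrite (half_angle_sub (ltW x1) q1) hq -/t q2.
      have -> : t - q = - q * (1 - t * q).
        transitivity (t * q ^+ 2 - q); last by ring.
        by rewrite q2 mulr1.
      have qn : `|q| = 1.
        by apply/eqP; rewrite -(@eqrXn2 _ 2%N)// real_normK ?num_real// q2 expr1n.
      rewrite normrM normfV !normrM normrN qn (gtr0_norm p0) !gtr0_norm//.
      by field; rewrite gt_eqF.
    rewrite /reg hq xq q2.
    have -> : (1 + t ^+ 2) * (1 + 1) / 2 = 1 + t ^+ 2 by field.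
    rewrite ln_div ?posrE ?exprn_gt0//.
    by rewrite lnXn// mulr2n; ring.
  move=> y /norm1_cases[->|->] _; rewrite /H zero ?mulr0 ?oppr0//.
  + by rewrite expr1n.
  + exact: half_angle1.
  + by rewrite sqrrN expr1n.
  + exact: half_angleN1.
- move=> y y1 yx; have xy0 : x - y != 0 by rewrite subr_eq0 eq_sym.
  have ht := half_angle_mul_lt1 x1 (ltW y1).
  apply: has_derive_eq.
    apply: has_deriveN; apply: has_deriveM; first exact: has_derive_cst.
    apply: has_deriveD; first exact: has_derive_ln_dist.
    apply: has_deriveB.
      apply: has_derive_ln; first by rewrite divr_gt0// mulr_gt0.
      apply: has_deriveM; last exact: has_derive_cst.
      apply: has_deriveM; first exact: has_derive_cst.
      apply: has_deriveD; first exact: has_derive_cst.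
      by apply/has_deriveX/has_derive_half_angle.
    apply: has_deriveM; first exact: has_derive_cst.
    apply: has_derive_ln; first exact: ht.
    apply: has_deriveB; first exact: has_derive_cst.
    apply: has_deriveM; first exact: has_derive_cst.
    exact: has_derive_half_angle.
  have s2 : s ^+ 2 = 1 - x ^+ 2 := sqr_sqrt_in (ltW x1).
  have yE := half_angle_sub (ltW x1) (ltW y1).
  have sE := half_angle_sqrt (ltW y1).
  have sxE : s = _ := half_angle_sqrt (ltW x1).
  rewrite -s2 sE; rewrite -/t in yE sxE ht.
  have d1 := d0 t; have d2 := d0 (half_angle y).
  have nh : 1 - half_angle y ^+ 2 != 0.
    have := sqrt_in_gt0 y1; rewrite sE; apply: contraTneq => ->.
    by rewrite mul0r ltxx.
  have nt : t - half_angle y != 0.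
    by apply: contra_neq xy0 => th; rewrite yE th mulr0 !mul0r.
  cbv beta; rewrite yE sxE; move: (half_angle y) d2 nh nt ht => h d2 nh nt ht.
  by field; rewrite nh nt !gt_eqF.
- by move=> y _; exact: has_derive_cst.
- apply: (@cvg_increment0 _ (fun y => - (s * reg y))).
    have := near_in_incr x1; apply: filterS => r [r1 r2].
    rewrite /glue !ltW// /H.
    have -> : x - (x + r) = - r by ring.
    have -> : x - (x - r) = r by ring.
    by rewrite normrN; ring.
  by apply: cvgN; apply: cvgM; [exact: cvg_cst|exact/creg/ltW].
- by apply: nearW => r; rewrite subrr.
Qed.

Lemma odd_primitive_W0_out x : 1 <= `|x| ->
  odd_primitive [:: -1; 1] (W 0) x (pi * joukowski x).
Proof.
move=> x1; pose s := Num.sqrt (x ^+ 2 - 1).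
have x2 : 0 <= x ^+ 2 - 1.
  by rewrite subr_ge0 -[x ^+ 2]real_normK ?num_real// exprn_ege1.
have s2 : s ^+ 2 = x ^+ 2 - 1 by rewrite sqr_sqrtr.
(* The half-angle primitive of 1 / (x - sin t) is (2 / s) atan((x h - 1) / s), here multiplied by 1
   - x^2 = - s^2. When |x| = 1, [s] is 0 and both [H] and [K] are identically 0. *)
pose H y := - (2 * s * atan ((x * half_angle y - 1) / s)).
pose K y := - (2 * s * atan ((x * Num.sg y - 1) / s)).
have cH : continuous H.
  move=> y; apply: cvgN; apply: cvgM; first exact: cvg_cst.
  apply: (@continuous_comp _ _ _ (fun y => (x * half_angle y - 1) / s) atan).
    apply: cvgM; last exact: cvg_cst.
    apply: cvgB; last exact: cvg_cst.
    by apply: cvgM; [exact: cvg_cst|exact: continuous_half_angle].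
  exact: continuous_atan.
have cK y : 1 <= `|y| -> {for y, continuous K}.
  move=> y1; apply: cvgN; apply: cvgM; first exact: cvg_cst.
  apply: (@continuous_comp _ _ _ (fun y => (x * Num.sg y - 1) / s) atan).
    apply: cvgM; last exact: cvg_cst.
    apply: cvgB; last exact: cvg_cst.
    by apply: cvgM; [exact: cvg_cst|exact: continuous_sg_out].
  exact: continuous_atan.
have HK y : `|y| = 1 -> H y = K y.
  by move=> /norm1_cases[->|->]; rewrite /H /K ?half_angle1 ?half_angleN1 ?sgrN sgr1.
have -> : pi * joukowski x = pi * x + - (pi * (Num.sg x * s)).
  by rewrite /joukowski -/s; ring.
apply: (@odd_primitive_W0_of H K).
- by move=> y _ _; exact: cH.
- exact: cK.
- by move=> y y1 _; exact: HK.
- move=> y y1 yx; have xy0 : x - y != 0 by rewrite subr_eq0 eq_sym.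
  apply: has_derive_eq.
    apply: has_deriveN; apply: has_deriveM; first exact: has_derive_cst.
    apply: has_derive_atan; apply: has_deriveM; last exact: has_derive_cst.
    apply: has_deriveB; last exact: has_derive_cst.
    by apply: has_deriveM; [exact: has_derive_cst|exact: has_derive_half_angle].
  have -> : 1 - x ^+ 2 = - s ^+ 2 by rewrite s2 opprB.
  have [->|s0] := eqVneq s 0; first by cbv beta; ring.
  cbv beta.
  have x0 : x != 0 by rewrite -normr_gt0 (lt_le_trans ltr01).
  have d2 : 1 + half_angle y ^+ 2 != 0 by rewrite gt_eqF// ltr_pwDl// sqr_ge0.
  have sE := half_angle_sqrt (ltW y1).
  have nh : 1 - half_angle y ^+ 2 != 0.
    have := sqrt_in_gt0 y1; rewrite sE; apply: contraTneq => ->.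
    by rewrite mul0r ltxx.
  have -> : 1 + ((x * half_angle y - 1) / s) ^+ 2 =
      x * (1 + half_angle y ^+ 2) * (x - y) / s ^+ 2.
    rewrite [X in x - X](half_angle_y (ltW y1)).
    transitivity ((s ^+ 2 + (x * half_angle y - 1) ^+ 2) / s ^+ 2).
      by field.
    by rewrite s2; field; rewrite -s2 expf_neq0.
  rewrite sE; move: (half_angle y) d2 nh => h d2 nh.
  by field; rewrite d2 nh xy0 x0 s0.
- move=> y y1; apply: has_derive_eq.
    apply: has_deriveN; apply: has_deriveM; first exact: has_derive_cst.
    apply: has_derive_atan; apply: has_deriveM; last exact: has_derive_cst.
    apply: has_deriveB; last exact: has_derive_cst.
    by apply: has_deriveM; [exact: has_derive_cst|exact: has_derive_sg_out].
  by cbv beta; ring.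
- apply: (@cvg_increment0 _ (glue H K)); first exact: nearW.
  by apply: continuous_glue; [move=> _; exact: cH|exact: cK|exact: HK].
- near=> r.
  have [r1 r2] : 1 < x + r /\ x - r < -1 by near: r; exact: near_pinfty_incr.
  rewrite /K gtr0_sg; last lra.
  rewrite ltr0_sg; last lra.
  have [->|s0] := eqVneq s 0; first by ring.
  have x1' : x - 1 != 0 /\ x + 1 != 0.
    have : s ^+ 2 != 0 by rewrite expf_neq0.
    have -> : s ^+ 2 = (x - 1) * (x + 1) by rewrite s2; ring.
    by rewrite mulf_eq0 negb_or => /andP.
  have -> : (x * -1 - 1) / s = - ((x + 1) / s) by ring.
  (* By (x - 1)(x + 1) = s^2 the two arguments are reciprocal, so the arctangents add up to pi/2 or
     -pi/2 according to the sign of [x]. *)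
  have -> : (x + 1) / s = ((x * 1 - 1) / s)^-1.
    rewrite mulr1 invf_div; apply: (mulIf s0); apply: (mulIf x1'.1).
    by rewrite mulfVK// mulrAC mulfVK ?x1'.1// -expr2 s2; ring.
  rewrite atanN mulr1.
  transitivity (- (2 * s * (atan ((x - 1) / s) + atan ((x - 1) / s)^-1))); first by ring.
  have sp : 0 < s by rewrite lt_def s0 sqrtr_ge0.
  move: x1; rewrite lter_normr => /orP[xp|xn].
    rewrite atan_inv; last first.
      by rewrite divr_gt0// lt_def x1'.1 subr_ge0.
    by rewrite gtr0_sg; [field|lra].
  rewrite atan_inv_lt0; last by rewrite pmulr_llt0 ?invr_gt0//; lra.
  by rewrite ltr0_sg; [field|lra].
Unshelve. all: by end_near. Qed.

End PrimitiveW.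

(** * Primitives for the Hilbert transform of [Ttilde 1] *)

Section PrimitiveTtilde.
Variable R : realType.
Implicit Types (x y z r : R).

(** The derivative as 1 / (dy/dj) with y = (j + 1/j)/2: rational in j alone, hence within reach of
    [field]. *)
Lemma has_derive_joukowski_frac y : 1 < `|y| ->
  has_derive (@joukowski R) y (2 * joukowski y ^+ 2 / (joukowski y ^+ 2 - 1)).
Proof.
move=> y1; apply: has_derive_eq; first exact: has_derive_joukowski.
have s0 := sqrt_out_gt0 y1; have sg2 := sgr_out y1.
have sE := sqrt_joukowski y1; have j0 := joukowski_neq0 y1.
have sn0 : Num.sqrt (y ^+ 2 - 1) != 0 by rewrite gt_eqF.
have sg0 : Num.sg y != 0 by apply: contraTneq (oner_neq0 R) => s; rewrite -sg2 s expr0n eqxx.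
have j2 : joukowski y ^+ 2 - 1 != 0.
  have := mulf_neq0 sg0 sn0; rewrite sE; apply: contra_neq => j2.
  apply: (mulIf j0); rewrite mul0r.
  transitivity (- (joukowski y ^+ 2 - 1) / 2); first by field.
  by rewrite j2 oppr0 mul0r.
have -> : - (Num.sg y * joukowski y / Num.sqrt (y ^+ 2 - 1)) =
  - (Num.sg y ^+ 2 * joukowski y / (Num.sg y * Num.sqrt (y ^+ 2 - 1))).
  by field; rewrite sg0 sn0.
have j2' : 1 - joukowski y ^+ 2 != 0 by rewrite -opprB oppr_eq0.
by rewrite sE sg2; field; rewrite j0 j2 mulNr -expr2.
Qed.

Lemma joukowski_norm1 y : `|y| = 1 -> joukowski y = y.
Proof.
move=> y1; rewrite /joukowski -[y ^+ 2]real_normK ?num_real// y1 expr1n.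
by rewrite subrr sqrtr0 mulr0 subr0.
Qed.

Lemma continuous_joukowski y : 1 <= `|y| -> {for y, continuous (@joukowski R)}.
Proof.
move=> y1; apply: cvgB; first exact: cvg_id.
apply: cvgM; first exact: continuous_sg_out.
apply: (@continuous_comp _ _ _ (fun z => z ^+ 2 - 1) Num.sqrt).
  by apply: cvgB; [exact: exprn_continuous|exact: cvg_cst].
exact: sqrt_continuous.
Qed.

Lemma joukowski_neq0_ge y : 1 <= `|y| -> joukowski y != 0.
Proof.
rewrite le_eqVlt => /predU1P[/esym y1|]; last exact: joukowski_neq0.
by rewrite joukowski_norm1// -normr_gt0 y1.
Qed.

Lemma joukowski_inv_bounds y : 1 < `|y| ->
  2 * `|y| - 1 <= `|joukowski y|^-1 <= 2 * `|y|.
Proof.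
move=> y1; rewrite -normfV joukowski_inv//.
have -> : y + Num.sg y * Num.sqrt (y ^+ 2 - 1) =
  Num.sg y * (`|y| + Num.sqrt (y ^+ 2 - 1)) by rewrite mulrDr -numEsg.
have y0 : 0 < `|y| by rewrite (lt_trans ltr01).
rewrite normrM normr_sg -normr_gt0 y0 mul1r ger0_norm ?addr_ge0//.
have y2 : y ^+ 2 = `|y| ^+ 2 by rewrite real_normK ?num_real.
have h1 : Num.sqrt (y ^+ 2 - 1) <= `|y|.
  rewrite -[leRHS]ger0_norm// -[leRHS]sqrtr_sqr ler_wsqrtr// y2; lra.
have h2 : `|y| - 1 <= Num.sqrt (y ^+ 2 - 1).
  rewrite -[leLHS]ger0_norm ?subr_ge0 ?(ltW y1)// -[leLHS]sqrtr_sqr ler_wsqrtr// y2.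
  by nra.
by apply/andP; split; lra.
Qed.

(** From ln(1 + u) <= u with u = (q - p) / p. *)
Lemma ln_sub_le (p q m : R) : 0 < m -> m <= p -> m <= q ->
  `|ln p - ln q| <= `|p - q| / m.
Proof.
move=> m0; wlog : p q / p <= q => [hw mp mq|pq mp mq].
  have [pq|/ltW qp] := leP p q; first exact: hw.
  by rewrite distrC [`|p - q|]distrC; exact: hw.
have p0 : 0 < p by rewrite (lt_le_trans m0).
have q0 : 0 < q by rewrite (lt_le_trans m0).
rewrite distrC ger0_norm; last by rewrite subr_ge0 ler_ln.
rewrite distrC ger0_norm ?subr_ge0//.
have -> : ln q - ln p = ln (1 + (q - p) / p).
  by rewrite -ln_div//; congr ln; field; rewrite gt_eqF.
apply: le_trans; first apply: le_ln1Dx.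
  by rewrite (lt_le_trans (_ : -1 < 0))// ?ltrN10// divr_ge0 ?subr_ge0// ltW.
by rewrite ler_wpM2l ?subr_ge0// lef_pV2.
Qed.

(** Both logarithms diverge, but 1/|j| equals 2 |y| up to an error of at most 1, so its values at
    [x + r] and [x - r] differ by at most 4 |x| + 1 while both tend to infinity. *)
Lemma cvg_ln_joukowski_increment x :
  ln `|joukowski (x + r)| - ln `|joukowski (x - r)| @[r --> +oo] --> 0.
Proof.
apply/cvgr0Pnorm_le => e e0; near=> r.
pose b := (4 * `|x| + 1) / e.
have b0 : 0 <= b by rewrite divr_ge0 ?addr_ge0 ?mulr_ge0// ltW.
have rb : 2 + `|x| + b < r by near: r; apply: nbhs_pinfty_gt; rewrite num_real.
have x1 := ler_norm x; have x2 := ler_norm (- x); rewrite normrN in x2.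
have [r1 r2] : 1 < x + r /\ x - r < -1 by lra.
have p1 : 1 < `|x + r| by rewrite lter_normr r1.
have q1 : 1 < `|x - r| by rewrite lter_normr; apply/orP; right; lra.
have lnE y : 1 < `|y| -> ln `|joukowski y| = - ln `|joukowski y|^-1.
  by move=> y1; rewrite lnV ?opprK// posrE normr_gt0 joukowski_neq0.
rewrite !lnE// opprK addrC.
have /andP[h1 h2] := joukowski_inv_bounds p1.
have /andP[h3 h4] := joukowski_inv_bounds q1.
have pE : `|x + r| = x + r by rewrite gtr0_norm//; lra.
have qE : `|x - r| = r - x by rewrite ltr0_norm ?opprB//; lra.
rewrite pE in h1 h2; rewrite qE in h3 h4.
have m0 : 0 < 1 + b by rewrite ltr_wpDr.
apply: le_trans; first apply: (@ln_sub_le _ _ (1 + b)) => //; try lra.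
rewrite ler_pdivrMr// mulrDr mulr1 /b mulrCA divff ?gt_eqF// mulr1.
apply: (@le_trans _ _ (4 * `|x| + 1)); last by rewrite lerDr ltW.
by rewrite ler_norml; lra.
Unshelve. all: by end_near. Qed.

Lemma cvg_joukowski_addr x : joukowski (x + r) @[r --> +oo] --> 0.
Proof.
apply/cvgr0Pnorm_le => e e0; near=> r.
have rb : 2 + `|x| + e^-1 < r by near: r; apply: nbhs_pinfty_gt; rewrite num_real.
have x2 := ler_norm (- x); rewrite normrN in x2.
have ei : 0 < e^-1 by rewrite invr_gt0.
have p1 : 1 < `|x + r| by rewrite lter_normr; apply/orP; left; lra.
apply: (le_trans (joukowski_norm_le p1)).
rewrite -[leRHS]invrK lef_pV2 ?posrE//; last by rewrite (lt_trans ltr01).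
by rewrite lter_normr; apply/orP; left; lra.
Unshelve. all: by end_near. Qed.

Lemma cvg_joukowski_subr x : joukowski (x - r) @[r --> +oo] --> 0.
Proof.
apply/cvgr0Pnorm_le => e e0; near=> r.
have rb : 2 + `|x| + e^-1 < r by near: r; apply: nbhs_pinfty_gt; rewrite num_real.
have x2 := ler_norm x.
have ei : 0 < e^-1 by rewrite invr_gt0.
have p1 : 1 < `|x - r| by rewrite lter_normr; apply/orP; right; lra.
apply: (le_trans (joukowski_norm_le p1)).
rewrite -[leRHS]invrK lef_pV2 ?posrE//; last by rewrite (lt_trans ltr01).
by rewrite lter_normr; apply/orP; right; lra.
Unshelve. all: by end_near. Qed.

(* [E] is the part of a primitive of [Ttilde 1 y / (x - y)] that depends on the
   position of [x] relative to [-1, 1]. *)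
Lemma odd_primitive_Ttilde1_of (E : R -> R) x m :
  (forall y, 1 <= `|y| -> y != x -> {for y, continuous E}) ->
  (forall y, `|y| = 1 -> y != x -> E y = 0) ->
  (forall y, 1 < `|y| -> y != x -> has_derive E y
     ((1 - x ^+ 2) / (y - x) * (2 * joukowski y / (joukowski y ^+ 2 - 1)))) ->
  (glue (fun=> 0) E (x + r) - glue (fun=> 0) E (x - r) @[r --> 0^'+] --> 0) ->
  (E (x + r) - E (x - r) @[r --> +oo] --> m) ->
  odd_primitive [:: -1; 1] (Ttilde 1) x m.
Proof.
move=> cE E0 dE lim0 limy.
have cT : continuous (@Ttilde R 1).
  by apply: holder_continuous; have [_] := @holder_Ttilde R 1.
pose B y := - (x * ln `|joukowski y|).
have cB y : 1 <= `|y| -> {for y, continuous B}.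
  move=> y1; apply: cvgN; apply: cvgM; first exact: cvg_cst.
  apply: (@continuous_comp _ _ _ (fun z => `|joukowski z|) (@ln R)).
    by apply: cvg_norm; exact: continuous_joukowski.
  by apply: continuous_ln; rewrite normr_gt0 joukowski_neq0_ge.
have B0 y : `|y| = 1 -> 0 = B y.
  by move=> y1; rewrite /B joukowski_norm1// y1 ln1 mulr0 oppr0.
have cB' : continuous (glue (fun=> 0) B).
  by move=> y; apply: continuous_glue; [move=> _; exact: cvg_cst|exact: cB|exact: B0].
(* Inside [-1, 1], y / (x - y) = -1 + x / (x - y) gives the first two terms. Outside, where
   [Ttilde 1] is no longer y, [B] and [E] make up the difference. At infinity only the increments of
   [E] can contribute. *)
exists (fun y => - Ttilde 1 y - x * ln `|x - y| + glue (fun=> 0) B y +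
  glue (fun=> 0) E y); split.
- move=> y yx; apply: cvgD; last first.
    apply: continuous_glue => y1; [exact: cvg_cst|exact: cE|by rewrite E0].
  apply: cvgD; last exact: cB'.
  apply: cvgB; first by apply: cvgN; exact: cT.
  apply: cvgM; first exact: cvg_cst.
  exact: (has_derive_continuous (has_derive_ln_dist yx)).
- move=> y yx /notin_pm1 yn1; have xy0 : x - y != 0 by rewrite subr_eq0 eq_sym.
  have dT := has_derive_Ttilde 0 yn1.
  have dL := has_derive_ln_dist yx.
  move: yn1; rewrite neq_lt => /orP[y1|y1].
    apply: has_derive_eq.
      apply: has_deriveD.
        apply: has_deriveD.
          apply: has_deriveB; first exact: has_deriveN dT.
          by apply: has_deriveM dL; exact: has_derive_cst.
        by apply: has_derive_glue_in; [exact: y1|exact: has_derive_cst].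
      by apply: has_derive_glue_in; [exact: y1|exact: has_derive_cst].
    by rewrite Utilde2_in ?ltW// Ttilde_in ?ltW// chebT1 chebU0; field.
  have dJ := has_derive_joukowski_frac y1; have j0 := joukowski_neq0 y1.
  have j1 := joukowski_norm_lt1 y1.
  have j2 : joukowski y ^+ 2 - 1 != 0.
    rewrite lt_eqF// subr_lt0 -[_ ^+ 2]real_normK ?num_real//.
    by rewrite exprn_ilt1.
  have yE := joukowski_double y1.
  have {}dT : has_derive (Ttilde 1) y (2 * joukowski y ^+ 2 / (joukowski y ^+ 2 - 1)).
    apply: has_derive_near dJ.
    by have := near_out y1; apply: filterS => z z1; rewrite Ttilde_out// expr1.
  apply: has_derive_eq.
    apply: has_deriveD.
      apply: has_deriveD.
        apply: has_deriveB; first exact: has_deriveN dT.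
        by apply: has_deriveM dL; exact: has_derive_cst.
      apply: has_derive_glue_out; first exact: y1.
      apply: has_deriveN; apply: has_deriveM; first exact: has_derive_cst.
      by apply: has_derive_ln_norm; [exact: j0|exact: dJ].
    by apply: has_derive_glue_out; [exact: y1|exact: dE].
  rewrite Ttilde_out// expr1.
  move: (joukowski y) j0 j2 yE => j j0 j2 yE.
  have yx0 : y - x != 0 by rewrite subr_eq0.
  apply: (mulIf (mulf_neq0 xy0 (mulf_neq0 j2 j0))).
  have yj : 2 * y * j = j ^+ 2 + 1 by rewrite yE; field.
  transitivity (j ^+ 2 * (j ^+ 2 - 1)); last by field; rewrite xy0.
  transitivity (j * (- (2 * j ^+ 2 * (x - y)) + x * (j ^+ 2 - 1) -
    2 * x * j * (x - y) - 2 * j * (1 - x ^+ 2))).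
    by field; rewrite xy0 yx0 j0 j2.
  transitivity (j * (- (x * j ^+ 2) + j * (2 * y * j) - x + x * (2 * y * j) - 2 * j)).
    by ring.
  by rewrite yj; ring.
- have -> : (fun r => - Ttilde 1 (x + r) - x * ln `|x - (x + r)| +
      glue (fun=> 0) B (x + r) + glue (fun=> 0) E (x + r) -
      (- Ttilde 1 (x - r) - x * ln `|x - (x - r)| +
      glue (fun=> 0) B (x - r) + glue (fun=> 0) E (x - r))) = (fun r =>
      ((- Ttilde 1 (x + r) + glue (fun=> 0) B (x + r)) -
       (- Ttilde 1 (x - r) + glue (fun=> 0) B (x - r))) +
      (glue (fun=> 0) E (x + r) - glue (fun=> 0) E (x - r))).
    apply/funext => r.
    have -> : x - (x + r) = - r by ring.
    have -> : x - (x - r) = r by ring.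
    by rewrite normrN; ring.
  rewrite [X in _ --> X](_ : 0 = 0 + 0); last by rewrite addr0.
  apply: cvgD; last exact: lim0.
  pose F y := - Ttilde 1 y + glue (fun=> 0) B y.
  apply: (@cvg_increment0 _ F F); first exact: nearW.
  by apply: cvgD; [apply: cvgN; exact: cT|exact: cB'].
- have lim : - (joukowski (x + r) - joukowski (x - r)) -
      x * (ln `|joukowski (x + r)| - ln `|joukowski (x - r)|) +
      (E (x + r) - E (x - r)) @[r --> +oo] --> - (0 - 0) - x * 0 + m.
    apply: cvgD limy; apply: cvgB.
      by apply: cvgN; apply: cvgB; [exact: cvg_joukowski_addr|exact: cvg_joukowski_subr].
    by apply: cvgM; [exact: cvg_cst|exact: cvg_ln_joukowski_increment].
  rewrite subrr oppr0 mulr0 subrr add0r in lim.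
  apply: cvg_trans lim; apply: near_eq_cvg; near=> r.
  have [r1 r2] : 1 < x + r /\ x - r < -1 by near: r; exact: near_pinfty_incr.
  have p1 : 1 < `|x + r| by rewrite lter_normr r1.
  have q1 : 1 < `|x - r| by rewrite lter_normr; apply/orP; right; lra.
  rewrite /glue !Ttilde_out// !expr1 !leNgt p1 q1 /= /B.
  have -> : x - (x + r) = - r by ring.
  have -> : x - (x - r) = r by ring.
  by rewrite normrN; ring.
Unshelve. all: by end_near. Qed.

Lemma joukowski_quadratic y : 1 < `|y| -> joukowski y ^+ 2 - 1 != 0.
Proof.
move=> y1; rewrite lt_eqF// subr_lt0 -[_ ^+ 2]real_normK ?num_real//.
by rewrite exprn_ilt1// joukowski_norm_lt1.
Qed.

Lemma odd_primitive_Ttilde1_in x : `|x| < 1 ->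
  odd_primitive [:: -1; 1] (Ttilde 1) x (- (pi * Num.sqrt (1 - x ^+ 2))).
Proof.
move=> x1; pose s := Num.sqrt (1 - x ^+ 2).
have s0 : 0 < s := sqrt_in_gt0 x1.
have sn0 : s != 0 by rewrite gt_eqF.
have s2 : s ^+ 2 = 1 - x ^+ 2 := sqr_sqrt_in (ltW x1).
(* Since s^2 + (j - x)^2 = 2 j (y - x), the first arctangent has the required derivative; the second
   is constant on each side and makes [E] vanish at -1 and 1. *)
pose E y := 2 * s * (atan ((joukowski y - x) / s) - atan ((Num.sg y - x) / s)).
have catan (f : R -> R) (F : set_system R) (FF : Filter F) (l : R) : f @ F --> l ->
    atan ((f z - x) / s) @[z --> F] --> atan ((l - x) / s).
  move=> fl; apply: (cvg_comp (fun z => (f z - x) / s) (@atan R)); last exact: continuous_atan.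
  by apply: cvgM; [apply: cvgB => //; exact: cvg_cst|exact: cvg_cst].
apply: (@odd_primitive_Ttilde1_of E).
- move=> y y1 yx; apply: cvgM; first exact: cvg_cst.
  apply: cvgB; first exact: (catan _ _ _ _ (continuous_joukowski y1)).
  exact: (catan _ _ _ _ (continuous_sg_out y1)).
- move=> y y1 _; rewrite /E joukowski_norm1//.
  by move: y1 => /norm1_cases[->|->]; rewrite ?sgrN sgr1 subrr mulr0.
- move=> y y1 yx; have yx0 : y - x != 0 by rewrite subr_eq0.
  have j0 := joukowski_neq0 y1; have j2 := joukowski_quadratic y1.
  apply: has_derive_eq.
    apply: has_deriveM; first exact: has_derive_cst.
    apply: has_deriveB.
      apply: has_derive_atan; apply: has_deriveM; last exact: has_derive_cst.
      apply: has_deriveB; last exact: has_derive_cst.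
      exact: has_derive_joukowski_frac.
    apply: has_derive_atan; apply: has_deriveM; last exact: has_derive_cst.
    by apply: has_deriveB; [exact: has_derive_sg_out|exact: has_derive_cst].
  cbv beta.
  have -> : 1 + ((joukowski y - x) / s) ^+ 2 = 2 * joukowski y * (y - x) / s ^+ 2.
    transitivity ((s ^+ 2 + (joukowski y - x) ^+ 2) / s ^+ 2); first by field.
    congr (_ / _); rewrite s2 sqrrB joukowski_sqr//; ring.
  have dn0 : 1 + ((Num.sg y - x) / s) ^+ 2 != 0.
    by rewrite gt_eqF// ltr_pwDl// sqr_ge0.
  move: dn0; move: (1 + ((Num.sg y - x) / s) ^+ 2) => d dn0.
  by rewrite -s2; field; rewrite dn0 yx0 j0 j2 sn0.
- apply: cvg_near_cst; have := near_in_incr x1; apply: filterS => r [r1 r2].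
  by rewrite /glue !ltW// subrr.
- have lim : 2 * s * (atan ((joukowski (x + r) - x) / s) - atan ((1 - x) / s)) -
      2 * s * (atan ((joukowski (x - r) - x) / s) - atan ((-1 - x) / s))
      @[r --> +oo] -->
      2 * s * (atan ((0 - x) / s) - atan ((1 - x) / s)) -
      2 * s * (atan ((0 - x) / s) - atan ((-1 - x) / s)).
    apply: cvgB; apply: cvgM; try exact: cvg_cst.
      by apply: cvgB; [exact: (catan _ _ _ _ (@cvg_joukowski_addr x))|exact: cvg_cst].
    by apply: cvgB; [exact: (catan _ _ _ _ (@cvg_joukowski_subr x))|exact: cvg_cst].
  have x1' := x1; rewrite ltr_norml in x1'; have /andP[xl xr] := x1'.
  (* As j tends to 0 the terms in -x / s cancel; (1 - x) / s and (1 + x) / s are reciprocal, so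
     their arctangents add up to pi/2. *)
  have -> : - (pi * s) = 2 * s * (atan ((0 - x) / s) - atan ((1 - x) / s)) -
      2 * s * (atan ((0 - x) / s) - atan ((-1 - x) / s)).
    have p0 : 0 < (1 - x) / s by rewrite divr_gt0// subr_gt0.
    have -> : (-1 - x) / s = - ((1 - x) / s)^-1.
      have xn0 : 1 - x != 0 by rewrite gt_eqF// subr_gt0.
      rewrite invf_div; apply: (mulIf sn0); apply: (mulIf xn0).
      by rewrite mulfVK// mulNr mulNr mulrAC mulfVK// -expr2 s2; ring.
    have := atan_inv p0; rewrite atanN => h.
    transitivity (- (2 * s * (pi / 2))); first by field.
    by rewrite -h; ring.
  apply: cvg_trans lim; apply: near_eq_cvg; near=> r.
  have [r1 r2] : 1 < x + r /\ x - r < -1 by near: r; exact: near_pinfty_incr.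
  rewrite /E gtr0_sg; last lra.
  by rewrite ltr0_sg//; lra.
Unshelve. all: by end_near. Qed.

Lemma odd_primitive_Ttilde1_pm1 x : `|x| = 1 ->
  odd_primitive [:: -1; 1] (Ttilde 1) x 0.
Proof.
move=> x1; apply: (@odd_primitive_Ttilde1_of (fun=> 0)).
- by move=> *; exact: cvg_cst.
- by [].
- move=> y _ _; rewrite -[x ^+ 2]real_normK ?num_real// x1 expr1n subrr !mul0r.
  exact: has_derive_cst.
- by apply: cvg_near_cst; apply: nearW => r; rewrite /glue !if_same subrr.
- by apply: cvg_near_cst; apply: nearW => r; rewrite subrr.
Qed.

Lemma odd_primitive_Ttilde1_out x : 1 < `|x| ->
  odd_primitive [:: -1; 1] (Ttilde 1) x 0.
Proof.
move=> x1; set w := joukowski x; pose s := (w^-1 - w) / 2.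
have w0 : w != 0 := joukowski_neq0 x1.
have w1 : `|w| < 1 := joukowski_norm_lt1 x1.
have xE : x = (w + w^-1) / 2 := joukowski_double x1.
have j_le1 y : 1 <= `|y| -> `|joukowski y| <= 1.
  rewrite le_eqVlt => /predU1P[/esym y1|/joukowski_norm_lt1/ltW//].
  by rewrite joukowski_norm1// y1.
have wj (j : R) : `|j| <= 1 -> 1 - w * j != 0.
  move=> j1; rewrite gt_eqF// subr_gt0 (le_lt_trans (ler_norm _))// normrM.
  by rewrite (le_lt_trans _ w1)// ler_piMr.
(* With j the image of [y], x - y = (w - j)(w j - 1) / (2 w j), so ln |x - y| + [F y] is ln |(w - j)
   / (1 - w j)|. This quotient has modulus 1 at j = -1 and j = 1, and it has the same limit at both
   infinities because j tends to 0. *)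
pose F y := ln (2 * `|w|) + ln `|joukowski y| - 2 * ln `|1 - w * joukowski y|.
pose E y := s * (ln `|x - y| + F y).
have cF y : 1 <= `|y| -> {for y, continuous F}.
  move=> y1; have cj := continuous_joukowski y1.
  apply: cvgB.
    apply: cvgD; first exact: cvg_cst.
    apply: (@continuous_comp _ _ _ (fun z => `|joukowski z|) (@ln R)).
      by apply: cvg_norm; exact: cj.
    by apply: continuous_ln; rewrite normr_gt0 joukowski_neq0_ge.
  apply: cvgM; first exact: cvg_cst.
  apply: (@continuous_comp _ _ _ (fun z => `|1 - w * joukowski z|) (@ln R)).
    apply: cvg_norm; apply: cvgB; first exact: cvg_cst.
    by apply: cvgM; [exact: cvg_cst|exact: cj].
  by apply: continuous_ln; rewrite normr_gt0; exact/wj/j_le1.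
apply: (@odd_primitive_Ttilde1_of E).
- move=> y y1 yx; apply: cvgM; first exact: cvg_cst.
  apply: cvgD; last exact: cF.
  exact: (has_derive_continuous (has_derive_ln_dist yx)).
- have zero (q : R) : `|q| = 1 -> q ^+ 2 = 1 -> E q = 0.
    move=> q1 q2; rewrite /E /F joukowski_norm1// q1 ln1 addr0.
    have p0 : 0 < `|1 - w * q| by rewrite normr_gt0 wj// q1.
    have -> : `|x - q| = `|1 - w * q| ^+ 2 / (2 * `|w|).
      rewrite xE; have -> : (w + w^-1) / 2 - q = (1 - w * q) ^+ 2 / (2 * w).
        transitivity ((w ^+ 2 + 1 - 2 * w * q) / (2 * w)); first by field.
        congr (_ / _); transitivity (1 - 2 * w * q + w ^+ 2 * q ^+ 2); last by ring.
        by rewrite q2; ring.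
      by rewrite normrM normfV normrX normrM normr_nat.
    have pw : 0 < 2 * `|w| by rewrite mulr_gt0// normr_gt0.
    by rewrite ln_div ?posrE ?exprn_gt0// lnXn// mulr2n; ring.
  move=> y y1 _; apply: zero => //.
  by rewrite -[y ^+ 2]real_normK ?num_real// y1 expr1n.
- move=> y y1 yx; have xy0 : x - y != 0 by rewrite subr_eq0 eq_sym.
  have yx0 : y - x != 0 by rewrite subr_eq0.
  have j0 := joukowski_neq0 y1; have j2 := joukowski_quadratic y1.
  have dJ := has_derive_joukowski_frac y1.
  have wj0 := wj _ (j_le1 y (ltW y1)).
  have yE := joukowski_double y1.
  apply: has_derive_eq.
    apply: has_deriveM; first exact: has_derive_cst.
    apply: has_deriveD; first exact: has_derive_ln_dist.
    apply: has_deriveB.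
      apply: has_deriveD; first exact: has_derive_cst.
      by apply: has_derive_ln_norm; [exact: j0|exact: dJ].
    apply: has_deriveM; first exact: has_derive_cst.
    apply: has_derive_ln_norm; first exact: wj0.
    apply: has_deriveB; first exact: has_derive_cst.
    by apply: has_deriveM dJ; exact: has_derive_cst.
  have w2 : w ^+ 2 - 1 != 0 := joukowski_quadratic x1.
  cbv beta; move: (joukowski y) j0 j2 wj0 yE => j j0 j2 wj0 yE.
  have xyE : x - y = (w - j) * (w * j - 1) / (2 * w * j).
    by rewrite xE yE; field; rewrite w0 j0.
  have wj0' : w * j - 1 != 0 by rewrite -opprB oppr_eq0.
  have wjn : w - j != 0.
    by apply: contra_neq xy0 => h; rewrite xyE h !mul0r.
  have -> : y - x = - (x - y) by rewrite opprB.
  have -> : 1 - x ^+ 2 = - s ^+ 2 by rewrite /s xE; field.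
  rewrite xyE /s; field.
  by rewrite w0 j0 j2 wj0 wj0' wjn.
- pose G y := s * F y.
  apply: (@cvg_increment0 _ G).
    have := near_out_incr x1; apply: filterS => r [r1 r2].
    rewrite /glue !leNgt r1 r2 /= /E.
    have -> : x - (x + r) = - r by ring.
    have -> : x - (x - r) = r by ring.
    by rewrite normrN /G; ring.
  by apply: cvgM; [exact: cvg_cst|exact/cF/ltW].
- have cln (f : R -> R) : f r @[r --> +oo] --> 0 ->
      ln `|1 - w * f r| @[r --> +oo] --> 0.
    move=> f0; rewrite [X in _ --> X](_ : 0 = ln `|1 - w * 0|); last first.
      by rewrite mulr0 subr0 normr1 ln1.
    apply: (cvg_comp (fun r => `|1 - w * f r|) (@ln R)); last first.
      by apply: continuous_ln; rewrite mulr0 subr0 normr1.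
    apply: cvg_norm; apply: cvgB; first exact: cvg_cst.
    by apply: cvgM; [exact: cvg_cst|exact: f0].
  have lim : s * ((ln `|joukowski (x + r)| - ln `|joukowski (x - r)|) -
      2 * (ln `|1 - w * joukowski (x + r)| - ln `|1 - w * joukowski (x - r)|))
      @[r --> +oo] --> s * (0 - 2 * (0 - 0)).
    apply: cvgM; first exact: cvg_cst.
    apply: cvgB; first exact: cvg_ln_joukowski_increment.
    apply: cvgM; first exact: cvg_cst.
    apply: cvgB.
      exact: (cln _ (@cvg_joukowski_addr x)).
    exact: (cln _ (@cvg_joukowski_subr x)).
  rewrite subrr mulr0 subrr mulr0 in lim.
  apply: cvg_trans lim; apply: near_eq_cvg; near=> r; rewrite /E /F.
  have -> : x - (x + r) = - r by ring.
  have -> : x - (x - r) = r by ring.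
  by rewrite normrN; ring.
Unshelve. all: by end_near. Qed.

End PrimitiveTtilde.

(** * Hilbert transforms of all basis functions *)

Section HilbertTransforms.
Variable R : realType.
Implicit Types (x y z r : R) (n : nat).

Local Notation pm1 := [:: -1; 1 : R].

Lemma decays_cvg_addr (u : R -> R) x : decays u -> u (x + r) @[r --> +oo] --> 0.
Proof.
move=> [C uC]; have C0 := decays_ge0 uC.
apply/cvgr0Pnorm_le => e e0; near=> r; apply: (le_trans (uC _)).
have rb : C / e + `|x| < r by near: r; apply: nbhs_pinfty_gt; rewrite num_real.
rewrite ler_pdivrMr ?ltr_pwDl//.
have : r - `|x| <= `|x + r|.
  by rewrite lter_normr; apply/orP; left; have := ler_norm (- x); rewrite normrN; lra.
have h : C / e < r - `|x| by lra.
by move: h; rewrite ltr_pdivrMr// => h1 h2; nra.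
Unshelve. all: by end_near. Qed.

Lemma decays_cvg_subr (u : R -> R) x : decays u -> u (x - r) @[r --> +oo] --> 0.
Proof.
move=> [C uC]; have := @decays_cvg_addr (u \o -%R) (- x).
rewrite (_ : (fun r => (u \o -%R) (- x + r)) = (fun r => u (x - r))).
  by apply; exists C => y /=; rewrite -weightN.
by apply/funext => r /=; rewrite opprD opprK.
Qed.

Lemma odd_primitive_eq (u v : R -> R) S x (l l' : R) : u =1 v -> l = l' ->
  odd_primitive S u x l -> odd_primitive S v x l'.
Proof. by move=> /funext -> ->. Qed.

Lemma odd_primitive0 S x : odd_primitive S (fun=> 0 : R) x 0.
Proof.
exists (fun=> 0); split.
- by move=> *; exact: cvg_cst.
- by move=> y _ _; rewrite mul0r; exact: has_derive_cst.
- by rewrite subrr; exact: cvg_cst.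
- by rewrite subrr; exact: cvg_cst.
Qed.

(** The logarithm of |x - y| is even about [x], so its increments vanish for every radius. This
    supplies [Ttilde 0] at the start of the recurrence. *)
Lemma odd_primitive1 S x : odd_primitive S (fun=> 1 : R) x 0.
Proof.
exists (fun y => - ln `|x - y|).
have E r : - ln `|x - (x + r)| - - ln `|x - (x - r)| = 0.
  have -> : x - (x + r) = - r by ring.
  have -> : x - (x - r) = r by ring.
  by rewrite normrN subrr.
have d y : y != x -> has_derive (fun y => - ln `|x - y|) y (1 / (x - y)).
  move=> yx; apply: has_derive_eq; first exact/has_deriveN/has_derive_ln_dist.
  by rewrite opprK mul1r.
split.
- by move=> y yx; exact: (has_derive_continuous (d y yx)).
- by move=> y yx _; exact: d.
- by rewrite (funext E); exact: cvg_cst.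
- by rewrite (funext E); exact: cvg_cst.
Qed.

(** On [-1, 1] the primitive is (y sqrt(1 - y^2) + arcsin y) / 2; the limit pi/2 is the area of the
    half disc. *)
Lemma primitive_W0 : exists P : R -> R, [/\ continuous P,
  forall y, y \notin pm1 -> has_derive P y (W 0 y) &
  forall x, P (x + r) - P (x - r) @[r --> +oo] --> pi / 2].
Proof.
pose A y := y * Num.sqrt (1 - y ^+ 2) / 2 + atan (half_angle y).
pose B y := Num.sg y * (pi / 4).
exists (glue A B); split.
- move=> y; apply: continuous_glue => y1.
  + apply: cvgD; last exact: continuous_atan_half_angle.
    apply: cvgM; last exact: cvg_cst.
    by apply: cvgM; [exact: cvg_id|exact: continuous_sqrt_in].
  + by apply: cvgM; [exact: continuous_sg_out|exact: cvg_cst].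
  + move: y1 => /norm1_cases[->|->]; rewrite /A /B.
      by rewrite half_angle1 expr1n subrr sqrtr0 atan1 sgr1; ring.
    by rewrite half_angleN1 sqrrN expr1n subrr sqrtr0 atanN atan1 sgrN sgr1; ring.
- move=> y /notin_pm1; rewrite neq_lt => /orP[y1|y1]; last first.
    apply: has_derive_glue_out => //; apply: has_derive_eq.
      by apply: has_deriveM; [exact: has_derive_sg_out|exact: has_derive_cst].
    by rewrite W_out ?ltW//; ring.
  apply: (has_derive_glue_in _ y1); apply: has_derive_eq.
    apply: has_deriveD.
      apply: has_deriveM; last exact: has_derive_cst.
      by apply: has_deriveM; [exact: has_derive_id|exact: has_derive_sqrt_in].
    exact: has_derive_atan_half_angle.
  rewrite W_in ?ltW// chebU0.
  have s0 := sqrt_in_gt0 y1; have s2 := sqr_sqrt_in (ltW y1).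
  have sn0 : Num.sqrt (1 - y ^+ 2) != 0 by rewrite gt_eqF.
  apply: (mulIf sn0).
  transitivity ((Num.sqrt (1 - y ^+ 2) ^+ 2 + (1 - y ^+ 2)) / 2).
    by field; rewrite sn0.
  by rewrite -[X in _ + X]s2; field.
- move=> x; apply: cvg_near_cst; near=> r.
  have [r1 r2] : 1 < x + r /\ x - r < -1 by near: r; exact: near_pinfty_incr.
  have p1 : 1 < `|x + r| by rewrite lter_normr r1.
  have q1 : 1 < `|x - r| by rewrite lter_normr; apply/orP; right; lra.
  rewrite /glue !leNgt p1 q1 /= /B gtr0_sg; last lra.
  by rewrite ltr0_sg; [field|lra].
Unshelve. all: by end_near. Qed.

Lemma primitive_Ttilde1 : exists P : R -> R, [/\ continuous P,
  forall y, y \notin pm1 -> has_derive P y (Ttilde 1 y) &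
  forall x, P (x + r) - P (x - r) @[r --> +oo] --> 0].
Proof.
pose A (y : R) := y ^+ 2 / 2.
(* In the variable j, j dy is (j - 1/j)/2 dj, with primitive j^2/4 - ln |j| / 2; the constant 1/4
   matches the value 1/2 of [A] at the endpoints. *)
pose B y := joukowski y ^+ 2 / 4 - ln `|joukowski y| / 2 + 4^-1.
exists (glue A B); split.
- move=> y; apply: continuous_glue => y1.
  + by apply: cvgM; [exact: exprn_continuous|exact: cvg_cst].
  + have cj := continuous_joukowski y1.
    apply: cvgD; last exact: cvg_cst.
    apply: cvgB; apply: cvgM; try exact: cvg_cst.
      apply: (@continuous_comp _ _ _ (@joukowski R) (fun z => z ^+ 2)).
        exact: cj.
      exact: exprn_continuous.
    apply: (@continuous_comp _ _ _ (fun z => `|joukowski z|) (@ln R)).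
      by apply: cvg_norm; exact: cj.
    by apply: continuous_ln; rewrite normr_gt0 joukowski_neq0_ge.
  + rewrite /A /B joukowski_norm1// y1 ln1 -[y ^+ 2]real_normK ?num_real// y1.
    by field.
- move=> y /notin_pm1; rewrite neq_lt => /orP[y1|y1].
    rewrite Ttilde_in ?ltW// chebT1; apply: (has_derive_glue_in _ y1).
    apply: has_derive_eq.
      by apply: has_deriveM; [apply/has_deriveX/has_derive_id|exact: has_derive_cst].
    by rewrite /= expr1; field.
  rewrite Ttilde_out// expr1; apply: (has_derive_glue_out _ y1).
  have j0 := joukowski_neq0 y1; have j2 := joukowski_quadratic y1.
  have dJ := has_derive_joukowski_frac y1.
  apply: has_derive_eq.
    apply: has_deriveD; last exact: has_derive_cst.
    apply: has_deriveB; apply: has_deriveM; try exact: has_derive_cst.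
      exact: has_deriveX dJ.
    by apply: has_derive_ln_norm; [exact: j0|exact: dJ].
  by rewrite /= expr1; field; rewrite j0 j2.
- move=> x.
  have lim : (joukowski (x + r) * joukowski (x + r) -
      joukowski (x - r) * joukowski (x - r)) / 4 -
      (ln `|joukowski (x + r)| - ln `|joukowski (x - r)|) / 2 @[r --> +oo] -->
      ((0 * 0 - 0 * 0) / 4 - 0 / 2 : R).
    apply: cvgB; apply: cvgM; try exact: cvg_cst.
      by apply: cvgB; apply: cvgM; (exact: cvg_joukowski_addr || exact: cvg_joukowski_subr).
    exact: cvg_ln_joukowski_increment.
  rewrite !mul0r subrr mul0r subrr in lim.
  apply: cvg_trans lim; apply: near_eq_cvg; near=> r.
  have [r1 r2] : 1 < x + r /\ x - r < -1 by near: r; exact: near_pinfty_incr.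
  have p1 : 1 < `|x + r| by rewrite lter_normr r1.
  have q1 : 1 < `|x - r| by rewrite lter_normr; apply/orP; right; lra.
  by rewrite /glue !leNgt p1 q1 /= /B; ring.
Unshelve. all: by end_near. Qed.

Lemma odd_primitive_W n x : odd_primitive pm1 (W n) x (pi * Ttilde n.+1 x).
Proof.
have W0 : odd_primitive pm1 (W 0) x (pi * Ttilde 1 x).
  have [x1|x1] := ltP `|x| 1.
    by rewrite Ttilde_in ?ltW// chebT1; exact: odd_primitive_W0_in.
  have -> : Ttilde 1 x = joukowski x; last exact: odd_primitive_W0_out.
  move: x1; rewrite le_eqVlt => /predU1P[/esym x1|x1].
    by rewrite joukowski_norm1// Ttilde_in ?x1// chebT1.
  by rewrite Ttilde_out// expr1.
elim/pair_ind: n => [||n IH1 IH2]; first exact: W0.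
  have [P [cP dP lP]] := primitive_W0.
  (* Index 1 uses W_{-1} = 0; the term pi [Ttilde 0] that the recurrence requires comes from the
     integral pi/2 of [W 0]. *)
  apply: odd_primitive_eq (odd_primitive_rec cP dP (lP x) W0 (odd_primitive0 pm1 x)).
    by move=> y; rewrite subr0 W1.
  by rewrite Ttilde_rec Ttilde0; field.
(* By [W_V] and [has_derive_W] this is a primitive of [W n.+1]. It vanishes outside (-1, 1), so from
   here on the integral term is 0. *)
pose P y := (W n.+2 y / n.+3%:R - W n y / n.+1%:R) / 2.
have P0 : P (x + r) - P (x - r) @[r --> +oo] --> 0.
  rewrite [X in _ --> X](_ : 0 = (0 / n.+3%:R - 0 / n.+1%:R) / 2 -
    (0 / n.+3%:R - 0 / n.+1%:R) / 2); last by rewrite subrr.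
  apply: cvgB; apply: cvgM; try exact: cvg_cst; apply: cvgB; apply: cvgM;
    try exact: cvg_cst; (exact: (@decays_cvg_addr _ x (@decays_W R _)) ||
    exact: (@decays_cvg_subr _ x (@decays_W R _))).
have cP : continuous P.
  move=> y; apply: cvgM; last exact: cvg_cst.
  by apply: cvgB; apply: cvgM; try exact: cvg_cst; apply: holder_continuous;
    exact: holder_W.
have dP y : y \notin pm1 -> has_derive P y (W n.+1 y).
  move=> /notin_pm1 y1; apply: has_derive_eq.
    apply: has_deriveM; last exact: has_derive_cst.
    apply: has_deriveB; apply: has_deriveM; try exact: has_derive_cst.
      exact: (has_derive_W n.+2 y1).
    exact: (has_derive_W n y1).
  cbv beta; rewrite (W_V n.+1); field.
  by rewrite nat1r -natrD !pnatr_eq0.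
apply: odd_primitive_eq (odd_primitive_rec cP dP P0 IH2 IH1).
  by move=> y; rewrite W_rec.
by rewrite (Ttilde_rec n.+1); ring.
Qed.

Lemma odd_primitive_Ttilde n x :
  odd_primitive pm1 (Ttilde n.+1) x (- (pi * W n x)).
Proof.
have T1 : odd_primitive pm1 (Ttilde 1) x (- (pi * W 0 x)).
  have [x1|x1|x1] := ltgtP `|x| 1.
  - by rewrite W_in ?ltW// chebU0 mulr1; exact: odd_primitive_Ttilde1_in.
  - by rewrite W_out ?ltW// mulr0 oppr0; exact: odd_primitive_Ttilde1_out.
  - by rewrite W_out ?x1// mulr0 oppr0; exact: odd_primitive_Ttilde1_pm1.
elim/pair_ind: n => [||n IH1 IH2]; first exact: T1.
  have [P [cP dP lP]] := primitive_Ttilde1.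
  (* The constant [Ttilde 0] contributes 0, matching W_{-1} = 0, and the symmetric integral of
     [Ttilde 1] is 0 as well. *)
  apply: odd_primitive_eq (odd_primitive_rec cP dP (lP x) T1 (odd_primitive1 pm1 x)).
    by move=> y; rewrite Ttilde_rec Ttilde0.
  by rewrite W1; ring.
(* A primitive of [Ttilde n.+2] by [has_derive_Ttilde] and [Ttilde_Utilde2]; its decay makes the
   integral term 0. *)
pose P y := (Ttilde n.+3 y / n.+3%:R - Ttilde n.+1 y / n.+1%:R) / 2.
have P0 : P (x + r) - P (x - r) @[r --> +oo] --> 0.
  rewrite [X in _ --> X](_ : 0 = (0 / n.+3%:R - 0 / n.+1%:R) / 2 -
    (0 / n.+3%:R - 0 / n.+1%:R) / 2); last by rewrite subrr.
  apply: cvgB; apply: cvgM; try exact: cvg_cst; apply: cvgB; apply: cvgM;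
    try exact: cvg_cst; (exact: (@decays_cvg_addr _ x (@decays_Ttilde R _)) ||
    exact: (@decays_cvg_subr _ x (@decays_Ttilde R _))).
have cP : continuous P.
  move=> y; apply: cvgM; last exact: cvg_cst.
  by apply: cvgB; apply: cvgM; try exact: cvg_cst; apply: holder_continuous;
    exact: (@holder_Ttilde R _).2.
have dP y : y \notin pm1 -> has_derive P y (Ttilde n.+2 y).
  move=> /notin_pm1 y1; apply: has_derive_eq.
    apply: has_deriveM; last exact: has_derive_cst.
    apply: has_deriveB; apply: has_deriveM; try exact: has_derive_cst.
      exact: (has_derive_Ttilde n.+2 y1).
    exact: (has_derive_Ttilde n y1).
  cbv beta; rewrite (Ttilde_Utilde2 n.+1); field.
  by rewrite nat1r -natrD !pnatr_eq0.
apply: odd_primitive_eq (odd_primitive_rec cP dP P0 IH2 IH1).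
  by move=> y; rewrite (Ttilde_rec n.+1).
by rewrite W_rec; ring.
Qed.

End HilbertTransforms.

(** * Integrability on rays and open intervals *)

Section PiecewiseIntegrability.
Variable R : realType.
Local Notation mu := (@lebesgue_measure R).
Implicit Types (a b x : R) (f F h : R -> R).

Lemma archi_inv (d : R) : 0 < d -> exists n : nat, d <= n.+1%:R /\ n.+1%:R^-1 <= d.
Proof.
move=> d0; exists (Num.bound (d + d^-1)).
have di : 0 < d^-1 by rewrite invr_gt0.
have h : d + d^-1 < (Num.bound (d + d^-1))%:R.
  by apply: archi_boundP; rewrite addr_ge0// ltW.
split; first by rewrite -natr1; lra.
by rewrite -[leRHS]invrK lef_pV2 ?posrE// -natr1; lra.
Qed.

Lemma invr_nat_le (n m : nat) : (n <= m)%N -> m.+1%:R^-1 <= n.+1%:R^-1 :> R.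
Proof. by move=> nm; rewrite lef_pV2 ?posrE// ler_nat. Qed.

Lemma invr_nat_le1 (n : nat) : n.+1%:R^-1 <= 1 :> R.
Proof. by rewrite invf_le1// ler1n. Qed.

Lemma integrable_derive_ray_right b f F h C :
  (forall y, b < y -> {for y, continuous f}) ->
  (forall y, b < y -> {for y, continuous h}) ->
  (forall y, b < y -> has_derive F y (h y)) ->
  (forall y, b < y -> `|f y| <= h y) -> (forall y, b < y -> `|F y| <= C) ->
  mu.-integrable `]b, +oo[ (EFin \o f).
Proof.
move=> cf ch dF fh FC.
have inD y : `]b, +oo[%classic y -> b < y by rewrite /= in_itv/= andbT.
apply: (@integrable_derive_bound _ (fun n => b + n.+1%:R^-1) (fun n => b + n.+1%:R) _ _ F h C).
- apply/seteqP; split=> y /=; rewrite in_itv/= andbT.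
    rewrite -subr_gt0 => /archi_inv[n [n1 n2]].
    by exists n => //=; rewrite in_itv/= -lerBrDl n2 -lerBlDl n1.
  move=> [n _ /=]; rewrite in_itv/= => /andP[yn _].
  by apply: lt_le_trans yn; rewrite ltrDl invr_gt0.
- move=> n m nm y /=; rewrite !in_itv/= => /andP[h1 h2].
  have : n.+1%:R <= m.+1%:R :> R by rewrite ler_nat.
  move: (invr_nat_le nm) h1 h2; move: (n.+1%:R^-1) (m.+1%:R^-1) => p q.
  by move: (n.+1%:R) (m.+1%:R) => p' q'; lra.
- move=> n; have : 1 <= n.+1%:R :> R by rewrite ler1n.
  move: (invr_nat_le1 n); move: (n.+1%:R^-1) => p.
  by move: (n.+1%:R) => p'; lra.
- apply: open_continuous_measurable_fun; first exact: interval_open.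
  by move=> y /set_mem /inD; exact: cf.
- by move=> y /inD; exact: ch.
- by move=> y /inD; exact: dF.
- by move=> y /inD; exact: fh.
- by move=> y /inD; exact: FC.
Qed.

Lemma integrable_derive_ray_left a f F h C :
  (forall y, y < a -> {for y, continuous f}) ->
  (forall y, y < a -> {for y, continuous h}) ->
  (forall y, y < a -> has_derive F y (h y)) ->
  (forall y, y < a -> `|f y| <= h y) -> (forall y, y < a -> `|F y| <= C) ->
  mu.-integrable `]-oo, a[ (EFin \o f).
Proof.
move=> cf ch dF fh FC.
have inD y : `]-oo, a[%classic y -> y < a by rewrite /= in_itv.
apply: (@integrable_derive_bound _ (fun n => a - n.+1%:R) (fun n => a - n.+1%:R^-1) _ _ F h C).
- apply/seteqP; split=> y /=; rewrite in_itv/=.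
    rewrite -subr_gt0 => /archi_inv[n [n1 n2]].
    by exists n => //=; rewrite in_itv/= lerBlDr -lerBlDl n1 lerBrDl -lerBrDr n2.
  move=> [n _ /=]; rewrite in_itv/= => /andP[_ yn].
  by apply: le_lt_trans yn _; rewrite ltrBlDr ltrDl invr_gt0.
- move=> n m nm y /=; rewrite !in_itv/= => /andP[h1 h2].
  have : n.+1%:R <= m.+1%:R :> R by rewrite ler_nat.
  move: (invr_nat_le nm) h1 h2; move: (n.+1%:R^-1) (m.+1%:R^-1) => p q.
  by move: (n.+1%:R) (m.+1%:R) => p' q'; lra.
- move=> n; have : 1 <= n.+1%:R :> R by rewrite ler1n.
  move: (invr_nat_le1 n); move: (n.+1%:R^-1) => p.
  by move: (n.+1%:R) => p'; lra.
- apply: open_continuous_measurable_fun; first exact: interval_open.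
  by move=> y /set_mem /inD; exact: cf.
- by move=> y /inD; exact: ch.
- by move=> y /inD; exact: dF.
- by move=> y /inD; exact: fh.
- by move=> y /inD; exact: FC.
Qed.

Lemma integrable_derive_itv a b f F h C : a < b ->
  (forall y, a < y < b -> {for y, continuous f}) ->
  (forall y, a < y < b -> {for y, continuous h}) ->
  (forall y, a < y < b -> has_derive F y (h y)) ->
  (forall y, a < y < b -> `|f y| <= h y) -> (forall y, a < y < b -> `|F y| <= C) ->
  mu.-integrable `]a, b[ (EFin \o f).
Proof.
move=> ab cf ch dF fh FC; have ba : 0 < b - a by rewrite subr_gt0.
have inD y : `]a, b[%classic y -> a < y < b by rewrite /= in_itv.
have half n : n.+2%:R^-1 <= 2^-1 :> R by rewrite lef_pV2 ?posrE// ler_nat.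
have pos n : 0 < (b - a) * n.+2%:R^-1 by rewrite mulr_gt0// invr_gt0.
(* Using [n.+2] keeps each margin at most half of the interval, so the endpoints of every segment
   are in order. *)
apply: (@integrable_derive_bound _ (fun n => a + (b - a) * n.+2%:R^-1)
  (fun n => b - (b - a) * n.+2%:R^-1) _ _ F h C).
- apply/seteqP; split=> y /=; rewrite in_itv/=.
    move=> /andP[ay yb].
    have d0 : 0 < Num.min ((y - a) / (b - a)) ((b - y) / (b - a)).
      by rewrite lt_min !divr_gt0// subr_gt0.
    have [n [_]] := archi_inv d0; rewrite le_min => /andP[n1 n2].
    have n3 : n.+2%:R^-1 <= n.+1%:R^-1 :> R by rewrite lef_pV2 ?posrE// ler_nat.
    have := le_trans n3 n1; have := le_trans n3 n2.
    rewrite !ler_pdivlMr// => m2 m1; exists n => //=; rewrite in_itv/=.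
    rewrite ![(b - a) * _]mulrC; move: m1 m2.
    by move: (n.+2%:R^-1 * (b - a)) => p; lra.
  move=> [n _ /=]; rewrite in_itv/= => /andP[y1 y2].
  by move: y1 y2 (pos n); move: ((b - a) * n.+2%:R^-1) => p; lra.
- move=> n m nm y /=; rewrite !in_itv/= => /andP[h1 h2].
  have : (b - a) * m.+2%:R^-1 <= (b - a) * n.+2%:R^-1.
    by rewrite ler_wpM2l// ?(ltW ba)//; exact: (@invr_nat_le n.+1 m.+1).
  by move: h1 h2; move: ((b - a) * m.+2%:R^-1) ((b - a) * n.+2%:R^-1) => p q; lra.
- move=> n; have : (b - a) * n.+2%:R^-1 <= (b - a) * 2^-1.
    by rewrite ler_wpM2l ?(ltW ba).
  by move: ((b - a) * n.+2%:R^-1) => p; lra.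
- apply: open_continuous_measurable_fun; first exact: interval_open.
  by move=> y /set_mem /inD; exact: cf.
- by move=> y /inD; exact: ch.
- by move=> y /inD; exact: dF.
- by move=> y /inD; exact: fh.
- by move=> y /inD; exact: FC.
Qed.

Lemma integrable_pieces a b f : a < b ->
  mu.-integrable `]-oo, a[ (EFin \o f) -> mu.-integrable `]a, b[ (EFin \o f) ->
  mu.-integrable `]b, +oo[ (EFin \o f) -> mu.-integrable setT (EFin \o f).
Proof.
move=> ab iA iB iC.
have mkc (I : interval R) : mu.-integrable [set` I] (EFin \o f) ->
    mu.-integrable setT (EFin \o (f \_ [set` I])).
  rewrite -restrict_EFin => iI; apply: (integrable_mkcond _ _).1 iI.
  exact: measurable_itv.
(* The open pieces omit [a] and [b]; multiples of the indicators of these points restore the values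
   of [f], so that the sum equals [f] everywhere. *)
have pt c : mu.-integrable setT (EFin \o (fun x => f c * \1_(`[c, c]%classic) x)).
  by apply: integrable_scale => //; exact: integrable_indic_itv.
have := integrableD measurableT (integrableD measurableT (pt a) (pt b))
  (integrableD measurableT (integrableD measurableT (mkc _ iA) (mkc _ iB)) (mkc _ iC)).
apply: eq_integrable => // x _ /=; congr EFin.
rewrite !patchE !indicE !mem_setE !in_itv/= !andbT.
have [xa|xa|xa] := ltgtP x a; have [xb|xb|xb] := ltgtP x b => /=;
  rewrite ?xa ?xb ?mulr0 ?mulr1 ?addr0 ?add0r //; lra.
Qed.

End PiecewiseIntegrability.

(** * The basis functions on a general interval *)

Section Columns.
Variable R : realType.
Local Notation mu := (@lebesgue_measure R).
Implicit Types (a b x y : R) (n : nat).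

Lemma to_ref_slope_gt0 a b : a < b -> 0 < 2 / (b - a).
Proof. by move=> ab; rewrite divr_gt0// subr_gt0. Qed.

Lemma has_derive_to_ref a b x : has_derive (to_ref a b) x (2 / (b - a)).
Proof.
apply: has_derive_eq.
  apply: has_deriveM; first exact: has_derive_cst.
  by apply: has_deriveB; [exact: has_derive_id|exact: has_derive_cst].
by rewrite mul0r add0r subr0 mulr1.
Qed.

Lemma to_ref_gt1 a b x : a < b -> b < x -> 1 < to_ref a b x.
Proof.
move=> ab bx; rewrite /to_ref mulrAC ltr_pdivlMr ?subr_gt0// mul1r; lra.
Qed.

Lemma to_ref_ltN1 a b x : a < b -> x < a -> to_ref a b x < -1.
Proof.
move=> ab xa; rewrite /to_ref mulrAC ltr_pdivrMr ?subr_gt0//; lra.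
Qed.

Lemma to_ref_in a b x : a < b -> a < x < b -> `|to_ref a b x| < 1.
Proof.
move=> ab /andP[ax xb]; rewrite ltr_norml /to_ref mulrAC.
rewrite ltr_pdivlMr ?ltr_pdivrMr ?subr_gt0// mul1r.
by apply/andP; split; lra.
Qed.

Lemma to_ref_norm_neq1 a b x : a < b -> x != a -> x != b -> `|to_ref a b x| != 1.
Proof.
move=> ab xa xb.
have [xa'|ax|/eqP] := ltgtP x a; last by rewrite (negPf xa).
  have := to_ref_ltN1 ab xa' => h; rewrite gt_eqF// lter_normr.
  by apply/orP; right; lra.
have [xb'|bx|/eqP] := ltgtP x b; last by rewrite (negPf xb).
  by rewrite lt_eqF// to_ref_in// ax.
by rewrite gt_eqF// lter_normr to_ref_gt1.
Qed.

Lemma to_ref_eq2 a b : a < b -> to_ref a b ((a + b) / 2 + (b - a)) = 2.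
Proof.
by move=> ab; rewrite /to_ref; field; rewrite gt_eqF// subr_gt0.
Qed.

(** [is_hilbert] and [is_half_laplacian] follow a convention at [Ttilde 0], so the other columns
    have to be told apart from it; the value at the point that [to_ref] sends to 2 does so. *)
Lemma W_to_ref_neq a b n : a < b -> W n \o to_ref a b <> @Ttilde R 0.
Proof.
move=> ab /(congr1 (fun f => f ((a + b) / 2 + (b - a)))) /=.
rewrite to_ref_eq2// W_out ?normr_nat ?ler1n// Ttilde0 => /esym/eqP.
by rewrite oner_eq0.
Qed.

Lemma Ttilde_to_ref_neq a b n : a < b -> Ttilde n.+1 \o to_ref a b <> @Ttilde R 0.
Proof.
move=> ab /(congr1 (fun f => f ((a + b) / 2 + (b - a)))) /=.
have n2 : 1 < `|2 : R| by rewrite normr_nat ltr1n.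
rewrite to_ref_eq2// Ttilde_out// Ttilde0 => /(congr1 Num.norm).
rewrite normr1 normrX => /eqP; rewrite lt_eqF//.
by rewrite exprn_ilt1// joukowski_norm_lt1.
Qed.

Lemma decays_to_ref (u : R -> R) a b : a < b -> decays u -> decays (u \o to_ref a b).
Proof.
move=> ab [C uC]; have C0 := decays_ge0 uC; have c0 := to_ref_slope_gt0 ab.
(* Chosen for 1 + |x| <= K (1 + c |x - d|), with c the slope of [to_ref] and d the midpoint. *)
pose K := 1 + `|(a + b) / 2| + (2 / (b - a))^-1.
exists (C * K) => x; apply: (le_trans (uC _)); rewrite -mulrA ler_wpM2l//.
rewrite ler_pdivlMr ?ltr_pwDl// mulrC ler_pdivrMr ?ltr_pwDl//.
rewrite /to_ref normrM (gtr0_norm c0) /K.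
have := ler_normD (x - (a + b) / 2) ((a + b) / 2); rewrite subrK => h.
move: h c0; move: (2 / (b - a)) (`|(a + b) / 2|) (normr_ge0 ((a + b) / 2)).
move: (`|x - (a + b) / 2|) (normr_ge0 (x - (a + b) / 2)) => t t0 c d d0 h c0.
have ci : c^-1 * c = 1 by rewrite mulVf// gt_eqF.
have ci0 : 0 < c^-1 by rewrite invr_gt0.
have : 0 <= d * (c * t) by rewrite !mulr_ge0// ltW.
have : 0 <= c * t by rewrite mulr_ge0// ltW.
have -> : (1 + d + c^-1) * (1 + c * t) =
  1 + d + c^-1 + c * t + d * (c * t) + c^-1 * c * t by ring.
by rewrite ci; lra.
Qed.

Lemma holder_to_ref (u : R -> R) a b : holder u -> holder (u \o to_ref a b).
Proof. exact: holder_comp_affine. Qed.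

Lemma pv_to_ref (u : R -> R) a b x (l : R) : a < b -> holder u -> decays u ->
  odd_primitive [:: -1; 1] u (to_ref a b x) l ->
  is_pv (fun y => (u \o to_ref a b) y / (x - y)) x l.
Proof.
move=> ab hu du op.
apply: pv_of_odd_primitive (odd_primitive_affine (to_ref_slope_gt0 ab) op).
- by apply: holder_continuous; exact: holder_to_ref.
- exact: decays_to_ref.
Qed.

Lemma pv_W a b n x : a < b ->
  is_pv (fun y => (W n \o to_ref a b) y / (x - y)) x
    (pi * Ttilde n.+1 (to_ref a b x)).
Proof.
move=> ab; apply: pv_to_ref => //.
- exact: holder_W.
- exact: decays_W.
- exact: odd_primitive_W.
Qed.

Lemma pv_Ttilde a b n x : a < b ->
  is_pv (fun y => (Ttilde n.+1 \o to_ref a b) y / (x - y)) x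
    (pi * - W n (to_ref a b x)).
Proof.
move=> ab; apply: pv_to_ref => //.
- exact: (@holder_Ttilde R _).2.
- exact: decays_Ttilde.
- by rewrite mulrN; exact: odd_primitive_Ttilde.
Qed.

Lemma hilbert_W a b n x : a < b ->
  is_hilbert (W n \o to_ref a b) x (Ttilde n.+1 (to_ref a b x)).
Proof.
move=> ab; rewrite /is_hilbert asboolF; last exact: W_to_ref_neq.
exists (pi * Ttilde n.+1 (to_ref a b x)); first exact: pv_W.
by rewrite mulrA mulVf ?mul1r// gt_eqF// pi_gt0.
Qed.

Lemma hilbert_Ttilde a b n x : a < b ->
  is_hilbert (Ttilde n.+1 \o to_ref a b) x (- W n (to_ref a b x)).
Proof.
move=> ab; rewrite /is_hilbert asboolF; last exact: Ttilde_to_ref_neq.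
exists (pi * - W n (to_ref a b x)); first exact: pv_Ttilde.
by rewrite mulrA mulVf ?mul1r// gt_eqF// pi_gt0.
Qed.

Lemma has_derive_W_to_ref a b n x : a < b -> x != a -> x != b ->
  has_derive (W n \o to_ref a b) x
    (- (n.+1%:R * V n.+1 (to_ref a b x)) * (2 / (b - a))).
Proof.
move=> ab xa xb; apply: (@has_derive_comp _ (W n) (to_ref a b)).
  exact/has_derive_W/to_ref_norm_neq1.
exact: has_derive_to_ref.
Qed.

Lemma has_derive_Ttilde_to_ref a b n x : a < b -> x != a -> x != b ->
  has_derive (Ttilde n.+1 \o to_ref a b) x
    (n.+1%:R * Utilde2 n.+2 (to_ref a b x) * (2 / (b - a))).
Proof.
move=> ab xa xb; apply: (@has_derive_comp _ (Ttilde n.+1) (to_ref a b)).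
  exact/has_derive_Ttilde/to_ref_norm_neq1.
exact: has_derive_to_ref.
Qed.

Lemma continuous_to_ref_comp (g : R -> R) a b x :
  {for to_ref a b x, continuous g} -> {for x, continuous (g \o to_ref a b)}.
Proof.
move=> cg; apply: continuous_comp; last exact: cg.
exact: (has_derive_continuous (has_derive_to_ref a b x)).
Qed.

Lemma continuous_V_to_ref a b n x : a < b -> x != a -> x != b ->
  {for x, continuous (fun x => n.+1%:R * V n.+1 (to_ref a b x) * (2 / (b - a)))}.
Proof.
move=> ab xa xb; apply: cvgM; last exact: cvg_cst.
apply: cvgM; first exact: cvg_cst.
exact/continuous_to_ref_comp/continuous_V/to_ref_norm_neq1.
Qed.

Lemma continuous_Utilde2_to_ref a b n x : a < b -> x != a -> x != b ->
  {for x, continuous (fun x => n.+1%:R * Utilde2 n.+2 (to_ref a b x) * (2 / (b - a)))}.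
Proof.
move=> ab xa xb; apply: cvgM; last exact: cvg_cst.
apply: cvgM; first exact: cvg_cst.
exact/continuous_to_ref_comp/continuous_Utilde2/to_ref_norm_neq1.
Qed.

(** [joukowski y] has the sign of [y], so the sign of [Utilde2 n.+2] is constant on each side of
    [-1, 1]. Its modulus is therefore, up to a constant factor, the derivative of [Ttilde n.+1]
    there. *)
Lemma normr_Utilde2 n y : 1 < `|y| ->
  `|Utilde2 n.+2 y| = - (Num.sg y ^+ n * Utilde2 n.+2 y).
Proof.
move=> y1; have s0 := sqrt_out_gt0 y1; have sg2 := sgr_out y1.
have sg1 : `|Num.sg y| = 1.
  by rewrite normr_sg -normr_gt0 (lt_trans ltr01).
have jE : joukowski y = Num.sg y * `|joukowski y|.
  rewrite [LHS]numEsg; congr (_ * _); rewrite -[joukowski y]invrK sgrV joukowski_inv//.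
  have -> : y + Num.sg y * Num.sqrt (y ^+ 2 - 1) =
    Num.sg y * (`|y| + Num.sqrt (y ^+ 2 - 1)) by rewrite mulrDr -numEsg.
  have y0 : 0 < `|y| by rewrite (lt_trans ltr01).
  by rewrite sgrM sgr_id (gtr0_sg (addr_gt0 y0 s0)) mulr1.
rewrite Utilde2_out// normrN normrM normrM normrX sg1 mul1r normfV (gtr0_norm s0).
have sgn : Num.sg y ^+ n * (Num.sg y * Num.sg y ^+ n.+1) = 1.
  by rewrite mulrA -exprSr -exprMn -expr2 sg2 expr1n.
rewrite mulrN opprK [in RHS]jE exprMn.
transitivity (Num.sg y ^+ n * (Num.sg y * Num.sg y ^+ n.+1) *
  (`|joukowski y| ^+ n.+1 / Num.sqrt (y ^+ 2 - 1))); last by ring.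
by rewrite sgn mul1r.
Qed.

(** On the rays the modulus is, up to sign, the derivative of a bounded function by [normr_Utilde2];
    between [a] and [b] the polynomial U_n is bounded. *)
Lemma integrable_Utilde2_to_ref a b n : a < b -> mu.-integrable setT
  (EFin \o (fun x => n.+1%:R * Utilde2 n.+2 (to_ref a b x) * (2 / (b - a)))).
Proof.
move=> ab; set f := fun x => _; have c0 := to_ref_slope_gt0 ab.
have [[C hC] _] := @holder_Ttilde R n.+1.
have bF (s : R) : `|s| <= 1 -> forall x, `|s * Ttilde n.+1 (to_ref a b x)| <= C.
  move=> s1 x; rewrite normrM; apply: le_trans (hC (to_ref a b x)).
  by rewrite ler_piMl.
have absf x : 1 < `|to_ref a b x| -> `|f x| = - (Num.sg (to_ref a b x) ^+ n) * f x.
  move=> x1; rewrite /f normrM (gtr0_norm c0) normrM normr_nat normr_Utilde2//; ring.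
apply: (integrable_pieces ab).
- apply: (@integrable_derive_ray_left _ a f
    (fun x => - (-1) ^+ n * Ttilde n.+1 (to_ref a b x)) (fun x => - (-1) ^+ n * f x) C).
  + by move=> x xa; apply: continuous_Utilde2_to_ref => //; rewrite lt_eqF// (lt_trans xa).
  + move=> x xa; apply: cvgM; first exact: cvg_cst.
    by apply: continuous_Utilde2_to_ref => //; rewrite lt_eqF// (lt_trans xa).
  + move=> x xa; apply: has_derive_eq.
      apply: has_deriveM; first exact: has_derive_cst.
      by apply: has_derive_Ttilde_to_ref; rewrite ?lt_eqF// (lt_trans xa).
    by rewrite mul0r add0r.
  + move=> x xa; have x1 := to_ref_ltN1 ab xa.
    by rewrite absf ?ltr0_sg//; [lra|rewrite lter_normr; apply/orP; right; lra].
  + by move=> x _; apply: bF; rewrite normrN normrX normrN normr1 expr1n.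
- have [[M hM] _] := holder_poly_clamp (chebU R n).
  pose M' := n.+1%:R * M * (2 / (b - a)).
  have M00 : 0 <= M := le_trans (normr_ge0 _) (hM 0).
  have M0 : 0 <= M' by rewrite mulr_ge0 ?(ltW c0)// mulr_ge0.
  apply: (@integrable_derive_itv _ a b f (fun x => M' * x) (fun=> M') (M' * (`|a| + `|b|)) ab).
  + move=> x /andP[ax xb].
    by apply: continuous_Utilde2_to_ref; rewrite ?(gt_eqF ax) ?(lt_eqF xb).
  + by move=> *; exact: cvg_cst.
  + move=> x _; apply: has_derive_eq.
      by apply: has_deriveM; [exact: has_derive_cst|exact: has_derive_id].
    by rewrite mul0r add0r mulr1.
  + move=> x xab; have x1 := ltW (to_ref_in ab xab).
    rewrite /f normrM (gtr0_norm c0) normrM normr_nat Utilde2_in//.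
    have := hM (to_ref a b x); rewrite clamp_id// => h.
    by rewrite ler_wpM2r ?(ltW c0)// ler_wpM2l.
  + move=> x /andP[ax xb]; rewrite normrM ger0_norm// ler_wpM2l//.
    have := ler_norm b; have := ler_norm (- a); rewrite normrN.
    by have := normr_ge0 a; have := normr_ge0 b; rewrite ler_norml; lra.
- apply: (@integrable_derive_ray_right _ b f
    (fun x => - 1 * Ttilde n.+1 (to_ref a b x)) (fun x => - 1 * f x) C).
  + by move=> x bx; apply: continuous_Utilde2_to_ref => //; rewrite gt_eqF// (lt_trans _ bx).
  + move=> x bx; apply: cvgM; first exact: cvg_cst.
    by apply: continuous_Utilde2_to_ref => //; rewrite gt_eqF// (lt_trans _ bx).
  + move=> x bx; apply: has_derive_eq.
      apply: has_deriveM; first exact: has_derive_cst.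
      by apply: has_derive_Ttilde_to_ref; rewrite ?gt_eqF// (lt_trans _ bx).
    by rewrite mul0r add0r.
  + move=> x bx; have x1 := to_ref_gt1 ab bx.
    by rewrite absf ?gtr0_sg ?expr1n//; [lra|rewrite lter_normr x1].
  + by move=> x _; apply: bF; rewrite normrN normr1.
Qed.

Lemma integrable_V_to_ref a b n : a < b -> mu.-integrable setT
  (EFin \o (fun x => n.+1%:R * V n.+1 (to_ref a b x) * (2 / (b - a)))).
Proof.
move=> ab; set f := fun x => _; have c0 := to_ref_slope_gt0 ab.
have V0 y : 1 < `|y| -> V n.+1 y = 0 by move=> /ltW y1; rewrite /V ltNge y1.
apply: (integrable_pieces ab).
- apply: (@integrable_derive_ray_left _ a f (fun=> 0) (fun=> 0) 0).
  + by move=> x xa; apply: continuous_V_to_ref => //; rewrite lt_eqF// (lt_trans xa).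
  + by move=> *; exact: cvg_cst.
  + by move=> *; exact: has_derive_cst.
  + move=> x xa; have x1 := to_ref_ltN1 ab xa.
    rewrite /f V0 ?mulr0 ?mul0r ?normr0//.
    by rewrite lter_normr; apply/orP; right; lra.
  + by move=> *; rewrite normr0.
- have [[M hM] _] := holder_poly_clamp (chebT R n.+1).
  pose M' := n.+1%:R * M.
  have M00 : 0 <= M := le_trans (normr_ge0 _) (hM 0).
  have M0 : 0 <= M' by rewrite mulr_ge0.
  (* The arctangent of the half angle is half an arcsine, hence the factor 2: [F] is M' times the
     arcsine, and its derivative dominates because T_{n+1} is bounded by [M] on [-1, 1]. *)
  pose F x := 2 * M' * atan (half_angle (to_ref a b x)).
  pose h x := M' * (Num.sqrt (1 - to_ref a b x ^+ 2))^-1 * (2 / (b - a)).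
  apply: (@integrable_derive_itv _ a b f F h (2 * M' * (pi / 2)) ab).
  + move=> x /andP[ax xb].
    by apply: continuous_V_to_ref; rewrite ?(gt_eqF ax) ?(lt_eqF xb).
  + move=> x xab; have x1 := to_ref_in ab xab.
    apply: cvgM; last exact: cvg_cst.
    apply: cvgM; first exact: cvg_cst.
    apply: cvgV; first by rewrite gt_eqF// sqrt_in_gt0.
    apply: (@continuous_to_ref_comp (fun y => Num.sqrt (1 - y ^+ 2))).
    exact: (has_derive_continuous (has_derive_sqrt_in x1)).
  + move=> x xab; have x1 := to_ref_in ab xab.
    apply: has_derive_eq.
      apply: has_deriveM; first exact: has_derive_cst.
      apply: (@has_derive_comp _ (fun y => atan (half_angle y)) (to_ref a b)).
        exact: has_derive_atan_half_angle.
      exact: has_derive_to_ref.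
    rewrite /h; move: (Num.sqrt _) (sqrt_in_gt0 x1) => s s0.
    by field; rewrite !gt_eqF// subr_gt0.
  + move=> x xab; have x1 := to_ref_in ab xab.
    rewrite /f /h normrM (gtr0_norm c0) normrM normr_nat /V x1 normrM normfV.
    rewrite (gtr0_norm (sqrt_in_gt0 x1)) ler_wpM2r ?(ltW c0)// -mulrA ler_wpM2l//.
    rewrite mulrC ler_wpM2r ?invr_ge0//.
    by have := hM (to_ref a b x); rewrite clamp_id// ltW.
  + move=> x _; rewrite /F normrM ger0_norm ?mulr_ge0// ler_wpM2l ?mulr_ge0//.
    have := @atan_ltpi2 R (half_angle (to_ref a b x)).
    by have := @atan_gtNpi2 R (half_angle (to_ref a b x)); rewrite ler_norml; lra.
- apply: (@integrable_derive_ray_right _ b f (fun=> 0) (fun=> 0) 0).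
  + by move=> x bx; apply: continuous_V_to_ref => //; rewrite gt_eqF// (lt_trans _ bx).
  + by move=> *; exact: cvg_cst.
  + by move=> *; exact: has_derive_cst.
  + move=> x bx; have x1 := to_ref_gt1 ab bx.
    by rewrite /f V0 ?mulr0 ?mul0r ?normr0// lter_normr x1.
  + by move=> *; rewrite normr0.
Qed.

Lemma half_laplacian_W a b n : a < b -> is_half_laplacian (W n \o to_ref a b)
  (fun x => n.+1%:R * Utilde2 n.+2 (to_ref a b x) * (2 / (b - a))).
Proof.
move=> ab; rewrite /is_half_laplacian asboolF; last exact: W_to_ref_neq.
have hu := holder_to_ref a b (@holder_W R n).
have hv := holder_to_ref a b (@holder_Ttilde R n.+1).2.
have du := decays_to_ref ab (@decays_W R n).
have cu := holder_continuous hu.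
split; first exact: decays_Lfun2.
have [L hL] := holder_holder_at hu.
apply: (@half_laplacian_of_hilbert _ [:: a; b] _ (Ttilde n.+1 \o to_ref a b) _ L) => //.
- by move=> x; exact: pv_W.
- exact: holder_continuous.
- exact/decays_to_ref/decays_Ttilde.
- move=> y; rewrite !inE negb_or => /andP[ya yb]; split.
    exact: continuous_Utilde2_to_ref.
  exact: has_derive_Ttilde_to_ref.
- exact: integrable_Utilde2_to_ref.
Qed.

Lemma half_laplacian_Ttilde a b n : a < b -> is_half_laplacian (Ttilde n.+1 \o to_ref a b)
  (fun x => n.+1%:R * V n.+1 (to_ref a b x) * (2 / (b - a))).
Proof.
move=> ab; rewrite /is_half_laplacian asboolF; last exact: Ttilde_to_ref_neq.
have hu := holder_to_ref a b (@holder_Ttilde R n.+1).2.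
have hv := holder_to_ref a b (@holder_W R n).
have du := decays_to_ref ab (@decays_Ttilde R n).
have cu := holder_continuous hu.
split; first exact: decays_Lfun2.
have [L hL] := holder_holder_at hu.
apply: (@half_laplacian_of_hilbert _ [:: a; b] _ (fun x => - W n (to_ref a b x)) _ L) => //.
- by move=> x; exact: pv_Ttilde.
- move=> x; apply: (@cvgN _ _ _ _ _ (W n \o to_ref a b)).
  exact: (@holder_continuous _ _ hv x).
- have [C hC] := decays_to_ref ab (@decays_W R n).
  by exists C => x; rewrite normrN; exact: hC.
- move=> y; rewrite !inE negb_or => /andP[ya yb]; split.
    exact: continuous_V_to_ref.
  apply: has_derive_eq; first exact/has_deriveN/has_derive_W_to_ref.
  by rewrite mulNr opprK.
- exact: integrable_V_to_ref.
Qed.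

End Columns.

(** * Block bookkeeping for the quasimatrices *)

Section Matrices.
Variable R : realType.
Local Notation nrow n := (\sum_(i < n.+3) 2)%N.
Implicit Types (P : (R -> R) -> (R -> R) -> Prop).

Lemma mulmx_castmx (T : pzRingType) m p p' q q' (ep : p = p') (eq : q = q')
    (u : 'M[T]_(m, p)) (M : 'M[T]_(p, q)) :
  castmx (erefl, ep) u *m castmx (ep, eq) M = castmx (erefl, eq) (u *m M).
Proof. by case: _ / ep; case: _ / eq; rewrite !castmx_id. Qed.

Lemma qeval_castmx p p' (e : p = p') (S : 'rV[R -> R]_p) x :
  qeval (castmx (erefl, e) S) x = castmx (erefl, e) (qeval S x).
Proof. by case: _ / e; rewrite !castmx_id. Qed.

Lemma qeval_row_mx p q (S : 'rV[R -> R]_p) (T : 'rV[R -> R]_q) x :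
  qeval (row_mx S T) x = row_mx (qeval S x) (qeval T x).
Proof. exact: map_row_mx. Qed.

Lemma qeval_mxrow p (q : 'I_p -> nat) (S : forall i, 'rV[R -> R]_(q i)) x :
  qeval (\mxrow_i S i) x = \mxrow_i qeval (S i) x.
Proof. by apply/matrixP => i j; rewrite !mxE. Qed.

(** The relation [P] between a column and its claimed image is left abstract in the column lemmas:
    equality, Hilbert transform, derivative and half Laplacian are substituted later, so the block
    structure is unfolded only once. *)
Lemma castmx_columns P p p' (e : p = p') (S : 'rV[R -> R]_p) 
    (T : R -> 'rV[R]_p) (T' : R -> 'rV[R]_p') :
  (forall x, T' x = castmx (erefl, e) (T x)) ->
  (forall j, P (S 0 j) (fun x => T x 0 j)) ->
  forall j, P (castmx (erefl, e) S 0 j) (fun x => T' x 0 j).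
Proof.
move=> /funext->; case: _ / e => PS j; rewrite castmx_id.
by under eq_fun => x do rewrite castmx_id.
Qed.

Lemma row_mx_columns P p q (S1 : 'rV[R -> R]_p) (S2 : 'rV[R -> R]_q)
    (T1 : R -> 'rV[R]_p) (T2 : R -> 'rV[R]_q) :
  (forall j, P (S1 0 j) (fun x => T1 x 0 j)) ->
  (forall j, P (S2 0 j) (fun x => T2 x 0 j)) ->
  forall j, P (row_mx S1 S2 0 j) (fun x => row_mx (T1 x) (T2 x) 0 j).
Proof.
move=> P1 P2 j; case: (split_ordP j) => {j} j ->.
  by under eq_fun => x do rewrite row_mxEl; rewrite row_mxEl.
by under eq_fun => x do rewrite row_mxEr; rewrite row_mxEr.
Qed.

Lemma mxrow_columns P p (q : 'I_p -> nat) (S : forall i, 'rV[R -> R]_(q i))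
    (T : forall i, R -> 'rV[R]_(q i)) :
  (forall i j, P (S i 0 j) (fun x => T i x 0 j)) ->
  forall j, P ((\mxrow_i S i) 0 j) (fun x => (\mxrow_i T i x) 0 j).
Proof.
move=> PS j; rewrite mxE; move: (PS (tagnat.sig1 j) (tagnat.sig2 j)).
by congr (P _ _); apply/funext => x; rewrite mxE.
Qed.

Lemma block_columns P (a b : R) n (B : 'I_n.+3 -> 'I_n.+1 -> 'M[R]_2) :
  (forall i : 'I_n.+1, P (W i \o to_ref a b) (fun x => \sum_(l < n.+3)
     (V l (to_ref a b x) * B l i 0 0 + Utilde2 l.+1 (to_ref a b x) * B l i 1 0))) ->
  (forall i : 'I_n.+1, P (Ttilde i.+1 \o to_ref a b) (fun x => \sum_(l < n.+3)
     (V l (to_ref a b x) * B l i 0 1 + Utilde2 l.+1 (to_ref a b x) * B l i 1 1))) ->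
  forall j, P (S0 a b n 0 j)
    (fun x => (qeval (S0star a b n) x *m \mxblock_(l, i) B l i) 0 j).
Proof.
move=> PW PT j.
pose i : 'I_n.+1 := tagnat.sig1 j; pose c : 'I_2 := tagnat.sig2 j.
have -> : S0 a b n 0 j = pair_row (W i \o to_ref a b) (Ttilde i.+1 \o to_ref a b) 0 c.
  by rewrite mxE.
rewrite (_ : (fun x => _) = fun x => \sum_(l < n.+3)
    (V l (to_ref a b x) * B l i 0 c + Utilde2 l.+1 (to_ref a b x) * B l i 1 c)).
  rewrite mxE; case: c => -[|[|//]] c2 /=.
    by rewrite (_ : Ordinal c2 = 0); [exact: PW|exact: val_inj].
  by rewrite (_ : Ordinal c2 = 1); [exact: PT|exact: val_inj].
apply/funext => x; rewrite qeval_mxrow mul_mxrow_mxblock mxE summxE.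
apply: eq_bigr => l _; rewrite mxE !big_ord_recl big_ord0 addr0 !mxE /=.
by rewrite (_ : lift ord0 ord0 = 1)//; exact: val_inj.
Qed.

Section Multi.
Variables (K : nat) (a b : 'I_K.+1 -> R) (n : 'I_K.+1 -> nat).
Local Notation nxt := (lift (@ord0 K)).
Variables (c : 'I_K.+1 -> 'M[R]_1) (g : forall k, 'cV[R]_(nrow (n k))).
Variable B : forall k, 'I_(n k).+3 -> 'I_(n k).+1 -> 'M[R]_2.
Local Arguments B : clear implicits.
Local Notation ref k := (to_ref (a k) (b k)).
Local Notation A := (fun k => block_mx (c k) 0 (g k) (\mxblock_(l, i) B k l i)).

(** The upper right block of each [A k] is zero, and [dagger] keeps only its 2 by 2 blocks, so [c]
    and [g] survive for the first interval alone. *)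
Lemma qeval_Smultistar_mul x :
  qeval (Smultistar a b n) x *m multi_diag A =
  castmx (erefl, multi_cols n) (row_mx
    (row_mx (const_mx (Utilde2 0 (ref ord0 x)) *m c ord0 +
             qeval (S0star (a ord0) (b ord0) (n ord0)) x *m g ord0)
            (qeval (S0star (a ord0) (b ord0) (n ord0)) x *m
               \mxblock_(l, i) B ord0 l i))
    (\mxrow_(k < K) (qeval (S0star (a (nxt k)) (b (nxt k)) (n (nxt k))) x *m
               \mxblock_(l, i) B (nxt k) l i))).
Proof.
rewrite /Smultistar /multi_diag qeval_castmx mulmx_castmx; congr castmx.
rewrite !qeval_row_mx mul_row_block !mulmx0 addr0 add0r mul_row_block mulmx0 add0r.
congr (row_mx (row_mx (_ *m _ + _) _) _).
  by apply/matrixP => i j; rewrite !mxE.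
rewrite qeval_mxrow mul_mxrow_mxblock; apply: eq_mxrow => k.
rewrite (bigD1 k)//= eqxx [X in _ + X]big1 ?addr0 => [|i /negPf ->]; last by rewrite mulmx0.
congr (_ *m _); apply: etrans (conform_mx_id _ _) _; exact: block_mxKdr.
Qed.

Lemma multi_columns P :
  P (Ttilde 0) (fun x => Utilde2 0 (ref ord0 x) * c ord0 0 0 +
    (qeval (S0star (a ord0) (b ord0) (n ord0)) x *m g ord0) 0 0) ->
  (forall k (i : 'I_(n k).+1), P (W i \o ref k) (fun x => \sum_(l < (n k).+3)
     (V l (ref k x) * B k l i 0 0 + Utilde2 l.+1 (ref k x) * B k l i 1 0))) ->
  (forall k (i : 'I_(n k).+1), P (Ttilde i.+1 \o ref k) (fun x => \sum_(l < (n k).+3)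
     (V l (ref k x) * B k l i 0 1 + Utilde2 l.+1 (ref k x) * B k l i 1 1))) ->
  forall j, P (Smulti a b n 0 j)
    (fun x => (qeval (Smultistar a b n) x *m multi_diag A) 0 j).
Proof.
move=> P0 PW PT j.
have PB k := block_columns (PW k) (PT k).
apply: (castmx_columns qeval_Smultistar_mul); apply: row_mx_columns.
  apply: row_mx_columns => [i|]; last exact: PB.
  rewrite ord1 mxE; move: P0; congr (P _ _); apply/funext => x.
  by rewrite [RHS]mxE; congr (_ + _); rewrite mxE big_ord1 mxE.
apply: (@mxrow_columns P K _ (fun k => S0 (a (nxt k)) (b (nxt k)) (n (nxt k)))
  (fun k x => qeval (S0star (a (nxt k)) (b (nxt k)) (n (nxt k))) x *m
     \mxblock_(l, i) B (nxt k) l i)) => k; exact: PB.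
Qed.

End Multi.

Lemma sum_block_pair n (k : 'I_n.+1) (F : nat -> 'M[R]_2 -> R) (X Y : 'M[R]_2) :
  (forall l, F l 0 = 0) ->
  \sum_(l < n.+3) F l (if l == k :> nat then X else if l == k.+2 :> nat then Y else 0)
  = F k X + F k.+2 Y.
Proof.
move=> F0; have k3 : (k < n.+3)%N by rewrite (leq_trans (ltn_ord k)) // leqW.
have k2 : (k.+2 < n.+3)%N by rewrite !ltnS -ltnS.
rewrite (bigD1 (Ordinal k3))//= eqxx (bigD1 (Ordinal k2))/=; last first.
  by rewrite -val_eqE /= eqn_leq ltnNge leqnSn.
rewrite eqxx gtn_eqF// big1 ?addr0// => l /andP[/negPf h1 /negPf h2].
by move: h1 h2; rewrite -!val_eqE /= => -> ->; exact: F0.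
Qed.

Lemma sum_block_single n (k : 'I_n.+1) (F : nat -> 'M[R]_2 -> R) (X : 'M[R]_2) :
  (forall l, F l 0 = 0) ->
  \sum_(l < n.+3) F l (if l == k.+1 :> nat then X else 0) = F k.+1 X.
Proof.
move=> F0; have k1 : (k.+1 < n.+3)%N by rewrite ltnS leqW.
rewrite (bigD1 (Ordinal k1))//= eqxx big1 ?addr0// => l /negPf.
by rewrite -val_eqE /= => ->; exact: F0.
Qed.

Lemma sum_EH y n (k : 'I_n.+1) (X : 'M[R]_2) c :
  \sum_(l < n.+3) (
    V l y * (if l == k :> nat then - (2^-1 *: X)
             else if l == k.+2 :> nat then 2^-1 *: X else 0) 0 c +
    Utilde2 l.+1 y * (if l == k :> nat then - (2^-1 *: X)
             else if l == k.+2 :> nat then 2^-1 *: X else 0) 1 c) =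
  ((V k.+2 y - V k y) * X 0 c + (Utilde2 k.+3 y - Utilde2 k.+1 y) * X 1 c) / 2.
Proof.
rewrite (sum_block_pair k (F := fun l M => V l y * M 0 c + Utilde2 l.+1 y * M 1 c)).
  by rewrite !mxE; ring.
by move=> l; rewrite !mxE !mulr0 addr0.
Qed.

Lemma sum_DA y n (k : 'I_n.+1) d (X : 'M[R]_2) c :
  \sum_(l < n.+3) (
    V l y * (if l == k.+1 :> nat then d *: X else 0) 0 c +
    Utilde2 l.+1 y * (if l == k.+1 :> nat then d *: X else 0) 1 c) =
  d * (V k.+1 y * X 0 c + Utilde2 k.+2 y * X 1 c).
Proof.
rewrite (sum_block_single k (F := fun l M => V l y * M 0 c + Utilde2 l.+1 y * M 1 c)).
  by rewrite !mxE; ring.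
by move=> l; rewrite !mxE !mulr0 addr0.
Qed.

End Matrices.
Theorem proposition4p5 (R : realType) (K : nat)
    (a b : 'I_K.+1 -> R) (n : 'I_K.+1 -> nat)
    (hab : forall k, a k < b k)
    (hI : forall k l, k != l ->
       is_subset1 (`[a k, b k]%classic `&` `[a l, b l]%classic)) :
  [/\ forall x : R,
        qeval (Smulti a b n) x = qeval (Smultistar a b n) x *m Emulti R n,
      forall (x : R) j,
        is_hilbert (Smulti a b n 0 j) x
          ((qeval (Smultistar a b n) x *m Hmulti R n) 0 j),
      forall (x : R) j, (forall k, x != a k /\ x != b k) ->
        is_derive x (1 : R) (Smulti a b n 0 j)
          ((qeval (Smultistar a b n) x *m Dmulti a b n) 0 j)
    & forall j, exists2 f : R -> R,
        is_half_laplacian (Smulti a b n 0 j) f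
      & forall x : R, (forall k, x != a k /\ x != b k) ->
          f x = (qeval (Smultistar a b n) x *m Amulti a b n) 0 j].
Proof.
have N00 : matN R 0 0 = -1 by rewrite mxE.
have N10 : matN R 1 0 = 0 by rewrite mxE.
have N01 : matN R 0 1 = 0 by rewrite mxE.
have N11 : matN R 1 1 = 1 by rewrite mxE.
have M00 : matM R 0 0 = 0 by rewrite mxE.
have M10 : matM R 1 0 = 1 by rewrite mxE.
have M01 : matM R 0 1 = 1 by rewrite mxE.
have M11 : matM R 1 1 = 0 by rewrite mxE.
have T0 : @Ttilde R 0 = cst 1 by apply/funext => x; rewrite Ttilde0.
split.
- move=> x; apply/rowP => j; rewrite [LHS]mxE; move: j x.
  apply: (@multi_columns R K a b n (fun=> (-1)%:M)
    (fun k => \mxcol_(i < (n k).+3) (if i == 1%N :> nat then delta_mx 1 0 else 0))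
    (fun k i l => if i == l :> nat then - (2^-1 *: matN R)
        else if i == l.+2 :> nat then 2^-1 *: matN R else 0)
    (fun f g => forall x, f x = g x)).
  (* The first column says -U_{-2} + U_0 = [Ttilde 0]: the entry in block row 1 selects [Utilde2 2],
     which is U_0. *)
  + move=> x; rewrite qeval_mxrow mul_mxrow_mxcol summxE.
    have i1 : (1 < (n ord0).+3)%N by [].
    rewrite (bigD1 (Ordinal i1))//= big1 => [|i]; last first.
      by rewrite -val_eqE /= => /negPf->; rewrite mulmx0 mxE.
    rewrite addr0 [X in _ * X + _]mxE [X in _ + X]mxE big_ord_recl big_ord1 !mxE /=.
    by rewrite !Ttilde0; move: (if _ then _ else _) => u; ring.
  + by move=> k i x; rewrite sum_EH N00 N10; apply: etrans (W_V _ _) _; ring.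
  + by move=> k i x; rewrite sum_EH N01 N11; apply: etrans (Ttilde_Utilde2 _ _) _; ring.
- move=> x j; move: j x.
  apply: (@multi_columns R K a b n (fun=> 0) (fun=> 0)
    (fun k i l => if i == l :> nat then - (2^-1 *: matM R)
        else if i == l.+2 :> nat then 2^-1 *: matM R else 0)
    (fun f g => forall x, is_hilbert f x (g x))).
  + by move=> x; rewrite mulmx0 !mxE mulr0 addr0 /is_hilbert asboolT.
  + move=> k i x; rewrite sum_EH M00 M10 mulr0 mulr1 add0r -Ttilde_Utilde2.
    exact: hilbert_W.
  + move=> k i x; rewrite sum_EH M01 M11 mulr0 mulr1 addr0.
    (* The difference V_{k+2} - V_k is opposite to the one in [W_V], which produces the minus sign
       in the transform of [Ttilde]. *)
    by rewrite -opprB mulNr -W_V; exact: hilbert_Ttilde.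
- move=> x j; move: j x.
  apply: (@multi_columns R K a b n (fun=> 0) (fun=> 0)
    (fun k i l => if i == l.+1 :> nat
        then (2 * l.+1%:R / (b k - a k)) *: matN R else 0)
    (fun f g => forall x, (forall k, x != a k /\ x != b k) ->
       is_derive x (1 : R) f (g x))).
  + by move=> x _; rewrite mulmx0 !mxE mulr0 addr0 T0; exact: is_derive_cst.
  + move=> k i x /(_ k)[xa xb]; rewrite sum_DA N00 N10.
    apply: (has_derive_eq (has_derive_W_to_ref i (hab k) xa xb)).
    by rewrite mulr0 addr0 mulrN1; ring.
  + move=> k i x /(_ k)[xa xb]; rewrite sum_DA N01 N11.
    apply: (has_derive_eq (has_derive_Ttilde_to_ref i (hab k) xa xb)).
    by ring.
- apply: (@multi_columns R K a b n (fun=> 0) (fun=> 0)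
    (fun k i l => if i == l.+1 :> nat
        then (2 * l.+1%:R / (b k - a k)) *: matM R else 0)
    (fun f g => exists2 h, is_half_laplacian f h &
       forall x, (forall k, x != a k /\ x != b k) -> h x = g x)).
  + exists (cst 0); first by rewrite /is_half_laplacian asboolT.
    by move=> x _; rewrite mulmx0 !mxE mulr0 addr0.
  + move=> k i; exists (fun x => i.+1%:R * Utilde2 i.+2 (to_ref (a k) (b k) x) *
      (2 / (b k - a k))); first exact: half_laplacian_W.
    by move=> x _; rewrite sum_DA M00 M10; ring.
  + move=> k i; exists (fun x => i.+1%:R * V i.+1 (to_ref (a k) (b k) x) *
      (2 / (b k - a k))); first exact: half_laplacian_Ttilde.
    by move=> x _; rewrite sum_DA M01 M11; ring.
Qed.
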